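(* Let $\nu>-1$ and $0<\beta<2j_{\nu,1}$, let $\mathfrak{L}_{\nu,\beta}$ be the Lommel ensemble, let $P_m$ be its monic orthogonal polynomials, and write $\|P_m\|^2=\int P_m^2\,d\mathfrak{L}_{\nu,\beta}$. Let $\mu_{\nu,\beta}=\Lambda\mathfrak{L}_{\nu,\beta}$ be its arcsin lift, with monic orthogonal polynomials $\Phi_m$, monic prediction errors $E_m(\mu_{\nu,\beta})$ and Toeplitz determinants $D_N=D_N(\mu_{\nu,\beta})$. Put $$A_m^2=\frac{\beta^2}{4(\nu+m)(\nu+m+1)}\quad(m\ge1),\qquad t_0=2,\qquad t_m=2-\frac{\beta^2}{4(\nu+m)(\nu+m+1)\,t_{m-1}}\quad(m\ge1).$$ Then for every $m\ge0$ $$\|P_m\|^2=\frac{\beta^2}{2(\nu+1)}\Bigl(\frac{\beta}{2}\Bigr)^{2m}\frac{\Gamma(\nu+1)\Gamma(\nu+2)}{\Gamma(\nu+m+1)\Gamma(\nu+m+2)},$$ $$E_m(\mu_{\nu,\beta})=\frac{t_m}{2}\cdot\frac{\beta^2}{2(\nu+1)}\Bigl(\frac{\beta}{2}\Bigr)^{2m}\frac{\Gamma(\nu+1)\Gamma(\nu+2)}{\Gamma(\nu+m+1)\Gamma(\nu+m+2)},\qquad \Phi_m(0)=(-1)^m(t_m-1).$$ Moreover: (i) $$\prod_{m=1}^\infty\frac{t_m}{2}=\Gamma(\nu+1)\Bigl(\frac{4}{\beta}\Bigr)^{\nu}J_\nu\Bigl(\frac{\beta}{2}\Bigr)=:\mathcal{J}_{\nu,\beta}\in(0,1),$$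 and for every $N\ge0$ $$D_N=\frac{P_{N+1}(2)}{2^{N+1}}\prod_{m=0}^N\|P_m\|^2,\qquad\text{with}\qquad \frac{P_{N+1}(2)}{2^{N+1}}\longrightarrow\mathcal{J}_{\nu,\beta}\ \text{ as }N\to\infty.$$ (ii) If $$\beta^2<\frac{32(\nu+1)(\nu+2)}{\nu+3},$$ then $t_1<t_2<\cdots$; $P_{m+1}(2)P_{m-1}(2)>P_m(2)^2$ for every $m\ge2$, while $P_2(2)P_0(2)<P_1(2)^2$; for every $m\ge2$, $1-\Phi_m(0)^2=A_m^2\,t_m/t_{m-1}>A_m^2$; and the numbers $\log(t_m/t_{m-1})$, $m\ge2$, are positive and summable with $\sum_{m\ge2}\log(t_m/t_{m-1})=\log\bigl(4/(4-A_1^2)\bigr)$. (iii) As $m\to\infty$ (with implied constants depending on $\nu$ and $\beta$), $$\log\frac{1-\Phi_m(0)^2}{A_m^2}=\log\frac{t_m}{t_{m-1}}=\frac{\beta^2}{8(\nu+m-1)(\nu+m)(\nu+m+1)}\bigl(1+O(m^{-2})\bigr),$$ and $2-t_m=\tfrac12A_m^2\bigl(1+O(m^{-2})\bigr)$; for all sufficiently large $m$ one has $t_m>1$ and $1-|\Phi_m(0)|=2-t_m$, so that $$1-|\Phi_m(0)|=\frac{\beta^2}{8(\nu+m)(\nu+m+1)}\bigl(1+O(m^{-2})\bigr).$$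
   Context: For $\nu>-1$, $J_\nu$ is the Bessel function of the first kind and $0<j_{\nu,1}<j_{\nu,2}<\cdots$ are its positive zeros. For $0<\beta<2j_{\nu,1}$ the Lommel ensemble $\mathfrak{L}_{\nu,\beta}$ is the purely atomic symmetric measure on $\mathbb{R}$ placing mass $(\beta/j_{\nu,k})^2$ at each of the points $\beta/j_{\nu,k}$ and $-\beta/j_{\nu,k}$, $k\ge1$. It is finite and its support is a compact infinite subset of $(-2,2)$. Arcsin lift: for a finite positive symmetric measure $\sigma$ on $\mathbb{R}$ with $\operatorname{supp}\sigma\subset(-2,2)$, $\Lambda\sigma$ is the measure on the unit circle $\partial\mathbb{D}$ that is the pushforward of $\sigma$ under $\Psi:(-2,2)\to\partial\mathbb{D}\setminus\{-1\}$, $\Psi(x)=e^{i\theta(x)}$, $\theta(x)=2\arcsin(x/2)$. For a finite positive measure $\mu$ on $\partial\mathbb{D}$ with infinite support, $E_m(\mu)=\min\int_{\partial\mathbb{D}}|\Phi|^2\,d\mu$ over monic complex polynomials $\Phi$ of degree $m$; the unique minimizer is the monic orthogonal polynomial $\Phi_m$. The Toeplitz determinants are $D_N(\mu)=\det[c_{j-k}]_{j,k=0}^N$, $c_k=\int_{\partial\mathbb{D}}z^{-k}\,d\mu$. *)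

(* Defs.v *)
From HB Require Import structures.
From mathcomp Require Import all_boot all_order all_algebra.
From mathcomp Require Import all_classical all_reals all_analysis.
From mathcomp Require Import measurable_realfun complex.

Set Implicit Arguments.
Unset Strict Implicit.
Unset Printing Implicit Defensive.

Import Order.TTheory GRing.Theory Num.Theory.
Import numFieldNormedType.Exports.

Local Open Scope classical_set_scope.
Local Open Scope ring_scope.

(** * Gamma and Bessel functions *)

(* Euler's integral, for 0 < x. *)
Definition Gamma {R : realType} (x : R) : R :=
  \int[lebesgue_measure]_(t in `]0, +oo[) (t `^ (x - 1) * expR (- t)).

(* J_nu(x) for -1 < nu and 0 < x; all Gamma arguments are then positive. *)
Definition besselJ {R : realType} (nu x : R) : R :=
  limn (series (fun k : nat =>
    (-1) ^+ k / (k`!%:R * Gamma (nu + k%:R + 1)) * (x / 2) `^ (nu + (2 * k)%:R))).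

(* For 1 <= k, bessel_zero nu k is the k-th positive zero j_{nu,k}: the positive
   zeros of J_nu are unbounded and have no accumulation point in [0, +oo[, so
   every infimum below is attained.  The value 0 at k = 0 starts the recursion. *)
Fixpoint bessel_zero {R : realType} (nu : R) (k : nat) : R :=
  if k is k'.+1 then inf [set x | bessel_zero nu k' < x /\ besselJ nu x = 0]
  else 0.

(** * The Lommel ensemble *)

Definition lommel_atoms {R : realType} (nu beta : R) (k : nat) :
    {measure set R -> \bar R} :=
  let a := beta / bessel_zero nu k in
  let w := NngNum (sqr_ge0 a) in
  measure_add (mscale w (dirac a)) (mscale w (dirac (- a))).

Definition lommel_ensemble {R : realType} (nu beta : R) :
    {measure set R -> \bar R} :=
  mseries (lommel_atoms nu beta) 1.

(** * Measures on the unit circle and the arcsin lift *)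

Definition complex_pair {R : realType} (z : R[i]) : R * R :=
  (complex.Re z, complex.Im z).

(* C carries the Borel sigma-algebra of R * R; measures on the unit circle are
   measures on C, always integrated over unit_circle. *)
HB.instance Definition _ (R : realType) := isPointed.Build R[i] 0.

Definition complex_borel (R : realType) : set (set R[i]) :=
  <<s preimage_set_system setT (@complex_pair R) measurable >>.

HB.instance Definition _ (R : realType) :=
  @isMeasurable.Build default_measure_display R[i] (@complex_borel R)
    (@sigma_algebra0 _ setT _) (@sigma_algebraC _ _)
    (@sigma_algebra_bigcup _ setT _).

Definition unit_circle {R : realType} : set R[i] := [set z | `|z| = 1].

Definition arcsin_map {R : realType} (x : R) : R[i] :=
  let theta := 2 * asin (x / 2) in (cos theta +i* sin theta)%C.

Lemma measurable_asin {R : realType} : measurable_fun setT (@asin R).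
Proof.
pose I : set R := `]-1, 1[%classic.
have -> : [set: R] = I `|` ([set -1] `|` ([set 1] `|` ~` `[-1, 1]%classic)).
  apply/seteqP; split => // x _; rewrite /I /= !in_itv /=.
  have [xN1|xN1|->] := ltgtP x (-1); last by right; left.
    by right; right; right.
  by have [x1|x1|->] := ltgtP x 1; [left|right; right; right|right; right; left].
have mC : measurable (~` `[-1, 1]%classic : set R) by exact: measurableC.
have mU1 : measurable ([set 1] `|` ~` `[-1, 1]%classic : set R) by exact: measurableU.
have mU2 : measurable ([set -1] `|` ([set 1] `|` ~` `[-1, 1]%classic) : set R).
  exact: measurableU.
apply/(measurable_funU _ _ mU2); first exact: measurable_itv.
split.
  apply: open_continuous_measurable_fun => //.
  by move=> x; rewrite inE /I /= in_itv /= => /continuous_asin.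
apply/(measurable_funU _ _ mU1) => //; split; first exact: measurable_fun_set1.
apply/(measurable_funU _ _ mC) => //; split; first exact: measurable_fun_set1.
have m0 : measurable_fun (~` `[-1, 1]%classic : set R) (fun=> 0 : R).
  exact: measurable_cst.
apply: eq_measurable_fun m0.
move=> x; rewrite inE /= in_itv /= => x1.
rewrite unlock /asin; case: xgetP => [y _ [_ yx]|//].
by case: x1; rewrite -yx sin_geN1 sin_le1.
Qed.

Lemma measurable_arcsin_map {R : realType} :
  measurable_fun setT (@arcsin_map R).
Proof.
have mtheta : measurable_fun setT (fun x : R => 2 * asin (x / 2)).
  apply: measurable_funM; first exact: measurable_cst.
  apply: (measurableT_comp measurable_asin).
  by apply: measurable_funM => //; exact: measurable_cst.
have mp : measurable_fun setT (@complex_pair R \o arcsin_map).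
  apply: measurable_fun_pair.
    apply: (measurableT_comp _ mtheta); apply: continuous_measurable_fun.
    exact: continuous_cos.
  apply: (measurableT_comp _ mtheta); apply: continuous_measurable_fun.
  exact: continuous_sin.
apply: (@measurability _ _ _ _ _ _
  (preimage_set_system setT (@complex_pair R) measurable)) => //.
move=> _ [_ [B mB <-] <-]; rewrite !setTI -comp_preimage.
by rewrite -[X in measurable X]setTI; exact: mp.
Qed.

(* The restriction to ]-2, 2[ only matters when sigma charges its complement. *)
Definition arcsin_lift {R : realType} (sigma : {measure set R -> \bar R}) :
    set R[i] -> \bar R :=
  pushforward (mrestr sigma (measurable_itv `]-2, 2[)) arcsin_map.

Section arcsin_lift_measure.
Context {R : realType} (sigma : {measure set R -> \bar R}).

Let m : {measure set R[i] -> \bar R} :=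
  measure_function_pushforward__canonical__measure_function_Measure
    (mrestr sigma (measurable_itv `]-2, 2[)) measurable_arcsin_map.

HB.instance Definition _ := isMeasure.Build _ _ _ (arcsin_lift sigma)
  (measure0 m) (measure_ge0 m) (@measure_semi_sigma_additive _ _ _ m).

End arcsin_lift_measure.

Definition complex_integral {R : realType} (mu : {measure set R[i] -> \bar R})
    (f : R[i] -> R[i]) : R[i] :=
  ((\int[mu]_(z in unit_circle) complex.Re (f z)) +i*
   (\int[mu]_(z in unit_circle) complex.Im (f z)))%C.

(** * Orthogonal polynomials, prediction errors, Toeplitz determinants *)

Definition monic_of_degree (K : nzRingType) (m : nat) : set {poly K} :=
  [set Q | Q \is monic /\ size Q = m.+1].

Definition is_monic_oprl {R : realType} (sigma : {measure set R -> \bar R})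
    (m : nat) (P : {poly R}) : Prop :=
  monic_of_degree m P /\
  forall Q : {poly R}, (size Q <= m)%N -> \int[sigma]_x (P.[x] * Q.[x]) = 0.

(* The monic orthogonal polynomial of degree m; it exists and is unique when
   sigma has finite moments and infinite support. *)
Definition monic_oprl {R : realType} (sigma : {measure set R -> \bar R})
    (m : nat) : {poly R} :=
  xget 0 [set P | is_monic_oprl sigma m P].

Definition is_monic_opuc {R : realType} (mu : {measure set R[i] -> \bar R})
    (m : nat) (Phi : {poly R[i]}) : Prop :=
  monic_of_degree m Phi /\
  forall Q : {poly R[i]}, (size Q <= m)%N ->
    complex_integral mu (fun z => Phi.[z] * (Q.[z])^*) = 0.

Definition monic_opuc {R : realType} (mu : {measure set R[i] -> \bar R})
    (m : nat) : {poly R[i]} :=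
  xget 0 [set Phi | is_monic_opuc mu m Phi].

(* The minimum of S, when S has one. *)
Definition minimum {R : realType} (S : set R) : R :=
  xget 0 [set e | S e /\ lbound S e].

(* Norms in R[i] are complex numbers with zero imaginary part. *)
Definition prediction_error {R : realType} (mu : {measure set R[i] -> \bar R})
    (m : nat) : R :=
  minimum [set \int[mu]_(z in unit_circle) complex.Re (`|Q.[z]| ^+ 2)
          | Q in @monic_of_degree R[i] m].

Definition toeplitz_moment {R : realType} (mu : {measure set R[i] -> \bar R})
    (k : int) : R[i] :=
  complex_integral mu (fun z => z ^ (- k)).

Definition toeplitz_det {R : realType} (mu : {measure set R[i] -> \bar R})
    (N : nat) : R[i] :=
  \det (\matrix_(j < N.+1, k < N.+1) toeplitz_moment mu (j%:Z - k%:Z)).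

(** * Auxiliary sequences *)

Definition lommel_A2 {R : realType} (nu beta : R) (m : nat) : R :=
  beta ^+ 2 / (4 * (nu + m%:R) * (nu + m%:R + 1)).

Fixpoint lommel_t {R : realType} (nu beta : R) (m : nat) : R :=
  if m is m'.+1 then
    2 - beta ^+ 2 / (4 * (nu + m%:R) * (nu + m%:R + 1) * lommel_t nu beta m')
  else 2.

(* f m = g m * (1 + O(m ^ -2)) as m tends to infinity. *)
Definition eq_up_to_O2 {R : realType} (f g : nat -> R) : Prop :=
  exists eps : nat -> R,
    eps =O_\oo (fun m => (m%:R : R) ^- 2) /\
    \forall m \near \oo, f m = g m * (1 + eps m).

(* Main.v *)
Require Import Defs.
From HB Require Import structures.
From mathcomp Require Import all_boot all_order all_algebra.
From mathcomp Require Import all_classical all_reals all_analysis.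
From mathcomp Require Import measurable_realfun complex.
From mathcomp Require Import polyrcf ring lra zify.

Set Implicit Arguments.
Unset Strict Implicit.
Unset Printing Implicit Defensive.

Import Order.TTheory GRing.Theory Num.Theory.
Import numFieldNormedType.Exports.

Local Open Scope classical_set_scope.
Local Open Scope ring_scope.

(* Let P_(n+1) = x P_n - A_n^2 P_(n-1).  In the variable w = 1 / x^2 the P_n
   converge, dominated coefficientwise, to F_nu = 0F1(; nu + 1; - beta^2 w / 4),
   which is J_nu up to an elementary factor, and by interlacing every zero of P_n
   moves monotonically outwards, to some beta / j_(nu,k).  In the limit, Newton's
   identities express the moments of the Lommel ensemble through
   F_(nu+1) / F_nu; the contiguous relation between F_(nu+m), F_(nu+m+1) and
   F_(nu+m+2) then yields the orthogonality of the P_n and their norms.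

   On the circle, cos (j theta(x)) is up to sign a Chebyshev polynomial in x, so
   orthogonality transfers to W_(m+1) = (z - 1) W_m + A_m^2 z W_(m-1).  The
   relations z Phi_m - (-1)^m Phi_m^* = W_(m+1) and
   Phi_m + (-1)^m Phi_m^* = t_m W_m amount to the Szego recurrence with
   coefficients (-1)^m (t_m - 1).

   Since t_m = P_(m+1)(2) / P_m(2), the products and the sum telescope; the
   asymptotics come from bootstrapping the linear recursion satisfied by
   t_m - t_(m-1). *)

(** * Jacobi polynomials and the interlacing of their zeros *)

(** The proof uses no differential equation and no complex analysis; real arguments stand in for
    Hurwitz's theorem and for the product expansion of J_nu. Three things could go wrong when the
    zeros of the P_n pass to the limit: mass could be lost from the power sums, neighbouring zeros
    could merge, and F_nu could have a zero that is not such a limit. Each must be excluded before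
    the k-th limit can be matched with j_(nu,k), which is defined as an infimum.

    Beyond that, the ensemble matters only through the functional p -> int p dL: orthogonality on
    the line and on the circle is algebra on its moments, and the symmetry of L makes the moments on
    the circle real, so that real polynomials suffice there.

    The bound beta < 2 j_(nu,1) says that 2 lies to the right of all atoms. This gives P_n(2) > 0,
    hence t_m > 0, and a nonzero limit of P_n(2) / 2^n. The convergence t_m -> 2 is a consequence of
    that limit and is not drawn from the nonlinear recursion for t_m. *)

Section jacobi_poly.
Context {R : comNzRingType} (A : nat -> R).

Fixpoint jacobi_poly (n : nat) : {poly R} :=
  if n is n'.+1 then
    if n' is n''.+1 then 'X * jacobi_poly n' - A n' *: jacobi_poly n'' else 'X
  else 1.

Lemma jacobi_polySS n : jacobi_poly n.+2 =
  'X * jacobi_poly n.+1 - A n.+1 *: jacobi_poly n.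
Proof. by []. Qed.

Lemma jacobi_poly_ind (Q : nat -> Prop) :
  Q 0%N -> Q 1%N -> (forall n, Q n -> Q n.+1 -> Q n.+2) -> forall n, Q n.
Proof.
move=> Q0 Q1 QSS n.
suff: Q n /\ Q n.+1 by case.
by elim: n => [//|n [Qn Qn1]]; split=> //; exact: QSS.
Qed.

Lemma jacobi_poly_monic_size n :
  jacobi_poly n \is monic /\ size (jacobi_poly n) = n.+1.
Proof.
elim/jacobi_poly_ind: n => [||n [mn sn] [mn1 sn1]].
- by rewrite monic1 size_poly1.
- by rewrite monicX size_polyX.
have sX : size ('X * jacobi_poly n.+1) = n.+3.
  by rewrite mulrC size_mulX ?sn1// -size_poly_eq0 sn1.
have lt : (size (- (A n.+1 *: jacobi_poly n))
    < size ('X * jacobi_poly n.+1)%R)%N.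
  by rewrite size_polyN sX (leq_ltn_trans (size_scale_leq _ _)) ?sn.
rewrite jacobi_polySS; split; last by rewrite size_polyDl.
by rewrite monicE lead_coefDl// lead_coef_Mmonic// lead_coefX.
Qed.

Lemma jacobi_poly_monic n : jacobi_poly n \is monic.
Proof. by have [] := jacobi_poly_monic_size n. Qed.

Lemma size_jacobi_poly n : size (jacobi_poly n) = n.+1.
Proof. by have [] := jacobi_poly_monic_size n. Qed.

Lemma horner_jacobi_polyN n x :
  (jacobi_poly n).[- x] = (- 1) ^+ n * (jacobi_poly n).[x].
Proof.
elim/jacobi_poly_ind: n => [||n ihn ihn1].
- by rewrite /= ?hornerE ?expr0 ?expr1 ?mul1r ?mulN1r ?mulr1.
- by rewrite /= ?hornerE ?expr0 ?expr1 ?mul1r ?mulN1r ?mulr1.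
by rewrite jacobi_polySS !hornerE ihn ihn1 !exprS; ring.
Qed.

(* [jacobi_poly n] has the parity of [n]; this is [x ^ n * p (1 / x)] as a
   polynomial in [x ^ 2]. *)
Fixpoint reversed_jacobi_poly (n : nat) : {poly R} :=
  if n is n'.+1 then
    if n' is n''.+1 then
      reversed_jacobi_poly n' - A n' *: ('X * reversed_jacobi_poly n'') else 1
  else 1.

Lemma reversed_jacobi_polySS n : reversed_jacobi_poly n.+2 =
  reversed_jacobi_poly n.+1 - A n.+1 *: ('X * reversed_jacobi_poly n).
Proof. by []. Qed.

End jacobi_poly.

Lemma horner_reversed_jacobi_poly {K : fieldType} (A : nat -> K) n x : x != 0 ->
  (jacobi_poly A n).[x] = x ^+ n * (reversed_jacobi_poly A n).[x ^- 2].
Proof.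
move=> x0; elim/jacobi_poly_ind: n => [||n ihn ihn1].
- by rewrite /= ?hornerE ?expr0 ?expr1 ?mul1r ?mulN1r ?mulr1.
- by rewrite /= ?hornerE ?expr0 ?expr1 ?mul1r ?mulN1r ?mulr1.
rewrite jacobi_polySS reversed_jacobi_polySS.
rewrite !(hornerD, hornerN, hornerZ, hornerM, hornerX) ihn ihn1.
set a := horner _ _; set b := horner _ _; rewrite -addn2 -addn1 !exprD.
by field.
Qed.

Section interlacing.
Context {R : realType} (A : nat -> R).
Context (A_gt0 : forall n, 0 < A n.+1).

Let P := jacobi_poly A.

(** Zeros are numbered from the largest one, so that the index [k] keeps its meaning when the degree
    grows and [u k < v k] is monotonicity in the degree. *)
Definition interlacing (n : nat) (u v : nat -> R) : Prop :=
  forall k, (k < n)%N -> v k.+1 < u k < v k.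

Lemma decreasing_lt (n : nat) (u : nat -> R) :
  (forall k, (k.+1 < n)%N -> u k.+1 < u k) ->
  forall i j, (i < j < n)%N -> u j < u i.
Proof.
move=> h i; elim=> [//|j ih] /andP[]; rewrite ltnS leq_eqVlt => /orP[/eqP->|ij] jn.
  exact: h.
by rewrite (lt_trans (h _ jn))// ih// ij ltnW.
Qed.

Lemma decreasing_le (n : nat) (u : nat -> R) :
  (forall k, (k.+1 < n)%N -> u k.+1 < u k) ->
  forall i j, (i <= j < n)%N -> u j <= u i.
Proof.
move=> h i j /andP[]; rewrite leq_eqVlt => /orP[/eqP->//|ij] jn.
by rewrite ltW// (decreasing_lt h)// ij.
Qed.

Lemma interlacing_decr n u v : interlacing n u v ->
  forall k, (k.+1 < n.+1)%N -> v k.+1 < v k.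
Proof. by move=> uv k kn; have /andP[/lt_trans] := uv k kn; exact. Qed.

Lemma prod_sign (n k : nat) (f : nat -> R) : (k <= n)%N ->
  (forall i, (i < k)%N -> f i < 0) ->
  (forall i, (k <= i < n)%N -> 0 < f i) ->
  0 < (-1) ^+ k * \prod_(0 <= i < n) f i.
Proof.
move=> kn neg pos; rewrite (@big_cat_nat _ _ _ k)//= mulrA mulr_gt0//.
  have -> : (-1 : R) ^+ k = \prod_(0 <= i < k) (-1) by rewrite prodr_const_nat subn0.
  rewrite -big_split /= big_nat; apply: prodr_gt0 => i /andP[_ ik].
  by rewrite mulN1r oppr_gt0 neg.
by rewrite big_nat; apply: prodr_gt0 => i; exact: pos.
Qed.

Lemma monic_root_prod (n : nat) (p : {poly R}) (w : nat -> R) :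
  p \is monic -> size p = n.+1 ->
  (forall k, (k < n)%N -> root p (w k)) ->
  (forall k, (k.+1 < n)%N -> w k.+1 < w k) ->
  p = \prod_(0 <= k < n) ('X - (w k)%:P).
Proof.
move=> pm sp rw wd.
rewrite (@all_roots_prod_XsubC _ p (map w (iota 0 n))).
- by rewrite (monicP pm) scale1r big_map /index_iota subn0.
- by rewrite size_map size_iota.
- by apply/allP => _ /mapP[k + ->]; rewrite mem_iota => /rw.
rewrite uniq_rootsE map_inj_in_uniq ?iota_uniq// => i j.
rewrite !mem_iota !add0n /= => iN jN eij.
by case: (ltngtP i j) => // ij; have := decreasing_lt wd (i := _) (j := _);
  [move=> /(_ i j); rewrite ij jN eij ltxx => /(_ isT)
  |move=> /(_ j i); rewrite ij iN eij ltxx => /(_ isT)].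
Qed.

Lemma monic_pos (p : {poly R}) : p \is monic -> exists B, forall x, B <= x -> 0 < p.[x].
Proof.
move=> pm; have [|B hB] := @poly_pinfty_gt_lc _ p.
  by rewrite (monicP pm) ltr01.
by exists B => x /hB; rewrite (monicP pm); apply: lt_le_trans.
Qed.

Definition jacobi_roots (n : nat) (u : nat -> R) :=
  P n = \prod_(0 <= k < n) ('X - (u k)%:P).

(** At a zero [v k] of [P n.+1] the recurrence leaves [- A n.+1 * P n], and interlacing makes the
    sign of [P n] there alternate with [k]; two far points supply the remaining sign changes. *)
Lemma interlacing_step n u v : interlacing n u v ->
  jacobi_roots n u -> jacobi_roots n.+1 v ->
  exists w, interlacing n.+1 v w /\ jacobi_roots n.+2 w.
Proof.
move=> uv Pu Pv.
have vd := interlacing_decr uv.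
have hn k : (k < n.+1)%N -> 0 < (-1) ^+ k * (P n).[v k].
  move=> kn; rewrite Pu horner_prod.
  under eq_bigr do rewrite !hornerE.
  apply: prod_sign => // i ik.
    have /andP[h _] := uv i (leq_trans ik kn).
    rewrite subr_lt0 (le_lt_trans _ h)//.
    by apply: (decreasing_le vd); rewrite ik.
  move: ik => /andP[ki iN].
  have /andP[_ h] := uv i iN.
  rewrite subr_gt0 (lt_le_trans h)//.
  by apply: (decreasing_le vd); rewrite ki ltnW.
have hn2 k : (k < n.+1)%N -> 0 < (-1) ^+ k.+1 * (P n.+2).[v k].
  move=> kn; rewrite /P jacobi_polySS -/(P _) -/(P n) !hornerE.
  have -> : (P n.+1).[v k] = 0.
    rewrite Pv horner_prod (bigD1_seq k) ?iota_uniq ?mem_index_iota//= !hornerE.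
    by rewrite subrr mul0r.
  by rewrite mulr0 sub0r exprS; have := mulr_gt0 (A_gt0 n) (hn k kn); lra.
have [B hB] := monic_pos (jacobi_poly_monic A n.+2).
(* [M] lies beyond [B] and [v 0], and [- M] below [v n]; parity transports the sign at [M] to [- M].
   The [n.+3] points [M, v 0, ..., v n, - M] bound [n.+2] intervals, one for each zero sought. *)
pose M := Num.max B (Num.max (v 0%N + 1) (1 - v n)).
have BM : B <= M by rewrite le_max lexx.
have vM : v 0%N < M by rewrite !lt_max ltrDl ltr01 !orbT.
have vN : - M < v n by rewrite ltrNl !lt_max ltrDr ltr01 !orbT.
pose V k := if k is k'.+1 then if (k' <= n)%N then v k' else - M else M.
have VP k : (k <= n.+2)%N -> 0 < (-1) ^+ k * (P n.+2).[V k].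
  case: k => [|k] kn; first by rewrite expr0 mul1r hB.
  rewrite /V; case: ifPn => kn'; first exact: hn2.
  have -> : k = n.+1 by lia.
  by rewrite /P horner_jacobi_polyN mulrA -exprMn mulrNN mulr1 expr1n mul1r hB.
have Vd k : (k.+1 < n.+3)%N -> V k.+1 < V k.
  case: k => [|k] kn //=; rewrite (_ : (k <= n)%N); last by lia.
  case: ifPn => kn'; first by apply: vd; lia.
  by rewrite (_ : k = n)//; lia.
have ex k : exists x, (k <= n.+1)%N -> V k.+1 < x < V k /\ root (P n.+2) x.
  have [kn|kn] := leqP k n.+1; last by exists 0.
  have VV : (P n.+2).[V k.+1] * (P n.+2).[V k] < 0.
    have := mulr_gt0 (VP k (leqW kn)) (VP k.+1 kn).
    move: (horner _ _) (horner _ _) => a b; rewrite exprS mulN1r mulNr mulrN mulrACA.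
    by rewrite -exprMn mulrNN mulr1 expr1n mul1r oppr_gt0 mulrC.
  have [|x xV rx] := poly_ivtoo _ VV; first by rewrite ltW// Vd.
  by exists x => _; split=> //; move: xV; rewrite in_itv.
have [w hw] := choice ex.
have wd k : (k.+1 < n.+2)%N -> w k.+1 < w k.
  move=> kn; have [/andP[h1 _] _] := hw k (ltnW kn).
  by have [/andP[_ h2] _] := hw k.+1 kn; exact: lt_trans h1.
exists w; split=> [k kn|].
  have [/andP[h1 _] _] := hw k (ltnW kn).
  have [/andP[_ h2] _] := hw k.+1 kn.
  by move: h1 h2; rewrite /V (_ : (k <= n)%N)// => -> ->.
apply: monic_root_prod.
- exact: jacobi_poly_monic.
- exact: size_jacobi_poly.
- by move=> k kn; have [] := hw k kn.
- exact: wd.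
Qed.

Definition jacobi_inv n (uv : (nat -> R) * (nat -> R)) :=
  [/\ interlacing n uv.1 uv.2, jacobi_roots n uv.1 & jacobi_roots n.+1 uv.2].

Lemma exists_jacobi_zeros : exists z : nat -> nat -> R,
  (forall n, jacobi_roots n (z n)) /\ (forall n, interlacing n (z n) (z n.+1)).
Proof.
(* An arbitrary value outside the invariant makes the step total, so that [choice] yields a function
   that can be iterated on pairs of consecutive families. *)
have step n uv : exists w, jacobi_inv n uv -> jacobi_inv n.+1 (uv.2, w).
  case: (pselect (jacobi_inv n uv)) => [[i1 i2 i3]|h]; last by exists (fun=> 0).
  by have [w [w1 w2]] := interlacing_step i1 i2 i3; exists w.
have {step} [f hf] := choice (fun nuv => step nuv.1 nuv.2).
pose s := fix s n := if n is n'.+1 then ((s n').2, f (n', s n')) else (fun=> 0, fun=> 0).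
have sP n : jacobi_inv n (s n).
  elim: n => [|n ih]; last exact: (hf (n, s n)).
  split=> //; rewrite /jacobi_roots /P; first by rewrite big_nil.
  by rewrite big_nat1 subr0.
exists (fun n => (s n).1); split=> n; first by have [] := sP n.
by have [] := sP n.
Qed.

End interlacing.

(** Identities in [w = x ^- 2] are first available for positive [w] only; this turns them into
    identities of polynomials. *)
Lemma poly_eq_pos {R : realDomainType} (p q : {poly R}) :
  (forall x, 0 < x -> p.[x] = q.[x]) -> p = q.
Proof.
move=> pq; apply/eqP; rewrite -subr_eq0; apply/eqP.
apply: (@roots_geq_poly_eq0 _ _ [seq k.+1%:R | k <- iota 0 (size (p - q))]).
- apply/allP => _ /mapP[k _ ->].
  by rewrite /root hornerD hornerN pq ?subrr ?ltr0Sn.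
- rewrite map_inj_uniq ?iota_uniq// => i j /eqP.
  by rewrite eqr_nat => /eqP[].
by rewrite size_map size_iota.
Qed.

(* Newton's identities between the coefficients of prod (1 - u k X) and the
   power sums of u, as a truncated logarithmic derivative. *)
Lemma newton_dvd {K : fieldType} (u : nat -> K) (n r : nat) :
  let p := \prod_(0 <= k < n) (1 - u k *: 'X) in
  'X^r %| p^`() + p * \sum_(0 <= i < r) (\sum_(0 <= k < n) u k ^+ i.+1) *: 'X^i.
Proof.
elim: n => [|n ih] /=.
  rewrite big_nil derivC add0r mul1r big1 ?dvdp0// => i _.
  by rewrite big_nil scale0r.
rewrite big_nat_recr//=; set p := \prod_(_ <= _ < _) _ in ih *.
pose G m := \sum_(0 <= i < r) (\sum_(0 <= k < m) u k ^+ i.+1) *: 'X^i.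
rewrite -/(G n.+1) -/(G n) in ih *.
(* [H] is the geometric sum contributed by the new factor; multiplied by [1 - u n X] it telescopes,
   which leaves an error divisible by [X ^ r]. *)
pose H : {poly K} := \sum_(0 <= i < r) (u n *: 'X) ^+ i.
have GE : G n.+1 = G n + u n *: H.
  rewrite /H /G scaler_sumr -big_split/=; apply: eq_bigr => i _.
  by rewrite big_nat_recr//= scalerDl exprZn scalerA exprS.
have HE : (1 - u n *: 'X) * H = 1 - u n ^+ r *: 'X^r.
  by rewrite -exprZn /H big_mkord -[LHS]opprK -mulNr opprB -subrX1 opprB.
have -> : (p * (1 - u n *: 'X))^`() + p * (1 - u n *: 'X) * G n.+1 =
   (1 - u n *: 'X) * (p^`() + p * G n) - u n ^+ r.+1 *: 'X^r * p.
  rewrite derivM derivB derivC derivZ derivX GE.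
  have -> : p * (1 - u n *: 'X) * (G n + u n *: H) =
    p * (1 - u n *: 'X) * G n + u n *: (p * ((1 - u n *: 'X) * H)).
    by rewrite mulrDr -scalerAr -!mulrA.
  rewrite HE exprS -!mul_polyC !polyCM; ring.
apply: dvdp_sub; first exact: dvdp_mull.
by apply: dvdp_mulr; rewrite -mul_polyC; exact: dvdp_mull.
Qed.

(** * Symmetry of the zeros and their power sums *)

Section jacobi_zeros.
Context {R : realType} (A : nat -> R) (z : nat -> nat -> R).
Context (A_gt0 : forall n, 0 < A n.+1).
Context (z_roots : forall n, jacobi_roots A n (z n)).
Context (z_interlacing : forall n, interlacing n (z n) (z n.+1)).

(** Nonpositive zeros and indices beyond the degree are sent to 0, which adds nothing to the power
    sums and makes [pos_zero n k] nondecreasing in [n] for every [k]. *)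
Definition pos_zero (n k : nat) : R := if (k < n)%N then Num.max 0 (z n k) else 0.

Lemma jacobi_zero_lt n i j : (i < j < n)%N -> z n j < z n i.
Proof.
case: n => [|n] ij; first by rewrite ltn0 andbF in ij.
by apply: decreasing_lt ij => k; exact: (interlacing_decr (@z_interlacing n)).
Qed.

Lemma root_jacobi_zero n k : (k < n)%N -> root (jacobi_poly A n) (z n k).
Proof.
move=> kn; rewrite /root z_roots horner_prod.
rewrite (bigD1_seq k) ?iota_uniq ?mem_index_iota//=.
by rewrite !hornerE subrr mul0r.
Qed.

Lemma big_jacobi_zeroN T (idx : T) (op : Monoid.com_law idx) (F : R -> T) n :
  \big[op/idx]_(0 <= k < n) F (- z n k) = \big[op/idx]_(0 <= k < n) F (z n k).
Proof.
rewrite -(big_map (fun k => - z n k) xpredT F) -(big_map (z n) xpredT F).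
have rootE x : root (jacobi_poly A n) x = (x \in [seq z n k | k <- index_iota 0 n]).
  by rewrite z_roots -(big_map (z n) xpredT (fun y => 'X - y%:P)) root_prod_XsubC.
have u : uniq [seq z n k | k <- index_iota 0 n].
  rewrite map_inj_in_uniq ?iota_uniq// => i j.
  rewrite !mem_index_iota /= => iN jN eij.
  by case: (ltngtP i j) => // ij; have := @jacobi_zero_lt n;
    [move=> /(_ i j)|move=> /(_ j i)]; rewrite ij ?iN ?jN eij ltxx => /(_ isT).
apply: perm_big; apply: uniq_perm => //.
  by rewrite (map_comp -%R (z n)) map_inj_uniq//; exact: oppr_inj.
move=> x; rewrite -rootE; apply/mapP/idP => [[k]|rx].
  rewrite mem_index_iota => /andP[_ kn] ->.
  rewrite /root horner_jacobi_polyN mulf_eq0 signr_eq0/=.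
  exact: root_jacobi_zero.
have : - x \in [seq z n k | k <- index_iota 0 n].
  by rewrite -rootE /root horner_jacobi_polyN mulf_eq0 signr_eq0.
by move=> /mapP[k kn e]; exists k => //; rewrite -e opprK.
Qed.

(** For [z] nonzero exactly one of [z] and [- z] survives the truncation at 0; [F 0 = idx] lets the
    other one, and a zero at the origin, count for nothing. The positive zeros are thus counted
    twice whatever the parity of [n]. *)
Lemma big_jacobi_zero_sqr T (idx : T) (op : Monoid.com_law idx) (F : R -> T) n :
  F 0 = idx ->
  \big[op/idx]_(0 <= k < n) F (z n k ^+ 2) =
  op (\big[op/idx]_(0 <= k < n) F (pos_zero n k ^+ 2))
     (\big[op/idx]_(0 <= k < n) F (pos_zero n k ^+ 2)).
Proof.
move=> F0; pose G x := F (Num.max 0 x ^+ 2).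
have GE : \big[op/idx]_(0 <= k < n) F (pos_zero n k ^+ 2) =
    \big[op/idx]_(0 <= k < n) G (z n k).
  by apply: eq_big_nat => k /andP[_ kn]; rewrite /pos_zero kn.
rewrite GE -[X in op X _]big_jacobi_zeroN -big_split /=.
apply: eq_bigr => k _; rewrite /G; have [z0|z0] := leP 0 (z n k).
  by rewrite max_l ?oppr_le0// expr0n/= F0 Monoid.mul1m.
by rewrite max_r ?oppr_ge0 1?ltW// expr0n/= F0 Monoid.mulm1 sqrrN.
Qed.

(** Pairing the values at [x] and [- x] turns the linear factors into [x ^ 2 - z ^ 2]. Taking the
    square avoids a case distinction on the parity of [n] and merely doubles the logarithmic
    derivative. *)
Lemma reversed_jacobi_poly_sqr n :
  reversed_jacobi_poly A n ^+ 2 = \prod_(0 <= k < n) (1 - z n k ^+ 2 *: 'X).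
Proof.
apply: poly_eq_pos => w w0.
pose x := (Num.sqrt w)^-1.
have sw0 : 0 < Num.sqrt w by rewrite sqrtr_gt0.
have x0 : x != 0 by rewrite invr_eq0 gt_eqF.
have xw : x ^- 2 = w by rewrite exprVn invrK sqr_sqrtr// ltW.
have xn0 : x ^+ n * x ^+ n != 0 by rewrite mulf_neq0// expf_neq0.
apply: (mulfI xn0).
transitivity ((jacobi_poly A n).[x] ^+ 2).
  by rewrite horner_reversed_jacobi_poly// xw horner_exp; move: (horner _ _) => y; ring.
transitivity ((-1) ^+ n * (jacobi_poly A n).[x] * (jacobi_poly A n).[- x]).
  rewrite horner_jacobi_polyN mulrACA -exprMn mulrNN mulr1 expr1n mul1r.
  by rewrite expr2.
rewrite z_roots !horner_prod.
have -> : (-1) ^+ n = \prod_(0 <= k < n) (-1 : R) by rewrite prodr_const_nat subn0.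
have -> : x ^+ n = \prod_(0 <= k < n) x by rewrite prodr_const_nat subn0.
rewrite -!big_split /=; apply: eq_bigr => k _.
rewrite !(hornerD, hornerN, hornerZ, hornerM, hornerX, hornerC) -xw.
by field.
Qed.

Lemma horner_reversed_jacobi_poly_sqr n w :
  (reversed_jacobi_poly A n).[w] ^+ 2 =
  (\prod_(0 <= k < n) (1 - pos_zero n k ^+ 2 * w)) ^+ 2.
Proof.
rewrite -horner_exp reversed_jacobi_poly_sqr horner_prod.
under eq_bigr do rewrite !(hornerD, hornerN, hornerZ, hornerX, hornerC).
rewrite (@big_jacobi_zero_sqr _ _ _ (fun y => 1 - y * w)) ?expr2//.
by rewrite mul0r subr0.
Qed.

Lemma reversed_jacobi_poly0 n : (reversed_jacobi_poly A n).[0] = 1.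
Proof.
elim/jacobi_poly_ind: n => [||n ih0 ih1]; rewrite ?hornerC//.
by rewrite reversed_jacobi_polySS !(hornerD, hornerN, hornerZ, hornerM, hornerX)
  ih1 mul0r mulr0 subr0.
Qed.

Definition pos_power_sum n p := \sum_(0 <= k < n) pos_zero n k ^+ (2 * p).

(** Newton's relation for [q ^ 2] is [2 q] times the relation for [q]; the factor can be cancelled
    because [q(0) = 1] makes it prime to [X]. *)
Lemma newton_reversed_jacobi n r :
  'X^r %| (reversed_jacobi_poly A n)^`() + reversed_jacobi_poly A n *
    \sum_(0 <= i < r) pos_power_sum n i.+1 *: 'X^i.
Proof.
set q := reversed_jacobi_poly A n; have := newton_dvd (fun k => z n k ^+ 2) n r.
rewrite /= -reversed_jacobi_poly_sqr -/q.
set G := \sum_(_ <= _ < _) _; set H := \sum_(_ <= _ < _) _.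
have -> : G = 2 *: H.
  rewrite /G /H scaler_sumr; apply: eq_bigr => i _; rewrite scalerA; congr (_ *: _).
  rewrite (@big_jacobi_zero_sqr _ _ _ (fun y => y ^+ i.+1)) ?expr0n//=.
  by rewrite mulr_natl mulr2n; congr (_ + _); apply: eq_bigr => k _; rewrite exprM.
have -> : (q ^+ 2)^`() + q ^+ 2 * (2 *: H) = (2 *: q) * (q^`() + q * H).
  by rewrite expr2 derivM -!mul_polyC; ring.
rewrite Gauss_dvdpr//; apply: coprimep_expl; rewrite coprimep_sym.
rewrite -(subr0 'X) coprimep_XsubC /root hornerZ reversed_jacobi_poly0.
by rewrite mulr1 pnatr_eq0.
Qed.

Lemma coef_newton_reversed_jacobi n r :
  let q := reversed_jacobi_poly A n in
  \sum_(i < r.+1) q`_i * pos_power_sum n (r - i).+1 = - (r.+1%:R * q`_r.+1).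
Proof.
move=> q; have /dvdpP[s] := newton_reversed_jacobi n r.+1.
move=> /(congr1 (fun p : {poly R} => p`_r)); rewrite coefMXn ltnSn.
rewrite coefD coef_deriv coefM -/q.
under eq_bigr => i _.
  rewrite coef_sum.
  rewrite (bigD1_seq (r - i)%N) ?iota_uniq ?mem_index_iota/= ?ltnS ?leq_subr//.
  rewrite big1 ?addr0; last first.
    by move=> j ji; rewrite coefZ coefXn eq_sym (negPf ji) mulr0.
  rewrite coefZ coefXn eqxx mulr1; over.
by move/eqP; rewrite addrC addr_eq0 mulr_natl => /eqP.
Qed.

Lemma pos_zero_ge0 n k : 0 <= pos_zero n k.
Proof. by rewrite /pos_zero; case: ifP => //; rewrite le_max lexx. Qed.

Lemma pos_zero_nondecr n k : pos_zero n k <= pos_zero n.+1 k.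
Proof.
rewrite {1}/pos_zero; case: ifPn => kn; last exact: pos_zero_ge0.
rewrite /pos_zero leqW//.
have /andP[_ zz] := z_interlacing kn.
by rewrite ge_max !le_max lexx/= (ltW zz) orbT.
Qed.

End jacobi_zeros.

(** * The confluent limit function 0F1 *)

Section series_lemmas.
Context {R : realType}.
Implicit Types u v M : nat -> R.

Lemma dominated_is_cvg_series u M :
  (forall j, `|u j| <= M j) -> cvgn (series M) -> cvgn (series u).
Proof.
move=> uM cM; apply: normed_cvg; apply: series_le_cvg cM => // j.
  exact: normr_ge0.
exact: le_trans (normr_ge0 _) (uM j).
Qed.

Lemma dominated_series_tail u M J :
  (forall j, `|u j| <= M j) -> cvgn (series M) ->
  `|limn (series u) - series u J| <= limn (series M) - series M J.
Proof.
move=> uM cM; have cu := dominated_is_cvg_series uM cM.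
have cu' : cvgn (fun n => `|series u n - series u J|).
  by apply: is_cvg_norm; apply: is_cvgB => //; exact: is_cvg_cst.
have -> : `|limn (series u) - series u J| = limn (fun n => `|series u n - series u J|).
  by apply/esym/cvg_lim => //; apply: cvg_norm; apply: cvgB => //; exact: cvg_cst.
have -> : limn (series M) - series M J = limn (fun n => series M n - series M J).
  by apply/esym/cvg_lim => //; apply: cvgB => //; exact: cvg_cst.
apply: ler_lim => //; first by apply: is_cvgB => //; exact: is_cvg_cst.
near=> n.
have Jn : (J <= n)%N by near: n; exact: nbhs_infty_ge.
by rewrite !sub_series_geq// (le_trans (ler_norm_sum _ _ _))// ler_sum.
Unshelve. all: by end_near. Qed.

(** Tannery's theorem: [M] makes the tails small uniformly in [n], and what remains is a finite
    sum. *)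
Lemma cvg_dominated_series (u : nat -> nat -> R) v M :
  (forall j, u n j @[n --> \oo] --> v j) ->
  (forall n j, `|u n j| <= M j) -> cvgn (series M) ->
  limn (series (u n)) @[n --> \oo] --> limn (series v).
Proof.
move=> uv uM cM.
have vM j : `|v j| <= M j.
  apply: (@ler_cvg_to _ \oo _ _ (fun n => `|u n j|) (fun=> M j)).
    by apply: cvg_norm; exact: uv.
  exact: cvg_cst.
exact: nearW.
apply/cvgrPdist_le => e e0.
have e4 : 0 < e / 3 by rewrite divr_gt0.
have [J hJ] : exists J, limn (series M) - series M J <= e / 3.
  have : series M @ \oo --> limn (series M) by [].
  move/cvgrPdist_le => /(_ _ e4)[J _ /(_ J)] /=; rewrite leqnn => /(_ isT) h.
  by exists J; rewrite (le_trans _ h)// ler_norm.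
have cJ : series (u n) J @[n --> \oo] --> series v J.
  rewrite seriesEnat; under eq_cvg do rewrite seriesEnat /=.
  by apply: cvg_big => [|j _]; [exact: add_continuous|exact: uv].
near=> n.
have h1 : `|series v J - series (u n) J| <= e / 3.
  by near: n; move/cvgrPdist_le : cJ; exact.
have h2 := le_trans (dominated_series_tail J vM cM) hJ.
have h3 := le_trans (dominated_series_tail J (uM n) cM) hJ.
have -> : limn (series v) - limn (series (u n)) =
  (limn (series v) - series v J) + (series v J - series (u n) J) -
  (limn (series (u n)) - series (u n) J) by lra.
rewrite (le_trans (ler_normB _ _))//.
have h4 := le_trans (ler_normD (limn (series v) - series v J) _) (lerD h2 h1).
by rewrite (le_trans (lerD h4 h3))//; lra.
Unshelve. all: by end_near. Qed.

Lemma series_finite u N : (forall j, (N <= j)%N -> u j = 0) ->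
  limn (series u) = \sum_(0 <= j < N) u j.
Proof.
move=> u0; apply/cvg_lim => //.
apply: cvg_near_cst; near=> n.
have Nn : (N <= n)%N by near: n; exact: nbhs_infty_ge.
rewrite seriesEnat /= (@big_cat_nat _ _ _ N)//= [X in _ + X]big_nat_cond.
by rewrite [X in _ + X]big1 ?addr0// => j /andP[/andP[/u0]].
Unshelve. all: by end_near. Qed.

Lemma cvgn_mull (a : R) u (l : R) :
  u n @[n --> \oo] --> l -> a * u n @[n --> \oo] --> a * l.
Proof. by move=> ul; exact: cvgMl_tmp. Qed.

Lemma cvgn_uniq u (l l' : R) : u n @[n --> \oo] --> l -> u n @[n --> \oo] --> l' -> l = l'.
Proof. by move=> ul ul'; rewrite -(cvg_lim _ ul)// -(cvg_lim _ ul'). Qed.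

Lemma cvg_inv_addn (x : R) : (x + n%:R)^-1 @[n --> \oo] --> (0 : R).
Proof.
apply/gtr0_cvgV0.
  near=> n; have : 1 - x <= n%:R by near: n; exact: nbhs_infty_ger.
  lra.
by apply/cvgryPge => B; near=> n; rewrite -lerBlDl; near: n; exact: nbhs_infty_ger.
Unshelve. all: by end_near. Qed.

End series_lemmas.

Section bessel_clifford.
Context {R : realType} (b : R).
Implicit Types mu w : R.

Definition rising (x : R) (j : nat) : R := \prod_(0 <= i < j) (x + i%:R).

Lemma risingS x j : rising x j.+1 = rising x j * (x + j%:R).
Proof. by rewrite /rising big_nat_recr. Qed.

Lemma risingSl x j : rising x j.+1 = x * rising (x + 1) j.
Proof.
rewrite /rising big_nat_recl//= addr0; congr (_ * _); apply: eq_bigr => i _.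
by rewrite -natr1 addrCA addrC.
Qed.

Lemma rising_ge x c j : 0 <= c -> c <= x -> c ^+ j <= rising x j.
Proof.
move=> c0 cx; have -> : c ^+ j = \prod_(0 <= i < j) c by rewrite prodr_const_nat subn0.
apply: ler_prod => i _; rewrite c0/= (le_trans cx)// lerDl ler0n//.
Qed.

Lemma rising_gt0 x j : 0 < x -> 0 < rising x j.
Proof.
by move=> x0; apply: prodr_gt0 => i _; rewrite ltr_pwDl// ler0n.
Qed.

(* [clifford mu w] is 0F1(; mu + 1; - b w), so that
   [besselJ mu x = (x / 2) ^ mu / Gamma (mu + 1) * clifford mu w] when
   [b w = x ^ 2 / 4]. *)
Definition clifford_coef mu (j : nat) : R :=
  (- b) ^+ j / (j`!%:R * rising (mu + 1) j).

Definition clifford mu w : R :=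
  limn (series (fun j => clifford_coef mu j * w ^+ j)).

Lemma clifford_coef0 mu : clifford_coef mu 0 = 1.
Proof. by rewrite /clifford_coef expr0 fact0 /rising big_nil mulr1 divr1. Qed.

Lemma clifford_coefS mu j : -1 < mu ->
  clifford_coef mu j.+1 = - (b / (j.+1%:R * (mu + 1))) * clifford_coef (mu + 1) j.
Proof.
move=> mu1; rewrite /clifford_coef risingSl factS natrM exprS.
have /lt0r_neq0 r0 : 0 < rising (mu + 1 + 1) j by apply: rising_gt0; lra.
have f0 : j`!%:R != 0 :> R by rewrite pnatr_eq0 -lt0n fact_gt0.
have n0 : (j.+1%:R : R) != 0 by rewrite pnatr_eq0.
have j0 : 0 <= (j%:R : R) by [].
by field; rewrite r0 f0 /= !gt_eqF; lra.
Qed.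

Lemma clifford_contiguous_coef mu j : -1 < mu ->
  clifford_coef (mu + 1) j.+1 - clifford_coef mu j.+1 =
  b / ((mu + 1) * (mu + 2)) * clifford_coef (mu + 2) j.
Proof.
move=> mu1; have e : mu + 1 + 1 = mu + 2 by lra.
rewrite /clifford_coef e risingS [rising (mu + 1) _]risingSl e.
have := risingS (mu + 2) j; rewrite risingSl => h.
have r0 : 0 < rising (mu + 2 + 1) j by apply: rising_gt0; lra.
have r0' : 0 < rising (mu + 2) j by apply: rising_gt0; lra.
have f0 : j`!%:R != 0 :> R by rewrite pnatr_eq0 -lt0n fact_gt0.
have n0 : 0 <= (j%:R : R) by [].
have -> : rising (mu + 2) j = (mu + 2) * rising (mu + 2 + 1) j / (mu + 2 + j%:R).
  by rewrite h mulfK// gt_eqF//; lra.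
rewrite factS natrM exprS -natr1.
by field; rewrite f0 !gt_eqF//; lra.
Qed.

(** Bounding each factor of the Pochhammer symbol below by [c] leaves an exponential series. Any
    positive [c <= mu + 1] being allowed, one majorant serves all the shifts [nu + m]. *)
Lemma clifford_term_le mu (c : R) w j : 0 < c -> c <= mu + 1 ->
  `|clifford_coef mu j * w ^+ j| <= exp_coeff (`|b * w| / c) j.
Proof.
move=> c0 cmu; rewrite /clifford_coef /exp_coeff /= mulrAC normrM normfV.
rewrite [`|_ * w ^+ j|](_ : _ = `|b * w| ^+ j); last first.
  by rewrite normrM !normrX normrN -exprMn normrM.
have rc := rising_ge j (ltW c0) cmu.
have r0 : 0 < rising (mu + 1) j by rewrite rising_gt0// (lt_le_trans c0).
have f0 : 0 < j`!%:R :> R by rewrite ltr0n fact_gt0.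
rewrite (gtr0_norm (mulr_gt0 f0 r0)).
have -> : (`|b * w| / c) ^+ j = `|b * w| ^+ j * (c ^+ j)^-1 by rewrite exprMn exprVn.
rewrite -mulrA ler_wpM2l ?exprn_ge0//.
by rewrite -invfM lef_pV2 ?posrE ?mulr_gt0 ?exprn_gt0// mulrC ler_pM2l.
Qed.

Lemma is_cvg_clifford mu w : -1 < mu ->
  cvgn (series (fun j => clifford_coef mu j * w ^+ j)).
Proof.
move=> mu1; apply: dominated_is_cvg_series (is_cvg_series_exp_coeff _).
by move=> j; apply: (@clifford_term_le mu (mu + 1)); lra.
Qed.

(** This is J_mu + J_(mu+2) = (2 (mu + 1) / x) J_(mu+1) in the present normalisation. The constant
    terms, both 1, cancel on the left, which accounts for the factor [w]. *)
Lemma clifford_contiguous mu w : -1 < mu ->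
  clifford (mu + 1) w - clifford mu w =
  b / ((mu + 1) * (mu + 2)) * w * clifford (mu + 2) w.
Proof.
move=> mu1.
have c1 : cvgn (series (fun j => clifford_coef (mu + 1) j * w ^+ j)).
  by apply: is_cvg_clifford; lra.
have c0 := @is_cvg_clifford mu w mu1.
have c2 : cvgn (series (fun j => clifford_coef (mu + 2) j * w ^+ j)).
  by apply: is_cvg_clifford; lra.
pose G n := series (fun j => clifford_coef (mu + 1) j * w ^+ j) n.+1 -
  series (fun j => clifford_coef mu j * w ^+ j) n.+1.
have G1 : G n @[n --> \oo] --> clifford (mu + 1) w - clifford mu w.
  by apply: cvgB; rewrite (cvg_shiftS (series _)).
rewrite -(cvg_lim _ G1)//; apply/cvg_lim => //.
rewrite (_ : G = fun n => b / ((mu + 1) * (mu + 2)) * w *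
    series (fun j => clifford_coef (mu + 2) j * w ^+ j) n).
  exact: cvgMl_tmp.
rewrite /G; apply/funext => n; rewrite !seriesEnat /= !big_nat_recl//= !clifford_coef0.
rewrite opprD addrACA subrr add0r -sumrB mulr_sumr; apply: eq_bigr => j _.
by rewrite -mulrBl clifford_contiguous_coef// exprS; ring.
Qed.

End bessel_clifford.

(** * Zeros of the Lommel polynomials *)

Section lommel_coef.
Context {R : realType} (nu beta : R).
Context (nu_gtN1 : -1 < nu) (beta_gt0 : 0 < beta).

Local Ltac slra := move: (nu_gtN1) => ?; lra.

Let b := beta ^+ 2 / 4.
Let A := lommel_A2 nu beta.
Let q := reversed_jacobi_poly A.

Lemma quarter_sqr_gt0 : 0 < b.
Proof. by rewrite divr_gt0// exprn_gt0. Qed.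

Lemma lommel_A2E n : A n.+1 = b / ((nu + 1 + n%:R) * (nu + 1 + n%:R + 1)).
Proof.
rewrite /A /lommel_A2 /b -natr1.
have n0 : 0 <= (n%:R : R) by [].
by field; rewrite !gt_eqF//; slra.
Qed.

Lemma lommel_A2_gt0 n : 0 < A n.+1.
Proof.
have n0 : 0 <= (n%:R : R) by [].
by rewrite lommel_A2E divr_gt0 ?quarter_sqr_gt0// mulr_gt0//; slra.
Qed.

(** The quotient of the [j]-th coefficient of the [n]-th reversed polynomial by its limit. That it
    lies in [0, 1] and tends to 1 is what dominated convergence needs. *)
Definition lommel_ratio n j : R :=
  ((n - j) ^_ j)%:R / rising (nu + 1 + (n - j)%:R) j.

Lemma lommel_ratio_eq0 n j : (n < j.*2)%N -> lommel_ratio n j = 0.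
Proof. by move=> nj; rewrite /lommel_ratio ffact_small ?mul0r//; lia. Qed.

Lemma rising_nat_gt0 n j : 0 < rising (nu + 1 + n%:R) j.
Proof. by rewrite rising_gt0// ltr_wpDr// -(addNr 1) ltrD2r. Qed.

Lemma lommel_ratio_ge0 n j : 0 <= lommel_ratio n j.
Proof. by rewrite divr_ge0// ltW// rising_nat_gt0. Qed.

Lemma ffact_le_expn n j : (n ^_ j <= n ^ j)%N.
Proof.
elim: j n => [//|j ih] [//|n]; rewrite ffactSS expnS leq_mul2l (leq_trans (ih n))//.
by case: (posnP j) => [->|j0]; rewrite ?expn0 ?leq_exp2r//.
Qed.

Lemma lommel_ratio_le1 n j : lommel_ratio n j <= 1.
Proof.
rewrite /lommel_ratio ler_pdivrMr ?rising_nat_gt0// mul1r.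
apply: (@le_trans _ _ ((n - j)%:R ^+ j)).
  by rewrite -natrX ler_nat ffact_le_expn.
by apply: rising_ge => //; rewrite lerDr; slra.
Qed.

Lemma coef_reversed_lommel n j : (q n)`_j = clifford_coef b nu j * lommel_ratio n j.
Proof.
have base m i : (m <= 1)%N -> (1 : {poly R})`_i = clifford_coef b nu i * lommel_ratio m i.
  move=> m1; rewrite coef1; case: i => [|i].
    rewrite clifford_coef0 /lommel_ratio ffactn0 /rising big_nil divr1 mul1r//.
  by rewrite lommel_ratio_eq0 ?mulr0//; lia.
elim/jacobi_poly_ind: n j => [||n ih0 ih1] j; [exact: base|exact: base|].
rewrite /q reversed_jacobi_polySS -/(q _) -/(q n) coefB coefZ coefXM ih1.
case: j => [|j].
  by rewrite mulr0 subr0 /lommel_ratio !ffactn0 /rising !big_nil.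
rewrite /= ih0.
have cS : clifford_coef b nu j.+1 = clifford_coef b nu j *
    (- b / (j.+1%:R * (nu + 1 + j%:R))).
  have r0 := @rising_gt0 R (nu + 1) j.
  have f0 : j`!%:R != 0 :> R by rewrite pnatr_eq0 -lt0n fact_gt0.
  have j0 : 0 <= (j%:R : R) by [].
  rewrite /clifford_coef risingS factS natrM exprS.
  by field; rewrite f0 !gt_eqF//; slra.
have [nj|nj] := ltnP n j.*2.
  by rewrite !lommel_ratio_eq0 ?mulr0 ?subr0//; lia.
rewrite cS /lommel_ratio.
have [m nE] : exists m, n = (m + j.*2)%N by exists (n - j.*2)%N; lia.
have -> : (n.+1 - j.+1 = m + j)%N by lia.
have -> : (n.+2 - j.+1 = (m + j).+1)%N by lia.
have -> : (n - j = m + j)%N by lia.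
rewrite ffactSS ffactnSr addnK !natrM.
have := rising_nat_gt0 (m + j) j.
(* The Pochhammer symbol of length [j + 2] that starts at [nu + 1 + m + j], expanded at both ends,
   expresses the shifted symbol [Z] through [Y]; a rational identity remains. *)
have := risingSl (nu + 1 + (m + j)%:R) j.+1.
rewrite !risingS lommel_A2E -/b.
set Y := rising _ j.
have -> : nu + 1 + (m + j)%:R + 1 = nu + 1 + (m + j).+1%:R by rewrite -natr1; slra.
set Z := rising _ j.
have m0 : 0 <= (m%:R : R) by [].
have j0 : 0 <= (j%:R : R) by [].
rewrite nE -addnn -!natr1 !natrD => YZ Y0.
have -> : Z = Y * (nu + 1 + (m%:R + j%:R) + j%:R) * (nu + 1 + (m%:R + j%:R) + (j%:R + 1)) /
   ((nu + 1 + (m%:R + j%:R)) * (nu + 1 + (m%:R + j%:R + 1) + j%:R)).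
  apply: (@mulfI _ ((nu + 1 + (m%:R + j%:R)) * (nu + 1 + (m%:R + j%:R + 1) + j%:R))).
    by rewrite mulf_neq0// gt_eqF//; slra.
  rewrite [RHS]mulrC divfK; last by rewrite mulf_neq0// gt_eqF//; slra.
  by rewrite mulrAC -mulrA -YZ; ring.
by field; rewrite !gt_eqF//; slra.
Qed.

Lemma cvg_lommel_ratio j : lommel_ratio n j @[n --> \oo] --> (1 : R).
Proof.
suff h : ((m ^_ j)%:R / rising (nu + 1 + m%:R) j : R) @[m --> \oo] --> (1 : R).
  by rewrite /lommel_ratio (cvg_centern j
    (fun m => (m ^_ j)%:R / rising (nu + 1 + m%:R) j)).
elim: j => [|j ih].
  apply: cvg_near_cst; apply: nearW => n.
  by rewrite ffactn0 /rising big_nil divr1.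
have lim1 : ((m - j)%:R / (nu + 1 + m%:R + j%:R) : R) @[m --> \oo] --> (1 : R).
  apply: (@cvg_trans _ ((fun m => 1 - (nu + 1 + 2 * j%:R) * ((nu + 1 + j%:R) + m%:R)^-1) @ \oo)).
    apply: near_eq_cvg; near=> m.
    have jm : (j <= m)%N by near: m; exact: nbhs_infty_ge.
    have j0 : 0 <= (j%:R : R) by [].
    have m0 : 0 <= (m%:R : R) by [].
    by rewrite natrB//; field; rewrite !gt_eqF//; slra.
  have h := @cvgn_mull _ (nu + 1 + 2 * j%:R) _ _ (@cvg_inv_addn R (nu + 1 + j%:R)).
  have c1 : (fun=> 1 : R) @ \oo --> (1 : R) by exact: cvg_cst.
  by have := cvgB c1 h; rewrite mulr0 subr0; exact.
under eq_cvg do rewrite ffactnSr natrM risingS invfM mulrACA.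
have h := cvgM ih lim1; rewrite mulr1 in h; exact: h.
Unshelve. all: by end_near. Qed.

(** General in [mu] and [rho] so as to serve the polynomials and their derivatives alike, and with a
    moving point [v n] because the zeros move with [n]. *)
Lemma cvg_horner_clifford (mu : R) (p : nat -> {poly R}) (rho : nat -> nat -> R)
    (v : nat -> R) (w : R) : -1 < mu ->
  (forall n j, (p n)`_j = clifford_coef b mu j * rho n j) ->
  (forall n j, 0 <= rho n j <= 1) ->
  (forall j, rho n j @[n --> \oo] --> (1 : R)) ->
  v n @[n --> \oo] --> w ->
  (p n).[v n] @[n --> \oo] --> clifford b mu w.
Proof.
move=> mu1 pE rho01 rho1 vw.
have [W hW] : exists W : R, forall n, `|v n| <= W.
  have [W [_ hW]] := cvg_seq_bounded (cvgP _ vw).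
  by exists (W + 1) => n; apply: hW; rewrite ?ltrDl.
rewrite (_ : (fun n => _) = fun n => limn (series (fun j => (p n)`_j * v n ^+ j))); last first.
  apply/funext => n; rewrite (@series_finite _ _ (size (p n))).
    by rewrite horner_coef big_mkord.
  by move=> j sj; rewrite nth_default// mul0r.
apply: (@cvg_dominated_series _ _ _ (exp_coeff (`|b * W| / (mu + 1)))).
- move=> j; apply: cvgM; last first.
    elim: j => [|j ih]; first exact: cvg_cst.
    by under eq_cvg do rewrite exprS; rewrite exprS; exact: cvgM.
  under eq_cvg do rewrite pE.
  by have := @cvgn_mull _ (clifford_coef b mu j) _ _ (rho1 j); rewrite mulr1.
- move=> n j; rewrite pE.
  apply: le_trans (@clifford_term_le _ b mu (mu + 1) W j _ _) => //; last by slra.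
  rewrite !normrM -mulrA ler_wpM2l//.
  have /andP[r0 r1] := rho01 n j.
  rewrite (ger0_norm r0) !normrX.
  have W0 := le_trans (normr_ge0 _) (hW 0%N).
  rewrite (ger0_norm W0) -[leRHS]mul1r ler_pM//.
  by rewrite lerXn2r// nnegrE.
- exact: is_cvg_series_exp_coeff.
Qed.

Lemma cvg_reversed_lommel (v : nat -> R) (w : R) : v n @[n --> \oo] --> w ->
  (q n).[v n] @[n --> \oo] --> clifford b nu w.
Proof.
apply: cvg_horner_clifford => //.
- exact: coef_reversed_lommel.
- by move=> n j; rewrite lommel_ratio_ge0 lommel_ratio_le1.
- exact: cvg_lommel_ratio.
Qed.

(** Termwise, the derivative of F_nu is [- (b / (nu + 1))] times F_(nu+1); divided by this constant,
    the derivatives have coefficients of the required form, with the ratios shifted by one index. *)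
Lemma cvg_deriv_reversed_lommel (v : nat -> R) (w : R) : v n @[n --> \oo] --> w ->
  (q n)^`().[v n] @[n --> \oo] --> - (b / (nu + 1)) * clifford b (nu + 1) w.
Proof.
move=> vw.
pose c := - (b / (nu + 1)).
have b0 := quarter_sqr_gt0.
have c0 : c != 0 by rewrite oppr_eq0 mulf_neq0 ?invr_eq0 ?gt_eqF//; slra.
have h : (c^-1 *: (q n)^`()).[v n] @[n --> \oo] --> clifford b (nu + 1) w.
  apply: (@cvg_horner_clifford _ _ (fun n j => lommel_ratio n j.+1)) => //.
  - slra.
  - move=> n j; rewrite coefZ coef_deriv coef_reversed_lommel clifford_coefS//.
    have n0 : 0 <= (j%:R : R) by [].
    rewrite -mulr_natr /c -[j.+1%:R]natr1; move: b0 => ?.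
    by field; rewrite !gt_eqF//; slra.
  - by move=> n j; rewrite lommel_ratio_ge0 lommel_ratio_le1.
  - by move=> j; exact: cvg_lommel_ratio.
have := @cvgn_mull _ c _ _ h.
by under eq_cvg do rewrite hornerZ mulrA divff// mul1r.
Qed.

Lemma cvg_coef_reversed_lommel j : (q n)`_j @[n --> \oo] --> clifford_coef b nu j.
Proof.
under eq_cvg do rewrite coef_reversed_lommel.
have := @cvgn_mull _ (clifford_coef b nu j) _ _ (cvg_lommel_ratio j).
by rewrite mulr1.
Qed.

Lemma cvg_clifford_shift (w : R) : clifford b (nu + m%:R) w @[m --> \oo] --> (1 : R).
Proof.
have e1 : limn (series (fun j => (j == 0%N)%:R * w ^+ j)) = 1.
  rewrite (@series_finite _ _ 1%N) ?big_nat1 ?mulr1//.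
  by case=> // j _; rewrite mul0r.
suff : clifford b (nu + m%:R) w @[m --> \oo] -->
  limn (series (fun j => (j == 0%N)%:R * w ^+ j)) by rewrite e1.
apply: (@cvg_dominated_series _ _ _ (exp_coeff (`|b * w| / (nu + 1)))).
- move=> j; apply: cvgMr_tmp; case: j => [|j].
    by under eq_cvg do rewrite clifford_coef0; exact: cvg_cst.
  (* Decay in [m] comes from the first factor [nu + 1 + m] of the Pochhammer symbol alone; the
     others are bounded below by [nu + 1]. *)
  apply: norm_cvg0; apply: (@squeeze_cvgr _ _ _ _ (fun=> 0 : R)); last 1 first.
  + have := @cvg_inv_addn R (nu + 1).
    move=> /(@cvgn_mull _ (b ^+ j.+1 / (nu + 1) ^+ j)); rewrite mulr0; exact.
  + near=> m; rewrite normr_ge0/= /clifford_coef.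
    have m0 : 0 <= (m%:R : R) by [].
    have nm : nu + m%:R + 1 = nu + 1 + m%:R by slra.
    have r0 := @rising_gt0 R (nu + 1 + m%:R + 1) j.
    rewrite normrM normrX normrN (gtr0_norm quarter_sqr_gt0) -mulrA.
    rewrite ler_wpM2l ?exprn_ge0 ?(ltW quarter_sqr_gt0)//.
    rewrite nm risingSl gtr0_norm; last first.
      by rewrite invr_gt0 !mulr_gt0 ?ltr0n ?fact_gt0 ?r0//; slra.
    rewrite -invfM lef_pV2 ?posrE; last 2 first.
      by rewrite !mulr_gt0 ?ltr0n ?fact_gt0 ?r0//; slra.
      by rewrite mulr_gt0 ?exprn_gt0//; slra.
    apply: (@le_trans _ _ (1 * ((nu + 1 + m%:R) * rising (nu + 1 + m%:R + 1) j))).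
      rewrite mul1r mulrC ler_wpM2l//; first slra.
      by apply: rising_ge; slra.
    rewrite mul1r ler_peMl ?ler1n ?fact_gt0// mulr_ge0//; first slra.
    by rewrite ltW// r0//; slra.
  + exact: cvg_cst.
- move=> m j; apply: clifford_term_le; first slra.
  by have : 0 <= (m%:R : R) by []; slra.
- exact: is_cvg_series_exp_coeff.
Unshelve. all: by end_near. Qed.

Lemma clifford0 (mu : R) : clifford b mu 0 = 1.
Proof.
rewrite /clifford (@series_finite _ _ 1%N) ?big_nat1 ?clifford_coef0 ?mulr1//.
by case=> // j _; rewrite expr0n mulr0.
Qed.

(* A common zero would propagate to all clifford (nu + m) along the contiguous
   relation, but these tend to 1. *)
Lemma clifford_simple (w : R) : clifford b nu w = 0 -> clifford b (nu + 1) w != 0.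
Proof.
move=> c0; apply/eqP => c1.
have w0 : w != 0 by apply: contra_eq_neq c0 => ->; rewrite clifford0 oner_eq0.
have b0 := quarter_sqr_gt0.
suff h m : clifford b (nu + m%:R) w = 0 /\ clifford b (nu + m.+1%:R) w = 0.
  have e : (fun m => clifford b (nu + m%:R) w) = fun=> 0.
    by apply/funext => m; rewrite (h m).1.
  have := cvg_clifford_shift w; rewrite e => /(cvg_lim (@Rhausdorff R)).
  by rewrite lim_cst// => /eqP; rewrite eq_sym oner_eq0.
elim: m => [|m [ih0 ih1]]; first by rewrite addr0.
split=> //.
have m0 : 0 <= (m%:R : R) by [].
have k0 : b / ((nu + m%:R + 1) * (nu + m%:R + 2)) * w != 0.
  apply: mulf_neq0 => //; apply: mulf_neq0; first by rewrite gt_eqF.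
  by rewrite invr_eq0 mulf_neq0// gt_eqF//; slra.
apply: (mulfI k0); rewrite mulr0.
have -> : nu + m.+2%:R = nu + m%:R + 2 by rewrite -!natr1; slra.
rewrite -clifford_contiguous; last by slra.
have -> : nu + m%:R + 1 = nu + m.+1%:R by rewrite -natr1; slra.
by rewrite ih0 ih1 subrr.
Qed.

End lommel_coef.

(** Weierstrass's inequality, by which a small sum keeps the product away from 0. *)
Lemma prod_1B_ge {R : realDomainType} (u : nat -> R) m n :
  (forall k, (m <= k < n)%N -> 0 <= u k <= 1) ->
  1 - \sum_(m <= k < n) u k <= \prod_(m <= k < n) (1 - u k).
Proof.
have [nm _|mn] := leqP n m; first by rewrite !big_geq// subr0.
elim: n mn => [//|n ih]; rewrite ltnS leq_eqVlt => /orP[/eqP->|mn] h.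
  by rewrite !big_nat1.
rewrite !big_nat_recr ?(ltnW mn)//=.
have ih' : 1 - \sum_(m <= k < n) u k <= \prod_(m <= k < n) (1 - u k).
  by apply: ih => // k /andP[mk kn]; rewrite h// mk ltnS ltnW.
have S0 : 0 <= \sum_(m <= k < n) u k.
  rewrite big_nat; apply: sumr_ge0 => k /andP[mk kn].
  by have /andP[] : 0 <= u k <= 1 by rewrite h// mk ltnS ltnW.
have /andP[un0 un1] : 0 <= u n <= 1 by rewrite h// ltnSn ltnW.
by move: ih' S0; set S := \sum_(_ <= _ < _) _; set P := \prod_(_ <= _ < _) _; nra.
Qed.

(** * Limits of the zeros and of their power sums *)

Section lommel_zeros.
Context {R : realType} (nu beta : R).
Context (nu_gtN1 : -1 < nu) (beta_gt0 : 0 < beta).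

Let b := beta ^+ 2 / 4.
Let A := lommel_A2 nu beta.
Let q := reversed_jacobi_poly A.

Context (z : nat -> nat -> R).
Context (z_roots : forall n, jacobi_roots A n (z n)).
Context (z_interlacing : forall n, interlacing n (z n) (z n.+1)).

Let a := pos_zero z.

Let A_gt0 n : 0 < A n.+1. Proof. exact: lommel_A2_gt0. Qed.

Let a_ge0 n k : 0 <= a n k. Proof. exact: pos_zero_ge0. Qed.

Let a_nondecr k : nondecreasing_seq (a ^~ k).
Proof. by apply/nondecreasing_seqP => n; exact: pos_zero_nondecr. Qed.

(** In Newton's identity the highest power sum has coefficient [q(0) = 1], so it is expressed
    through lower ones and through convergent coefficients. *)
Lemma cvg_pos_power_sum r : cvgn (fun n => pos_power_sum z n r.+1).
Proof.
elim/ltn_ind: r => r ih.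
have e n : pos_power_sum z n r.+1 = - (r.+1%:R * (q n)`_r.+1) -
    \sum_(0 <= i < r) (q n)`_i.+1 * pos_power_sum z n (r - i.+1).+1.
  have := coef_newton_reversed_jacobi z_roots z_interlacing n r.
  rewrite /= -/q big_ord_recl subn0 => <-.
  rewrite -horner_coef0 reversed_jacobi_poly0 mul1r.
  by rewrite big_mkord addrK.
rewrite (funext e).
apply: (cvgP (- (r.+1%:R * clifford_coef b nu r.+1) -
  \sum_(0 <= i < r) clifford_coef b nu i.+1 *
    limn (fun n => pos_power_sum z n (r - i.+1).+1))).
apply: cvgB.
  by apply: cvgN; apply: cvgn_mull; exact: cvg_coef_reversed_lommel.
rewrite big_nat; under eq_cvg do rewrite big_nat.
apply: cvg_big; first exact: add_continuous.
move=> i /andP[_ ir]; apply: cvgM; first exact: cvg_coef_reversed_lommel.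
by apply: ih; lia.
Qed.

(** Indexed so that it becomes half the moment of order [2 * r] of the ensemble: the mass of an atom
    contributes the extra square. *)
Definition lommel_power_sum r := limn (fun n => pos_power_sum z n r.+1).

(** Coefficientwise form of F_nu * sum_r S_r w^r = - F_nu', where S_r stands for
    [lommel_power_sum r]. *)
Lemma newton_lommel_power_sum r :
  \sum_(i < r.+1) clifford_coef b nu i * lommel_power_sum (r - i) =
  b / (nu + 1) * clifford_coef b (nu + 1) r.
Proof.
transitivity (- (r.+1%:R * clifford_coef b nu r.+1)); last first.
  have r0 : 0 <= (r%:R : R) by [].
  have nu1 := nu_gtN1.
  rewrite clifford_coefS// -natr1; move: b => b'.
  by field; rewrite !gt_eqF//; lra.
apply: (@cvgn_uniq _ (fun n => - (r.+1%:R * (q n)`_r.+1))).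
  have h n : - (r.+1%:R * (q n)`_r.+1) =
      \sum_(i < r.+1) (q n)`_i * pos_power_sum z n (r - i).+1.
    by rewrite coef_newton_reversed_jacobi.
  under eq_cvg do rewrite h.
  apply: cvg_big; first exact: add_continuous.
  move=> i _; apply: cvgM; first exact: cvg_coef_reversed_lommel.
  exact: cvg_pos_power_sum.
by apply: cvgN; apply: cvgn_mull; exact: cvg_coef_reversed_lommel.
Qed.

Lemma pos_power_sum_nondecr r : nondecreasing_seq (fun n => pos_power_sum z n r.+1).
Proof.
apply/nondecreasing_seqP => n; rewrite /pos_power_sum big_nat_recr//=.
rewrite -[leLHS]addr0 lerD//; last by rewrite exprn_ge0.
apply: ler_sum => k _; apply: lerXn2r; rewrite ?nnegrE//.
exact: pos_zero_nondecr.
Qed.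

Lemma pos_power_sum_le r n : pos_power_sum z n r.+1 <= lommel_power_sum r.
Proof.
exact: (nondecreasing_cvgn_le (@pos_power_sum_nondecr r) (@cvg_pos_power_sum r)).
Qed.

Lemma is_cvg_pos_zero k : cvgn (a ^~ k).
Proof.
apply: nondecreasing_is_cvgn => //.
(* A single square is at most the whole power sum [S], and [a ^ 2 <= S] implies [a <= 1 + S]. *)
exists (1 + lommel_power_sum 0) => _ [n _ <-].
have h : a n k ^+ 2 <= lommel_power_sum 0.
  apply: le_trans (pos_power_sum_le 0 n).
  have [kn|nk] := ltnP k n.
    rewrite /pos_power_sum (bigD1_seq k) ?mem_index_iota ?iota_uniq//=.
    by rewrite muln1 lerDl sumr_ge0// => i _; rewrite exprn_ge0.
  rewrite /a /pos_zero ltnNge nk/= expr0n/=.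
  by rewrite sumr_ge0// => i _; rewrite exprn_ge0// pos_zero_ge0.
have := a_ge0 n k; nra.
Qed.

Definition lommel_zero k := limn (a ^~ k).
Let x := lommel_zero.

Lemma pos_zero_le_lommel_zero n k : a n k <= x k.
Proof. exact: (nondecreasing_cvgn_le (@a_nondecr k) (@is_cvg_pos_zero k)). Qed.

Lemma lommel_zero_ge0 k : 0 <= x k.
Proof. exact: le_trans (a_ge0 0 k) (pos_zero_le_lommel_zero 0 k). Qed.

Lemma cvg_pos_zero k : a n k @[n --> \oo] --> x k.
Proof. exact: is_cvg_pos_zero. Qed.

Lemma cvgn_exp (u : nat -> R) (l : R) p :
  u n @[n --> \oo] --> l -> u n ^+ p @[n --> \oo] --> l ^+ p.
Proof.
move=> ul; elim: p => [|p ih]; first exact: cvg_cst.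
by under eq_cvg do rewrite exprS; rewrite exprS; exact: cvgM.
Qed.

(* No mass is lost in the limit, by monotonicity of each zero. *)
Lemma cvg_series_lommel_zero r :
  series (fun k => x k ^+ (2 * r.+1)) @ \oo --> lommel_power_sum r.
Proof.
apply: (@squeeze_cvgr _ _ _ _ (fun n => pos_power_sum z n r.+1) (fun=> lommel_power_sum r)).
- near=> n; rewrite seriesEnat /=; apply/andP; split.
    apply: ler_sum => k _; apply: lerXn2r; rewrite ?nnegrE ?lommel_zero_ge0//.
    exact: pos_zero_le_lommel_zero.
  have h : \sum_(0 <= k < n) a m k ^+ (2 * r.+1) @[m --> \oo] -->
      \sum_(0 <= k < n) x k ^+ (2 * r.+1).
    apply: cvg_big => [|k _]; first exact: add_continuous.
    by apply: cvgn_exp; exact: cvg_pos_zero.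
  apply: (cvgr_to_le h); near=> m.
  have nm : (n <= m)%N by near: m; exact: nbhs_infty_ge.
  apply: le_trans (pos_power_sum_le r m).
  rewrite /pos_power_sum (@big_cat_nat _ _ _ n 0 m)//= lerDl.
  by rewrite sumr_ge0// => i _; rewrite exprn_ge0.
- exact: cvg_pos_power_sum.
- exact: cvg_cst.
Unshelve. all: by end_near. Qed.

(* The zeros are symmetric and distinct, so at least half of them, up to one,
   are positive. *)
Lemma jacobi_zero_gt0 k n : (2 * k + 2 <= n)%N -> 0 < z n k.
Proof.
move=> kn; rewrite ltNge; apply/negP => zk.
have := @big_jacobi_zeroN _ A z z_roots z_interlacing _ 0%N addn (fun y => nat_of_bool (0 < y)) n.
have le_k : (\sum_(0 <= i < n) (0 < z n i)%R <= k)%N.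
  rewrite (@big_cat_nat _ _ _ k)//=; last by lia.
  rewrite [X in (_ + X)%N]big_nat_cond [X in (_ + X)%N]big1 ?addn0.
    apply: (@leq_trans (\sum_(0 <= i < k) 1)%N); last first.
      by rewrite sum_nat_const_nat subn0 muln1.
    by apply: leq_sum => i _; exact: leq_b1.
  move=> i; rewrite andbT => /andP[ki iN]; apply/eqP; rewrite eqb0 -leNgt.
  apply: le_trans zk; move: ki; rewrite leq_eqVlt => /orP[/eqP->//|ki].
  by apply/ltW/(jacobi_zero_lt z_interlacing); rewrite ki.
have ge_k : (n - k.+1 <= \sum_(0 <= i < n) (0 < - z n i)%R)%N.
  rewrite (@big_cat_nat _ _ _ k.+1)//=; last by lia.
  apply: leq_trans (leq_addl _ _).
  rewrite big_nat_cond (eq_bigr (fun=> 1%N)); last first.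
    move=> i; rewrite andbT => /andP[ki iN]; apply/eqP; rewrite eqb1 oppr_gt0.
    by apply: lt_le_trans zk; apply: (jacobi_zero_lt z_interlacing); rewrite ki.
  by rewrite -big_nat_cond sum_nat_const_nat muln1.
by move=> e; rewrite e in ge_k; have := leq_trans ge_k le_k; lia.
Qed.

Lemma pos_zeroE k n : (2 * k + 2 <= n)%N -> a n k = z n k.
Proof.
move=> kn; rewrite /a /pos_zero ifT; last by lia.
by rewrite max_r// ltW// jacobi_zero_gt0.
Qed.

Lemma pos_zero_gt0 k n : (2 * k + 2 <= n)%N -> 0 < a n k.
Proof. by move=> kn; rewrite pos_zeroE// jacobi_zero_gt0. Qed.

Lemma lommel_zero_gt0 k : 0 < x k.
Proof. exact: lt_le_trans (pos_zero_gt0 (leqnn _)) (pos_zero_le_lommel_zero _ _). Qed.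

Lemma horner_reversed_pos_zero k n : (2 * k + 2 <= n)%N -> (q n).[a n k ^- 2] = 0.
Proof.
move=> kn; apply/eqP; rewrite -sqrf_eq0.
rewrite (horner_reversed_jacobi_poly_sqr z_roots z_interlacing).
rewrite (bigD1_seq k) ?mem_index_iota ?iota_uniq//=; last by lia.
rewrite -/a divff ?subrr ?mul0r ?expr0n//.
by rewrite expf_neq0// gt_eqF// pos_zero_gt0.
Qed.

Lemma cvg_pos_zero_inv k : a n k ^- 2 @[n --> \oo] --> x k ^- 2.
Proof.
apply: cvgV; first by rewrite expf_neq0// gt_eqF// lommel_zero_gt0.
by apply: cvgn_exp; exact: cvg_pos_zero.
Qed.

Lemma clifford_lommel_zero k : clifford b nu (x k ^- 2) = 0.
Proof.
apply: (@cvgn_uniq _ (fun n => (q n).[a n k ^- 2])).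
  by apply: cvg_reversed_lommel => //; exact: cvg_pos_zero_inv.
apply: cvg_near_cst; near=> n; apply: horner_reversed_pos_zero.
by near: n; exact: nbhs_infty_ge.
Unshelve. all: by end_near. Qed.

(** If two neighbours merged in the limit, the zeros of the derivative that Rolle's theorem puts
    between their inverse squares would be squeezed to the same point, where F_nu and F_(nu+1) would
    both vanish. *)
Lemma lommel_zero_decr k : x k.+1 < x k.
Proof.
have lea n : (2 * k + 4 <= n)%N -> a n k.+1 < a n k.
  move=> kn; rewrite !pos_zeroE; try lia.
  by apply: (jacobi_zero_lt z_interlacing); lia.
rewrite lt_neqAle; apply/andP; split; last first.
  apply: (@ler_cvg_to _ \oo _ _ (a ^~ k.+1) (a ^~ k)).
  - exact: cvg_pos_zero.
  - exact: cvg_pos_zero.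
  by near=> n; apply/ltW/lea; near: n; exact: nbhs_infty_ge.
apply/eqP => xx.
have ex n : exists y, (2 * k + 4 <= n)%N ->
    a n k ^- 2 <= y <= a n k.+1 ^- 2 /\ (q n)^`().[y] = 0.
  case: (leqP (2 * k + 4) n) => kn; last by exists 0.
  have [||y + y0] := @poly_rolle _ (a n k ^- 2) (a n k.+1 ^- 2) (q n).
  - rewrite ltf_pV2 ?posrE ?exprn_gt0 ?pos_zero_gt0//; try lia.
    by rewrite ltrXn2r ?nnegrE// lea.
  - by rewrite !horner_reversed_pos_zero//; lia.
  rewrite in_itv/= => /andP[/ltW y1 /ltW y2].
  by exists y => _; rewrite y1 y2.
have [c cP] := choice ex.
have cx : c n @[n --> \oo] --> x k ^- 2.
  apply: (@squeeze_cvgr _ _ _ _ (fun n => a n k ^- 2) (fun n => a n k.+1 ^- 2)).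
  - near=> n.
    have kn : (2 * k + 4 <= n)%N by near: n; exact: nbhs_infty_ge.
    by have [] := cP n kn.
  - exact: cvg_pos_zero_inv.
  - by rewrite -xx; exact: cvg_pos_zero_inv.
have := clifford_simple nu_gtN1 beta_gt0 (clifford_lommel_zero k).
apply/negP; rewrite negbK -/b.
have : - (b / (nu + 1)) * clifford b (nu + 1) (x k ^- 2) = 0.
  apply: (@cvgn_uniq _ (fun n => (q n)^`().[c n])).
    exact: cvg_deriv_reversed_lommel.
  apply: cvg_near_cst; near=> n.
  have kn : (2 * k + 4 <= n)%N by near: n; exact: nbhs_infty_ge.
  by have [] := cP n kn.
move/eqP; rewrite mulf_eq0 => /orP[|//].
rewrite oppr_eq0 gt_eqF// divr_gt0 ?quarter_sqr_gt0//.
by move: nu_gtN1 => ?; lra.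
Unshelve. all: by end_near. Qed.

Lemma lommel_zero_lt i j : (i < j)%N -> x j < x i.
Proof.
elim: j => [//|j ih]; rewrite ltnS leq_eqVlt => /orP[/eqP->|/ih]; first exact: lommel_zero_decr.
exact: lt_trans (lommel_zero_decr j).
Qed.

(** Beyond some [K] the sum of the [w * x k ^+ 2] is at most 1/2. As each [a n k] is below its
    limit, Weierstrass's inequality bounds the tail of the product below by 1/2 for every large [n],
    while the first [K] factors have a nonzero limit. Squares are compared because the product
    formula gives [q n] only up to sign. *)
Lemma clifford_neq0 (w : R) : 0 < w -> (forall k, w != x k ^- 2) -> clifford b nu w != 0.
Proof.
move=> w0 wx.
have S1 := @cvg_series_lommel_zero 0.
have [K hK] : exists K, forall n, w * \sum_(K <= k < n) x k ^+ 2 <= 1 / 2.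
  have e0 : 0 < (w *+ 2)^-1 by rewrite invr_gt0 pmulrn_lgt0.
  move/cvgrPdist_le : (S1) => /(_ _ e0)[K _ /(_ K)] /=; rewrite leqnn => /(_ isT) h.
  exists K => n.
  have [Kn|nK] := leqP K n; last by rewrite big_geq ?mulr0// ltnW.
  have {}h : lommel_power_sum 0 - series (fun k => x k ^+ (2 * 1)) K <= (w *+ 2)^-1.
    exact: le_trans (ler_norm _) h.
  have h2 : series (fun k => x k ^+ (2 * 1)) n <= lommel_power_sum 0.
    rewrite -(cvg_lim (@Rhausdorff R) S1); apply: nondecreasing_cvgn_le.
      by apply: nondecreasing_series => i _ _; rewrite exprn_ge0 ?lommel_zero_ge0.
    exact: cvgP S1.
  have -> : (1 / 2 : R) = w * (w *+ 2)^-1.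
    by rewrite -mulr_natr; field; rewrite gt_eqF.
  rewrite ler_pM2l//.
  have := sub_series_geq (fun k => x k ^+ (2 * 1)) Kn.
  by rewrite muln1 => <-; rewrite muln1 in h h2; apply: le_trans h; rewrite lerB.
have PK : \prod_(0 <= k < K) (1 - a n k ^+ 2 * w) @[n --> \oo] -->
    \prod_(0 <= k < K) (1 - x k ^+ 2 * w).
  apply: cvg_big => [|k _]; first exact: mul_continuous.
  apply: cvgB; first exact: cvg_cst.
  by apply: cvgMr_tmp; apply: cvgn_exp; exact: cvg_pos_zero.
have PK0 : \prod_(0 <= k < K) (1 - x k ^+ 2 * w) != 0.
  rewrite big_mkord; apply/prodf_neq0 => k _; rewrite subr_eq0.
  apply: contra (wx k) => /eqP h; apply/eqP.
  have xk : x k ^+ 2 != 0 by rewrite expf_neq0// gt_eqF// lommel_zero_gt0.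
  by apply: (mulfI xk); rewrite divff.
have qc : (q n).[w] ^+ 2 @[n --> \oo] --> clifford b nu w ^+ 2.
  by apply: cvgn_exp; apply: cvg_reversed_lommel => //; exact: cvg_cst.
suff : 0 < clifford b nu w ^+ 2 by move=> h; move: (gt_eqF h); rewrite sqrf_eq0 => ->.
apply: (@lt_le_trans _ _ ((\prod_(0 <= k < K) (1 - x k ^+ 2 * w)) ^+ 2 * (1 / 2) ^+ 2)).
  by rewrite -exprMn exprn_even_gt0//= mulf_neq0//; lra.
have h : (\prod_(0 <= k < K) (1 - a n k ^+ 2 * w)) ^+ 2 * (1 / 2) ^+ 2 @[n --> \oo] -->
   (\prod_(0 <= k < K) (1 - x k ^+ 2 * w)) ^+ 2 * (1 / 2) ^+ 2.
  by apply: cvgMr_tmp; exact: cvgn_exp.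
apply: (@ler_cvg_to _ \oo _ _
  (fun n => (\prod_(0 <= k < K) (1 - a n k ^+ 2 * w)) ^+ 2 * (1 / 2) ^+ 2)
  (fun n => (q n).[w] ^+ 2)) => //; near=> n.
have Kn : (K <= n)%N by near: n; exact: nbhs_infty_ge.
rewrite (horner_reversed_jacobi_poly_sqr z_roots z_interlacing) -/a.
rewrite (@big_cat_nat _ _ _ K 0 n)//= [leRHS]exprMn ler_wpM2l ?sqr_ge0//.
have S0 m k : 0 <= a m k ^+ 2 * w by rewrite mulr_ge0 ?sqr_ge0// ltW.
have Shalf m : \sum_(K <= k < m) a n k ^+ 2 * w <= 1 / 2.
  apply: le_trans (hK m); rewrite mulr_sumr; apply: ler_sum => k _.
  rewrite mulrC ler_pM2l// lerXn2r ?nnegrE ?lommel_zero_ge0//.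
  exact: pos_zero_le_lommel_zero.
have : 1 / 2 <= \prod_(K <= k < n) (1 - a n k ^+ 2 * w).
  apply: le_trans (@prod_1B_ge _ _ _ _ _); first by move: (Shalf n); lra.
  move=> k /andP[Kk kn]; rewrite S0/=.
  have : a n k ^+ 2 * w <= 1 / 2; last by lra.
  apply: le_trans (Shalf k.+1); rewrite big_nat_recr//= lerDr.
  by rewrite sumr_ge0.
by move=> h1; apply: lerXn2r; rewrite ?nnegrE//; lra.
Unshelve. all: by end_near. Qed.

Lemma clifford_eq0 (w : R) : 0 < w ->
  clifford b nu w = 0 <-> exists k, w = x k ^- 2.
Proof.
move=> w0; split=> [c0|[k ->]]; last exact: clifford_lommel_zero.
apply: contrapT => /forallNP h; move/eqP: c0; apply/negP.
by apply: clifford_neq0 => // k; apply/eqP; exact: h.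
Qed.

End lommel_zeros.

(** * Functional equation of the Gamma function *)

Section gamma_function.
Context {R : realType}.
Notation leb := (@lebesgue_measure R).
Implicit Types (x t : R) (n : nat).

Let g x t : R := t `^ (x - 1) * expR (- t).
(** Truncating to [[1 / (n + 2), n + 2]] avoids the singularity at 0 for [x < 1]; the offset 2 keeps
    the interval nondegenerate at [n = 0]. *)
Let lo n : R := n.+2%:R^-1.
Let hi n : R := n.+2%:R.
Let K n : set R := `[lo n, hi n]%classic.
Let J n x : R := \int[leb]_(t in K n) g x t.

Let lo_gt0 n : 0 < lo n. Proof. by rewrite invr_gt0 ltr0n. Qed.

Let lo_lt1 n : lo n < 1. Proof. by rewrite invf_lt1 ?ltr0n// ltr1n. Qed.

Let lo_lt_hi n : lo n < hi n.
Proof. by rewrite (lt_trans (lo_lt1 n))// ltr1n. Qed.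

Let g_ge0 x t : 0 <= g x t.
Proof. by rewrite mulr_ge0 ?powR_ge0 ?expR_ge0. Qed.

Let is_derive_expRN (t : R) : is_derive t 1 (fun s => expR (- s)) (- expR (- t)).
Proof.
have := @is_derive1_comp R expR -%R t _ _ (is_derive_expR _) (is_deriveNid t 1).
by move=> h; apply: is_derive_eq; rewrite mulrN1.
Qed.

Let cont_powR x t : 0 < t -> {for t, continuous (fun s => s `^ x)}.
Proof.
move=> t0; apply/differentiable_continuous/derivable1_diffP.
by have [] := is_derive1_powR x t0.
Qed.

Let cont_expRN t : {for t, continuous (fun s : R => expR (- s))}.
Proof.
apply/differentiable_continuous/derivable1_diffP.
by have [] := is_derive_expRN t.
Qed.

Let cont_g x t : 0 < t -> {for t, continuous (g x)}.
Proof. by move=> t0; apply: cvgM; [exact: cont_powR|exact: cont_expRN]. Qed.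

Let within_K n (f : R -> R) : (forall t, 0 < t -> {for t, continuous f}) ->
  {within K n, continuous f}.
Proof.
move=> cf; apply: continuous_in_subspaceT => t; rewrite inE /K/= in_itv/= => /andP[t0 _].
exact/cf/(lt_le_trans (lo_gt0 n)).
Qed.

Let deriv_K n (f : R -> R) : (forall t, 0 < t -> derivable f t 1) ->
  derivable_oo_LRcontinuous f (lo n) (hi n).
Proof.
move=> df; have cf t : 0 < t -> {for t, continuous f}.
  by move=> t0; apply/differentiable_continuous/derivable1_diffP/df.
split.
- by move=> t; rewrite in_itv/= => /andP[t0 _]; apply/df/(lt_trans (lo_gt0 n)).
- exact/cvg_at_right_filter/cf.
- by apply/cvg_at_left_filter/cf; exact: lt_trans (lo_lt_hi n).
Qed.

Let integrable_K n (f : R -> R) : (forall t, 0 < t -> {for t, continuous f}) ->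
  leb.-integrable (K n) (EFin \o f).
Proof.
move=> cf; apply: continuous_compact_integrable; first exact: segment_compact.
exact: within_K.
Qed.

Let truncated_by_parts n x : J n (x + 1) =
  (lo n `^ x * expR (- lo n) - hi n `^ x * expR (- hi n)) + x * J n x.
Proof.
have h := @Rintegration_by_parts R (fun t => t `^ x) (fun t => - expR (- t))
  (fun t => x * t `^ (x - 1)) (fun t => expR (- t)) (lo n) (hi n) (lo_lt_hi n).
have -> : J n (x + 1) = \int[leb]_(t in K n) (t `^ x * expR (- t)).
  by apply: eq_Rintegral => t _; rewrite /g addrK.
rewrite {}h.
- rewrite !mulrN opprK; congr (_ + _); first by rewrite addrC.
  rewrite -RintegralZl//; last by apply: integrable_K => t; exact: cont_g.
  rewrite -[LHS]mulN1r -RintegralZl//.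
  + by apply: eq_Rintegral => t _; rewrite /g; ring.
  + apply: integrable_K => t t0; apply: cvgM.
      by apply: cvgM; [exact: cvg_cst|exact: cont_powR].
    by apply: cvgN; exact: cont_expRN.
- exact: measurable_itv.
- apply: within_K => t t0; apply: cvgM; first exact: cvg_cst.
  exact: cont_powR.
- by apply: deriv_K => t t0; have [] := is_derive1_powR x t0.
- move=> t; rewrite in_itv/= => /andP[t0 _].
  by rewrite powR_derive1// in_itv/= (lt_trans (lo_gt0 n)).
- by apply: within_K => t _; exact: cont_expRN.
- apply: deriv_K => t _; have h := is_deriveN (is_derive_expRN t).
  by have [] := h.
- move=> t _; rewrite derive1E; have h := is_deriveN (is_derive_expRN t).
  by have [_ ->] := h; rewrite opprK.
Qed.

Let cvg_truncated x :
  (J n x)%:E @[n --> \oo] --> (\int[leb]_(t in `]0%R, +oo[) (g x t)%:E)%E.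
Proof.
have -> : `]0, +oo[%classic = \bigcup_n K n.
  apply/seteqP; split=> [t|t [n _]]; last first.
    by rewrite /K/= !in_itv/= andbT => /andP[t0 _]; exact: (lt_le_trans (lo_gt0 n) t0).
  rewrite /= in_itv/= andbT => t0.
  have [n [h1 h2]] : exists n, t <= n%:R /\ t^-1 <= n%:R.
    exists (maxn (Num.bound t) (Num.bound t^-1)); split.
      by rewrite (le_trans (ltW (archi_boundP (ltW t0))))// ler_nat leq_maxl.
    rewrite (le_trans (ltW (archi_boundP _)))//; last by rewrite ler_nat leq_maxr.
    by rewrite invr_ge0 ltW.
  exists n => //; rewrite /K/= in_itv/=; apply/andP; split.
    rewrite /lo invf_ple ?posrE//; apply: le_trans h2 _; rewrite ler_nat; lia.
  by apply: le_trans h1 _; rewrite ler_nat; lia.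
have mK n : measurable (K n) by exact: measurable_itv.
have mg n : measurable_fun (K n) (EFin \o g x).
  by have /integrableP[] := integrable_K n (@cont_g x).
rewrite (_ : (fun n => (J n x)%:E) = fun n => (\int[leb]_(t in K n) (g x t)%:E)%E).
  apply: ge0_nondecreasing_set_cvg_integral => //.
  - apply/nondecreasing_seqP => n; apply/subsetPset => t; rewrite /K/= !in_itv/=.
    move=> /andP[t1 t2]; apply/andP; split.
      by apply: le_trans t1; rewrite lef_pV2 ?posrE ?ltr0n// ler_nat.
    by apply: le_trans t2 _; rewrite ler_nat.
  - by move=> n t _; rewrite lee_fin.
apply/funext => n; rewrite /J /Rintegral fineK//.
apply: integrable_fin_num; first exact: mK.
exact: (integrable_K n (@cont_g x)).
Qed.

(** One term of the exponential series beats [t ^ (x + 1)]. The spare factor [t^-1] makes the bound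
    serve both for boundedness and for a limit 0. *)
Let powR_expRN_le t x (N : nat) : 1 <= t -> x + 1 <= N.+1%:R ->
  t `^ x * expR (- t) <= N.+1`!%:R * t^-1.
Proof.
move=> t1 xN; have t0 : 0 < t by rewrite (lt_le_trans ltr01).
rewrite expRN ler_pdivrMr ?expR_gt0// mulrAC ler_pdivlMr//.
have -> : t `^ x * t = t `^ (x + 1).
  by rewrite powRD ?powRr1 ?ltW// (gt_eqF t0) implybT.
apply: (@le_trans _ _ (t `^ N.+1%:R)); first by rewrite ler_powR.
rewrite (powR_mulrn _ (ltW t0)).
have := @expR_ge1Dxn R t N (ltW t0).
have f0 : 0 < N.+1`!%:R :> R by rewrite ltr0n fact_gt0.
move=> h; rewrite -ler_pdivrMl// mulrC; apply: le_trans h; by rewrite lerDr.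
Qed.

Let nat_above x : exists N : nat, x + 1 <= N.+1%:R.
Proof.
exists (Num.bound `|x|); rewrite -natr1 lerD2r.
by rewrite (le_trans (ler_norm _))// ltW// archi_boundP.
Qed.

Let truncated_step n x : 0 <= x -> J n (x + 1) <= 1 + x * J n x.
Proof.
move=> x0; rewrite truncated_by_parts lerD2r.
have h1 : lo n `^ x <= 1.
  rewrite -(powRr0 (lo n)); apply: ger_powR => //.
  by rewrite lo_gt0 ltW.
have h2 : expR (- lo n) <= 1 by rewrite -expR0 ler_expR oppr_le0 ltW.
have h3 : 0 <= hi n `^ x * expR (- hi n) by rewrite mulr_ge0 ?powR_ge0 ?expR_ge0.
rewrite lerBlDr -[leLHS]addr0 lerD// -[leRHS]mulr1 ler_pM ?powR_ge0 ?expR_ge0//.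
Qed.

Let truncated_nat_bound (N : nat) : exists M, forall n, J n N.+1%:R <= M.
Proof.
elim: N => [|N [M hM]].
  exists 1 => n; have := truncated_step n (lexx 0).
  by rewrite add0r mul0r addr0.
exists (1 + N.+1%:R * M) => n; rewrite -natr1.
by apply: le_trans (truncated_step n _) _ => //; rewrite lerD2l ler_pM2l// ltr0n.
Qed.

(** Positive integer arguments are bounded by iterating the integration by parts. In general
    [t ^ x <= 1 + t ^ (N + 1)] bounds the truncation at [x + 1], and integration by parts, divided
    by [x], comes back to [x], even in the singular range below 1. *)
Let truncated_bound x : 0 < x -> exists M, forall n, J n x <= M.
Proof.
move=> x0; have [N xN] := nat_above x.
have [M1 hM1] := truncated_nat_bound 0.
have [M2 hM2] := truncated_nat_bound N.+1.
have hx1 n : J n (x + 1) <= M1 + M2.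
  apply: le_trans (lerD (hM1 n) (hM2 n)).
  rewrite -RintegralD//=; last 2 first.
  - by apply: integrable_K => t; exact: cont_g.
  - by apply: integrable_K => t; exact: cont_g.
  apply: le_Rintegral => //.
  - exact: measurable_itv.
  - by apply: integrable_K => t; exact: cont_g.
  - apply: integrable_K => t t0; apply: cvgD; exact: cont_g.
  - move=> t; rewrite /K/= in_itv/= => /andP[t0 _].
    have {}t0 : 0 < t := lt_le_trans (lo_gt0 n) t0.
    rewrite /g -mulrDl ler_wpM2r ?expR_ge0// subrr powRr0 addrK.
    have [t1|/ltW t1] := leP t 1.
      rewrite -[leLHS]addr0 lerD ?powR_ge0//.
      by rewrite -(powRr0 t); apply: ger_powR; rewrite ?t0// ltW.
    rewrite -[leLHS]add0r lerD//; apply: ler_powR => //.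
    by rewrite lerBrDr (le_trans xN)// ler_nat.
  exact: measurable_itv.
exists ((M1 + M2 + N.+1`!%:R) / x) => n.
rewrite ler_pdivlMr// mulrC.
have -> : x * J n x = J n (x + 1) -
    (lo n `^ x * expR (- lo n) - hi n `^ x * expR (- hi n)).
  by rewrite truncated_by_parts addrAC subrr add0r.
have h1 : 0 <= lo n `^ x * expR (- lo n) by rewrite mulr_ge0 ?powR_ge0 ?expR_ge0.
have h2 : hi n `^ x * expR (- hi n) <= N.+1`!%:R * (hi n)^-1.
  by apply: powR_expRN_le => //; rewrite ler1n.
have h3 : N.+1`!%:R * (hi n)^-1 <= N.+1`!%:R :> R.
  by rewrite -[leRHS]mulr1 ler_wpM2l// ltW// lo_lt1.
rewrite opprB addrA; apply: (@le_trans _ _ (J n (x + 1) + hi n `^ x * expR (- hi n))).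
  by rewrite lerBlDr lerDl.
by rewrite lerD// (le_trans h2).
Qed.

Let gamma_integral_fin x : 0 < x ->
  (\int[leb]_(t in `]0%R, +oo[) (g x t)%:E)%E \is a fin_num.
Proof.
move=> /truncated_bound[M hM].
rewrite ge0_fin_numE; last by apply: integral_ge0 => t _; rewrite lee_fin.
rewrite (@le_lt_trans _ _ M%:E) ?ltry//.
rewrite -(cvg_lim _ (@cvg_truncated x))//.
apply: lime_le; first by apply: cvgP; exact: cvg_truncated.
by apply: nearW => n; rewrite lee_fin.
Qed.

Let cvg_truncated_Gamma x : 0 < x -> J n x @[n --> \oo] --> Gamma x.
Proof.
move=> x0; have := @cvg_truncated x; rewrite -(fineK (gamma_integral_fin x0)).
by move/fine_cvg.
Qed.

Let cvg_lo_powR x : 0 < x -> lo n `^ x @[n --> \oo] --> (0 : R).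
Proof.
move=> x0; suff h : lo @ \oo --> (0 : R)^'+.
  have h1 := powR_cvg0 x0; have h2 := cvg_comp lo _ h h1; exact: h2.
move=> S [e /= e0 eS]; have := @cvg_inv_addn R 2.
move/cvgrPdist_lt => /(_ _ e0); apply: filterS => n h; apply: eS => //=.
by move: h; rewrite -natrD add2n.
Qed.

Lemma GammaS x : 0 < x -> Gamma (x + 1) = x * Gamma x.
Proof.
move=> x0.
have c1 : J n (x + 1) @[n --> \oo] --> Gamma (x + 1).
  by apply: cvg_truncated_Gamma; rewrite addr_gt0.
apply: (cvgn_uniq c1).
under eq_cvg do rewrite truncated_by_parts.
have -> : x * Gamma x = (0 - 0) + x * Gamma x by rewrite subrr add0r.
apply: cvgD; last by apply: cvgn_mull; exact: cvg_truncated_Gamma.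
apply: cvgB.
  apply: (@squeeze_cvgr _ _ _ _ (fun=> 0) (fun n => lo n `^ x)).
  - near=> n; rewrite mulr_ge0 ?powR_ge0 ?expR_ge0//=.
    rewrite -[leRHS]mulr1 ler_wpM2l ?powR_ge0//.
    by rewrite -expR0 ler_expR oppr_le0 ltW.
  - exact: cvg_cst.
  - exact: cvg_lo_powR.
have [N xN] := nat_above x.
apply: (@squeeze_cvgr _ _ _ _ (fun=> 0) (fun n => N.+1`!%:R * (2 + n%:R)^-1)).
- near=> n; rewrite mulr_ge0 ?powR_ge0 ?expR_ge0//=.
  rewrite -natrD add2n; apply: powR_expRN_le => //; by rewrite ler1n.
- exact: cvg_cst.
- by have := @cvgn_mull _ (N.+1`!%:R) _ _ (@cvg_inv_addn R 2); rewrite mulr0.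
Unshelve. all: by end_near. Qed.

Lemma Gamma_gt0 x : 0 < x -> 0 < Gamma x.
Proof.
move=> x0.
have [c] := EVT_min (ltW (lo_lt_hi 0)) (@within_K 0 _ (@cont_g x)).
rewrite in_itv/= => /andP[c0 _] hc.
have gc0 : 0 < g x c.
  by rewrite mulr_gt0 ?expR_gt0// powR_gt0// (lt_le_trans (lo_gt0 0)).
have mK : measurable (K 0) by exact: measurable_itv.
apply: (@lt_le_trans _ _ (J 0 x)).
  apply: (@lt_le_trans _ _ (\int[leb]_(t in K 0) g x c)).
    rewrite Rintegral_cst; last exact: measurable_itv.
    apply: mulr_gt0 => //.
    have h := @lebesgue_measure_itv R `[lo 0, hi 0]; rewrite /= lte_fin lo_lt_hi in h.
    have h2 : fine (leb (K 0)) = hi 0 - lo 0 by rewrite -[RHS]/(fine (hi 0 - lo 0)%:E) EFinB -h.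
    by apply: lt_le_trans (_ : hi 0 - lo 0 <= _); rewrite ?subr_gt0// -h2.
  apply: le_Rintegral => //.
  - by apply: integrable_K => t _; exact: cvg_cst.
  - by apply: integrable_K => t; exact: cont_g.
have iK := integrable_K 0 (@cont_g x).
rewrite -lee_fin /Gamma /J /Rintegral fineK; last by apply: integrable_fin_num; [exact: mK|exact: iK].
rewrite fineK; last exact: gamma_integral_fin.
apply: ge0_subset_integral => //.
- apply/measurable_EFinP; apply: open_continuous_measurable_fun => //.
  by move=> t; rewrite inE/= in_itv/= andbT => t0; exact: cont_g.
- by move=> t _; rewrite lee_fin.
- move=> t; rewrite /K/= !in_itv/= andbT => /andP[t0 _].
  exact: lt_le_trans (lo_gt0 0) t0.
Qed.

Lemma Gamma_rising (x : R) (j : nat) : 0 < x ->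
  Gamma (x + j%:R) = Gamma x * rising x j.
Proof.
move=> x0; elim: j => [|j ih]; first by rewrite addr0 /rising big_nil mulr1.
rewrite -natr1 addrA GammaS; last by rewrite ltr_pwDl.
by rewrite ih risingS; ring.
Qed.

End gamma_function.

(** * Zeros of Bessel functions *)

Section bessel_zeros.
Context {R : realType} (nu beta : R).
Context (nu_gtN1 : -1 < nu) (beta_gt0 : 0 < beta).

Let b := beta ^+ 2 / 4.
Let A := lommel_A2 nu beta.

Lemma besselJ_clifford (y w : R) : 0 < y -> b * w = (y / 2) ^+ 2 ->
  besselJ nu y = (y / 2) `^ nu / Gamma (nu + 1) * clifford b nu w.
Proof.
move=> y0 bw; have nu1 := nu_gtN1.
have y2 : 0 < y / 2 by rewrite divr_gt0.
have G0 : 0 < Gamma (nu + 1) by apply: Gamma_gt0; lra.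
apply/cvg_lim => //.
rewrite (_ : series _ = fun n => (y / 2) `^ nu / Gamma (nu + 1) *
    series (fun j => clifford_coef b nu j * w ^+ j) n).
  by apply: cvgn_mull; exact: is_cvg_clifford.
apply/funext => n; rewrite !seriesEnat /= mulr_sumr; apply: eq_bigr => k _.
have -> : nu + k%:R + 1 = nu + 1 + k%:R by lra.
rewrite Gamma_rising; last by lra.
rewrite powRD; last by rewrite (gt_eqF y2) implybT.
rewrite powR_mulrn ?(ltW y2)// exprM -bw /clifford_coef exprMn (exprNn b).
have f0 : k`!%:R != 0 :> R by rewrite pnatr_eq0 -lt0n fact_gt0.
have r0 : 0 < rising (nu + 1) k by apply: rising_gt0; lra.
by field; rewrite f0 !gt_eqF.
Qed.

Lemma besselJ_eq0 (y w : R) : 0 < y -> b * w = (y / 2) ^+ 2 ->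
  besselJ nu y = 0 <-> clifford b nu w = 0.
Proof.
move=> y0 bw; have nu1 := nu_gtN1; rewrite (besselJ_clifford y0 bw).
split=> [/eqP|->]; last by rewrite mulr0.
rewrite mulf_eq0 => /orP[|/eqP//]; rewrite gt_eqF// divr_gt0//.
  by rewrite powR_gt0// divr_gt0.
by apply: Gamma_gt0; lra.
Qed.

Section with_zeros.
Context (z : nat -> nat -> R).
Context (z_roots : forall n, jacobi_roots A n (z n)).
Context (z_interlacing : forall n, interlacing n (z n) (z n.+1)).

Let x := lommel_zero z.

Let x_gt0 k : 0 < x k.
Proof. exact: (lommel_zero_gt0 nu_gtN1 beta_gt0 z_roots z_interlacing). Qed.

Lemma positive_bessel_zeros (y : R) : 0 < y ->
  besselJ nu y = 0 <-> exists k, y = beta / x k.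
Proof.
move=> y0; have b0 : 0 < b := quarter_sqr_gt0 beta_gt0.
have w0 : 0 < (y / beta) ^+ 2 by rewrite exprn_gt0// divr_gt0.
have bw : b * (y / beta) ^+ 2 = (y / 2) ^+ 2.
  by rewrite /b; field; rewrite gt_eqF.
rewrite (besselJ_eq0 y0 bw) (clifford_eq0 nu_gtN1 beta_gt0 z_roots z_interlacing w0).
split=> -[k e]; exists k; last first.
  rewrite e -/x -exprVn; congr (_ ^+ 2); have := x_gt0 k; move=> ?.
  by field; rewrite !gt_eqF.
move: e; rewrite -exprVn => /eqP; rewrite eqrXn2 ?divr_ge0 ?invr_ge0 ?ltW//.
by move=> /eqP e; rewrite mulrC -e divfK// gt_eqF.
Qed.

Let x_lt i j : (i < j)%N -> x j < x i.
Proof. exact: (lommel_zero_lt nu_gtN1 beta_gt0 z_roots z_interlacing). Qed.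

Lemma bessel_zero_lommel k : bessel_zero nu k.+1 = beta / x k.
Proof.
(* [l] will be 0 or the previous zero. In both cases the zeros above [l] are those of index at least
   [m], and the infimum is attained at [m] because [x] decreases. *)
have step (l : R) m : (forall y, l < y /\ besselJ nu y = 0 <->
    exists2 j, (m <= j)%N & y = beta / x j) ->
    inf [set y | l < y /\ besselJ nu y = 0] = beta / x m.
  move=> lP; have min j : (m <= j)%N -> beta / x m <= beta / x j.
    rewrite leq_eqVlt => /orP[/eqP->//|mj].
    by rewrite ler_pM2l// lef_pV2 ?posrE// ltW// x_lt.
  apply/eqP; rewrite eq_le; apply/andP; split.
    apply: ge_inf; last by apply/lP; exists m.
    by exists (beta / x m) => y /lP[j mj ->]; exact: min.
  apply: lb_le_inf; first by exists (beta / x m); apply/lP; exists m.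
  by move=> y /lP[j mj ->]; exact: min.
elim: k => [|k ih]; rewrite [LHS]/=.
  apply: step => y; split=> [[y0]|[j _ ->]].
    by move=> /(positive_bessel_zeros y0)[j ->]; exists j.
  have yj : 0 < beta / x j by rewrite divr_gt0.
  by split=> //; apply/(positive_bessel_zeros yj); exists j.
rewrite -/(bessel_zero nu k.+1) ih; apply: step => y; split=> [[y0]|[j kj ->]].
  have y1 : 0 < y by rewrite (lt_trans _ y0)// divr_gt0.
  move=> /(positive_bessel_zeros y1)[j yj]; exists j => //.
  rewrite ltnNge; apply/negP => jk; move: y0; rewrite yj ltNge; apply/negP.
  rewrite negbK ler_pM2l// lef_pV2 ?posrE//.
  by move: jk; rewrite leq_eqVlt => /orP[/eqP->//|/x_lt/ltW].
have yj : 0 < beta / x j by rewrite divr_gt0.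
split; last by apply/(positive_bessel_zeros yj); exists j.
by rewrite ltr_pM2l// ltf_pV2 ?posrE// x_lt.
Qed.

End with_zeros.

(** Free of the auxiliary family [z], which from here on occurs only inside proofs; the shift of
    index makes the largest atom the one of index 0. *)
Definition lommel_atom k : R := beta / bessel_zero nu k.+1.

Let atomE z (zr : forall n, jacobi_roots A n (z n))
    (zi : forall n, interlacing n (z n) (z n.+1)) : lommel_atom = lommel_zero z.
Proof.
apply/funext => k; rewrite /lommel_atom (bessel_zero_lommel zr zi) invfM invrK.
by rewrite mulrA divff ?mul1r// gt_eqF.
Qed.

Lemma lommel_atom_gt0 k : 0 < lommel_atom k.
Proof.
have [z [zr zi]] := exists_jacobi_zeros (lommel_A2_gt0 nu_gtN1 beta_gt0).
by rewrite (atomE zr zi) (lommel_zero_gt0 nu_gtN1 beta_gt0 zr zi).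
Qed.

Lemma lommel_atom_le k : lommel_atom k <= lommel_atom 0.
Proof.
have [z [zr zi]] := exists_jacobi_zeros (lommel_A2_gt0 nu_gtN1 beta_gt0).
rewrite (atomE zr zi); case: k => // k.
by apply/ltW/(lommel_zero_lt nu_gtN1 beta_gt0 zr zi).
Qed.

(* The Rayleigh sums, through the Taylor coefficients of
   J_(nu + 1) / J_nu. *)
Lemma rayleigh_sums : exists S : nat -> R,
  (forall r, series (fun k => lommel_atom k ^+ (2 * r.+1)) @ \oo --> S r) /\
  (forall r, \sum_(i < r.+1) clifford_coef b nu i * S (r - i)%N =
    b / (nu + 1) * clifford_coef b (nu + 1) r).
Proof.
have [z [zr zi]] := exists_jacobi_zeros (lommel_A2_gt0 nu_gtN1 beta_gt0).
exists (lommel_power_sum z); rewrite (atomE zr zi); split=> r.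
  exact: (cvg_series_lommel_zero nu_gtN1 beta_gt0 zr zi).
exact: (newton_lommel_power_sum nu_gtN1 beta_gt0 zr zi).
Qed.

(** Every zero of the polynomial stays below its limit, hence below the largest atom. *)
Lemma jacobi_lommel_gt0 n (y : R) : lommel_atom 0 < y -> 0 < (jacobi_poly A n).[y].
Proof.
have [z [zr zi]] := exists_jacobi_zeros (lommel_A2_gt0 nu_gtN1 beta_gt0).
rewrite (atomE zr zi) => x0y; rewrite zr horner_prod big_nat; apply: prodr_gt0.
move=> k /andP[_ kn]; rewrite !hornerE subr_gt0; apply: le_lt_trans x0y.
apply: (@le_trans _ _ (lommel_zero z k)); last first.
  by rewrite -(atomE zr zi) lommel_atom_le.
apply: le_trans (pos_zero_le_lommel_zero nu_gtN1 beta_gt0 zr zi n k).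
by rewrite /pos_zero kn le_max lexx orbT.
Qed.

Lemma cvg_jacobi_lommel : (jacobi_poly A n).[2] / 2 ^+ n @[n --> \oo] -->
  clifford b nu (1 / 4).
Proof.
have h n : (jacobi_poly A n).[2] / 2 ^+ n = (reversed_jacobi_poly A n).[1 / 4].
  have n2 : (2 : R) ^+ n != 0 by rewrite expf_neq0.
  have -> : 1 / 4 = (2 : R) ^- 2 by field.
  by rewrite horner_reversed_jacobi_poly// mulrAC divff// mul1r.
under eq_cvg do rewrite h.
by apply: cvg_reversed_lommel => //; exact: cvg_cst.
Qed.

Lemma clifford_quarter_besselJ :
  Gamma (nu + 1) * (4 / beta) `^ nu * besselJ nu (beta / 2) = clifford b nu (1 / 4).
Proof.
have nu1 := nu_gtN1.
have G0 : 0 < Gamma (nu + 1) by apply: Gamma_gt0; lra.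
rewrite (@besselJ_clifford _ (1 / 4)) ?divr_gt0//; last by rewrite /b; field.
have -> : beta / 2 / 2 = (4 / beta)^-1 by field; rewrite gt_eqF.
have p0 : 0 < (4 / beta) `^ nu by rewrite powR_gt0// divr_gt0.
have -> : (4 / beta)^-1 `^ nu = ((4 / beta) `^ nu)^-1.
  have c0 : 0 <= 4 / beta by rewrite divr_ge0// ltW.
  apply: (@mulfI _ ((4 / beta) `^ nu)); first by rewrite gt_eqF.
  rewrite -powRM ?invr_ge0// divff ?mulfV ?gt_eqF ?powR1//.
  by rewrite divr_gt0.
by field; rewrite !gt_eqF.
Qed.

(** A limit of positive numbers is only nonnegative; this one is nonzero because [1 / 4] lies
    strictly below every zero [x_k ^- 2] of F_nu. *)
Lemma clifford_quarter_gt0 : lommel_atom 0 < 2 -> 0 < clifford b nu (1 / 4).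
Proof.
move=> x2; have [z [zr zi]] := exists_jacobi_zeros (lommel_A2_gt0 nu_gtN1 beta_gt0).
rewrite lt_neqAle; apply/andP; split; last first.
  apply: (cvgr_to_ge cvg_jacobi_lommel); apply: nearW => n.
  by rewrite divr_ge0 ?exprn_ge0// ltW// jacobi_lommel_gt0.
rewrite eq_sym; apply/(clifford_neq0 nu_gtN1 beta_gt0 zr zi) => [|k].
  by rewrite divr_gt0.
rewrite -(atomE zr zi); have x0 := lommel_atom_gt0 k.
rewrite lt_eqF// mul1r ltf_pV2 ?posrE ?exprn_gt0//.
have -> : 4 = 2 ^+ 2 :> R by rewrite expr2; lra.
by rewrite ltrXn2r ?nnegrE ?ltW// (le_lt_trans (lommel_atom_le k)).
Qed.

End bessel_zeros.

(** * The Szego recurrence *)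

Section toeplitz_form.
Context {K : fieldType} (c : nat -> K).
Implicit Types (p : {poly K}) (k : int).

(* The pairing of p with z ^ k for the Toeplitz moments c_(-j) = c_j. *)
Definition toeplitz_form k p : K :=
  \sum_(i < size p) p`_i * c (absz (i%:Z - k)).

Lemma toeplitz_form_wide n k p : (size p <= n)%N ->
  toeplitz_form k p = \sum_(i < n) p`_i * c (absz (i%:Z - k)).
Proof.
move=> pn; rewrite /toeplitz_form (big_ord_widen n (fun i => p`_i * c (absz (i%:Z - k))))//.
rewrite big_mkcond; apply: eq_bigr => i _; case: ifPn => //; rewrite -leqNgt => ip.
by rewrite nth_default// mul0r.
Qed.

Lemma toeplitz_formD k p q :
  toeplitz_form k (p + q) = toeplitz_form k p + toeplitz_form k q.
Proof.
pose n := maxn (size p) (size q).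
rewrite (@toeplitz_form_wide n _ (p + q)) ?size_polyD//.
rewrite (@toeplitz_form_wide n _ p) ?leq_maxl//.
rewrite (@toeplitz_form_wide n _ q) ?leq_maxr//.
by rewrite -big_split; apply: eq_bigr => i _ /=; rewrite coefD mulrDl.
Qed.

Lemma toeplitz_formZ a k p : toeplitz_form k (a *: p) = a * toeplitz_form k p.
Proof.
rewrite (@toeplitz_form_wide (size p) _ (a *: p)) ?size_scale_leq//.
by rewrite mulr_sumr; apply: eq_bigr => i _; rewrite coefZ mulrA.
Qed.

Lemma toeplitz_formB k p q :
  toeplitz_form k (p - q) = toeplitz_form k p - toeplitz_form k q.
Proof. by rewrite toeplitz_formD -scaleN1r toeplitz_formZ mulN1r. Qed.

Lemma toeplitz_formX k p : toeplitz_form k ('X * p) = toeplitz_form (k - 1) p.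
Proof.
rewrite (@toeplitz_form_wide (size p).+1 _ ('X * p)); last first.
  by rewrite mulrC (leq_trans (size_polyMleq _ _))// size_polyX addn2.
rewrite big_ord_recl coefXM mul0r add0r; apply: eq_bigr => i _.
by rewrite coefXM lift0 /=; congr (_ * c (absz _)); lia.
Qed.

Lemma toeplitz_form1 k : toeplitz_form k 1 = c (absz k).
Proof. by rewrite /toeplitz_form size_poly1 big_ord1 coef1 mul1r sub0r abszN. Qed.

Context (a : nat -> K).

(** The reversed polynomial is carried along with its own recurrence instead of being computed by
    reversal. In this sign convention [a m] is, for [m >= 1], the value at 0 of the [m]-th
    polynomial. *)
Fixpoint szego (m : nat) : {poly K} * {poly K} :=
  if m is m'.+1 then
    let: (p, ps) := szego m' in
    ('X * p + a m'.+1 *: ps, ps + a m'.+1 *: ('X * p))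
  else (1, 1).

Let Phi m := (szego m).1.
Let Phis m := (szego m).2.

Lemma szegoS1 m : Phi m.+1 = 'X * Phi m + a m.+1 *: Phis m.
Proof. by rewrite /Phi /Phis /=; case: (szego m). Qed.

Lemma szegoS2 m : Phis m.+1 = Phis m + a m.+1 *: ('X * Phi m).
Proof. by rewrite /Phi /Phis /=; case: (szego m). Qed.

Lemma szego_monic m : Phi m \is monic /\ size (Phi m) = m.+1.
Proof.
suff [] : [/\ Phi m \is monic, size (Phi m) = m.+1 & (size (Phis m) <= m.+1)%N] by [].
elim: m => [|m [mP sP sPs]].
  by rewrite /Phi /Phis /= monic1 size_poly1.
have P0 : Phi m != 0 by rewrite monic_neq0.
have sX : size ('X * Phi m) = m.+2 by rewrite mulrC size_mulX ?sP.
have lt : (size (a m.+1 *: Phis m) < size ('X * Phi m)%R)%N.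
  by rewrite sX (leq_ltn_trans (size_scale_leq _ _)).
rewrite szegoS1 szegoS2; split.
- by rewrite monicE lead_coefDl// mulrC lead_coefMX -monicE.
- by rewrite size_polyDl.
- rewrite (leq_trans (size_polyD _ _))// geq_max (leq_trans sPs)//=.
  by rewrite (leq_trans (size_scale_leq _ _))// sX.
Qed.

Lemma horner0_szego m : (Phi m.+1).[0] = a m.+1 /\ (Phis m).[0] = 1.
Proof.
have h n : (Phis n).[0] = 1.
  elim: n => [|n ih]; first by rewrite /Phis /= hornerC.
  by rewrite szegoS2 hornerD hornerZ hornerM hornerX mul0r mulr0 addr0.
by rewrite szegoS1 hornerD hornerZ hornerM hornerX mul0r add0r h mulr1.
Qed.

(** Stands in for the pointwise relation on the circle between a polynomial and its reversal; as the
    moments are even in their index, it follows from the two recurrences alone. *)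
Lemma toeplitz_form_szego_rev m k :
  toeplitz_form k (Phis m) = toeplitz_form (m%:Z - k) (Phi m).
Proof.
elim: m k => [|m ih] k.
  by rewrite /Phi /Phis /= !toeplitz_form1 sub0r abszN.
rewrite szegoS1 szegoS2 !toeplitz_formD !toeplitz_formZ !toeplitz_formX !ih.
by congr (toeplitz_form _ _ + _ * toeplitz_form _ _); lia.
Qed.

Context (E : nat -> K).
Context (E0 : E 0%N = c 0%N).
Context (ES : forall m, E m.+1 = (1 - a m.+1 ^+ 2) * E m).

(* The Szego recurrence produces the orthogonal polynomials as soon as its
   coefficients satisfy a m.+1 * E m = - <z Phi_m, 1>. *)
Lemma szego_orthogonal : (forall m, toeplitz_form 0 (Phis m) = E m ->
    toeplitz_form 0 ('X * Phi m) = - a m.+1 * E m) ->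
  forall m, (forall k : nat, (k < m)%N -> toeplitz_form k (Phi m) = 0) /\
    toeplitz_form m (Phi m) = E m.
Proof.
move=> aE; elim=> [|m [orth norm]].
  by split=> //; rewrite /Phi /= toeplitz_form1.
have Ps0 : toeplitz_form 0 (Phis m) = E m by rewrite toeplitz_form_szego_rev subr0.
split=> [[|k] km|].
- by rewrite szegoS1 toeplitz_formD toeplitz_formZ aE// Ps0 mulNr addNr.
- rewrite szegoS1 toeplitz_formD toeplitz_formZ toeplitz_formX.
  rewrite toeplitz_form_szego_rev.
  have -> : (k.+1%:Z - 1 = k%:Z)%R by lia.
  have -> : (m%:Z - k.+1%:Z = (m - k.+1)%N%:Z)%R by lia.
  by rewrite !orth ?mulr0 ?addr0//; lia.
- rewrite szegoS1 toeplitz_formD toeplitz_formZ toeplitz_formX.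
  rewrite toeplitz_form_szego_rev.
  have -> : (m.+1%:Z - 1 = m%:Z)%R by lia.
  have -> : (m%:Z - m.+1%:Z = 0 - 1)%R by lia.
  by rewrite -toeplitz_formX aE// norm ES; ring.
Qed.

End toeplitz_form.

(** The coefficient matrix [L] is unitriangular, and orthogonality makes [L *m T] triangular with
    the [E m] on its diagonal. *)
Lemma toeplitz_form_det {K : fieldType} (c : nat -> K) (Phi : nat -> {poly K}) (E : nat -> K) N :
  (forall m, Phi m \is monic /\ size (Phi m) = m.+1) ->
  (forall m, (forall k : nat, (k < m)%N -> toeplitz_form c k (Phi m) = 0) /\
    toeplitz_form c m (Phi m) = E m) ->
  \det (\matrix_(j < N.+1, k < N.+1) c (absz (j%:Z - k%:Z))) = \prod_(m < N.+1) E m.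
Proof.
move=> mP orth; set T := \matrix_(_, _) _.
pose L := \matrix_(m < N.+1, j < N.+1) (Phi m)`_j.
have LT i k : (L *m T) i k = toeplitz_form c k (Phi i).
  rewrite (@toeplitz_form_wide _ _ N.+1) ?(mP i).2//.
  by rewrite mxE; apply: eq_bigr => j _; rewrite !mxE.
have detL : \det L = 1.
  rewrite det_trig; last first.
    by apply/is_trig_mxP => i j ij; rewrite mxE nth_default// (mP i).2.
  rewrite big1// => i _; rewrite mxE.
  by have [/monicP + s] := mP i; rewrite /lead_coef s.
have detU : \det (L *m T) = \prod_(m < N.+1) E m.
  rewrite -det_tr det_trig; last first.
    by apply/is_trig_mxP => i j ij; rewrite mxE LT (orth j).1.
  by apply: eq_bigr => i _; rewrite mxE LT (orth i).2.
by rewrite -detU det_mulmx detL mul1r.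
Qed.

(** * Transfer of orthogonality from the line to the circle *)

Section arcsin_transform.
Context {K : fieldType} (A : nat -> K) (Lf : {scalar {poly K}}) (h t : nat -> K).
Context (two_neq0 : (2 : K) != 0).
Context (orth : forall m k, (k < m)%N -> Lf (jacobi_poly A m * 'X^k) = 0).
Context (norm : forall m, Lf (jacobi_poly A m * 'X^m) = h m).
Context (hS : forall m, h m.+1 = A m.+1 * h m).
Context (t0 : t 0%N = 2).
Context (tS : forall m, (2 - t m.+1) * t m = A m.+1).

Let P := jacobi_poly A.

Lemma jacobi_orthogonal m (Q : {poly K}) : (size Q <= m)%N -> Lf (P m * Q) = 0.
Proof.
move=> Qm; rewrite -(coefK Q) poly_def mulr_sumr linear_sum big1//= => i _.
by rewrite -scalerAr linearZ/= orth ?mulr0// (leq_trans _ Qm).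
Qed.

Lemma jacobi_norm m (Q : {poly K}) : (size Q <= m.+1)%N -> Lf (P m * Q) = Q`_m * h m.
Proof.
move=> Qm; rewrite -norm -[LHS]addr0 -[X in _ + X](@jacobi_orthogonal m (Q`_m *: 'X^m - Q)).
  rewrite -linearD/= -mulrDr addrC subrK -scalerAr linearZ/=//.
apply/leq_sizeP => j; rewrite leq_eqVlt => /orP[/eqP<-|mj].
  by rewrite coefB coefZ coefXn eqxx mulr1 subrr.
rewrite coefB coefZ coefXn gtn_eqF// mulr0 sub0r nth_default ?oppr0//.
exact: leq_trans Qm mj.
Qed.

(* V_j (s + 1 / s) = (s ^ j + s ^ (- j)) / 2 *)
Fixpoint half_chebyshev (n : nat) : {poly K} :=
  if n is n'.+1 then
    if n' is n''.+1 then 'X * half_chebyshev n' - half_chebyshev n''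
    else 2^-1 *: 'X
  else 1.
Let V := half_chebyshev.

Lemma half_chebyshevSS n : V n.+2 = 'X * V n.+1 - V n.
Proof. by []. Qed.

(** The normalisation [V 1 = X / 2] is what makes the even extension in the index satisfy the
    recurrence at [j = 0] as well. *)
Lemma half_chebyshev_int (j : int) : V (absz (j + 1)%R) + V (absz (j - 1)%R) = 'X * V (absz j).
Proof.
have V1 : V 1%N + V 1%N = 'X.
  by rewrite -scalerDl -mulr2n -[_ *+ 2]mulr_natl divff// scale1r.
case: (intP j) => [|n|n].
- by rewrite V1 mulr1.
- rewrite (_ : absz (n.+1%:Z + 1)%R = n.+2); last lia.
  rewrite (_ : absz (n.+1%:Z - 1)%R = n); last lia.
  by rewrite half_chebyshevSS subrK.
- rewrite (_ : absz (- n.+1%:Z + 1)%R = n); last lia.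
  rewrite (_ : absz (- n.+1%:Z - 1)%R = n.+2); last lia.
  rewrite (_ : absz (- n.+1%:Z)%R = n.+1); last lia.
  by rewrite half_chebyshevSS addrC subrK.
Qed.

Lemma half_chebyshev_lead n : (size (V n) <= n.+1)%N /\ (V n.+1)`_n.+1 = 2^-1.
Proof.
suff : (size (V n) <= n.+1)%N /\ (size (V n.+1) <= n.+2)%N /\ (V n.+1)`_n.+1 = 2^-1.
  by move=> [h1 [_ h2]].
elim: n => [|n [s0 [s1 l]]].
  rewrite /V /= size_poly1 coefZ coefX mulr1; split=> //; split=> //.
  by rewrite (leq_trans (size_scale_leq _ _))// size_polyX.
split=> //; rewrite half_chebyshevSS; split.
  rewrite (leq_trans (size_polyD _ _))// geq_max size_polyN.
  rewrite (leq_trans s0) ?andbT; last by lia.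
  by rewrite mulrC (leq_trans (size_polyMleq _ _))// size_polyX addn2.
by rewrite coefB coefXM /= l (nth_default _ (leq_trans s0 _)) ?subr0.
Qed.

(* With x = 2 sin (theta / 2), the j-th trigonometric moment cos (j theta) is
   (-1) ^ j V_2j (x). *)
Definition arcsin_moment (j : nat) : K := (-1) ^+ j * Lf (V (2 * j)).

Let tf := toeplitz_form arcsin_moment.

(** With [x = 2 sin (theta / 2)] and [z = e ^ (i theta)] one has [z - 1 = i x z ^ (1/2)], so
    [i ^ m z ^ (m/2) P_m(x)] satisfies this recurrence: [W m] is [P m] read on the circle. *)
Fixpoint para_poly (n : nat) : {poly K} :=
  if n is n'.+1 then
    if n' is n''.+1 then ('X - 1) * para_poly n' + A n' *: ('X * para_poly n'')
    else 'X - 1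
  else 1.
Let W := para_poly.

Lemma para_polySS n : W n.+2 = ('X - 1) * W n.+1 + A n.+1 *: ('X * W n).
Proof. by []. Qed.

(** Reading [W m] as [i ^ m z ^ (m/2) P_m(x)], the pairing with [z ^ k] leaves [P m] against the
    power [m - 2 k] of [z ^ (1/2)], which [V] represents up to sign. The induction compares the two
    recurrences through [half_chebyshev_int]. *)
Lemma toeplitz_form_para m (k : int) :
  tf k (W m) = (-1) ^+ (m + absz k) * Lf (P m * V (absz (m%:Z - 2 * k)%R)).
Proof.
have sg (j : int) : (-1) ^+ absz (j - 1)%R = - (-1) ^+ absz j :> K.
  case: (intP j) => [|n|n]; first by rewrite expr1 expr0.
    by rewrite (_ : absz (n.+1%:Z - 1)%R = n); [rewrite exprS mulN1r opprK|lia].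
  rewrite (_ : absz (- n.+1%:Z - 1)%R = n.+2); last by lia.
  by rewrite (_ : absz (- n.+1%:Z)%R = n.+1); [rewrite !exprS mulN1r|lia].
elim/jacobi_poly_ind: m k => [||m ih0 ih1] k.
- rewrite /tf toeplitz_form1 /arcsin_moment /P /= mul1r.
  by congr (_ * Lf (V _)); lia.
- rewrite /tf /W /= toeplitz_formB -['X]mulr1 toeplitz_formX !toeplitz_form1.
  rewrite /arcsin_moment sg exprS mulN1r !mulNr -opprD -mulrDr -linearD/=.
  congr (- (_ * Lf _)); rewrite /P /=.
  have := half_chebyshev_int (1 - 2 * k).
  rewrite (_ : 1 - 2 * k + 1 = - (2 * (k - 1))); last by ring.
  rewrite (_ : 1 - 2 * k - 1 = - (2 * k)); last by ring.
  by rewrite !abszN !abszM mulr1.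
rewrite para_polySS mulrBl mul1r /tf toeplitz_formD toeplitz_formB toeplitz_formZ.
rewrite !toeplitz_formX -!/(tf _ _) ih1 ih0 ih1.
rewrite (_ : m%:Z - 2 * (k - 1) = m.+2%:Z - 2 * k); last lia.
rewrite (_ : m.+1%:Z - 2 * (k - 1) = m.+2%:Z - 2 * k + 1); last lia.
rewrite (_ : m.+1%:Z - 2 * k = m.+2%:Z - 2 * k - 1); last lia.
have -> : P m.+2 * V (absz (m.+2%:Z - 2 * k)%R) =
    P m.+1 * (V (absz (m.+2%:Z - 2 * k + 1)%R) + V (absz (m.+2%:Z - 2 * k - 1)%R)) -
    A m.+1 *: (P m * V (absz (m.+2%:Z - 2 * k)%R)).
  by rewrite half_chebyshev_int /P jacobi_polySS -!mul_polyC; ring.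
rewrite linearB linearZ/= (mulrDr (P m.+1)) linearD/= !exprD sg !exprS; ring.
Qed.

Let a m := (-1) ^+ m * (t m - 1).
Let Phi m := (szego a m).1.
Let Phis m := (szego a m).2.
Let E m := t m / 2 * h m.

Lemma szego_para m :
  'X * Phi m - (-1) ^+ m *: Phis m = W m.+1 /\
  Phi m + (-1) ^+ m *: Phis m = t m *: W m.
Proof.
elim: m => [|m [ih1 ih2]].
  rewrite /Phi /Phis /= expr0 scale1r mulr1 t0; split=> //.
  by rewrite scaler_nat mulr2n.
have aE : a m.+1 = - ((-1) ^+ m * (t m.+1 - 1)) by rewrite /a exprS mulN1r mulNr.
have ss : (-1) ^+ m * (-1) ^+ m = 1 :> K by rewrite -exprMn mulrNN mulr1 expr1n.
rewrite /Phi /Phis szegoS1 szegoS2 -/(Phi m) -/(Phis m) para_polySS -ih1.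
(* The second relation at [m] and [tS] eliminate [W m]; what remains is linear in [Phi m] and
   [Phis m], with a sign of square 1. *)
have AE : A m.+1 *: ('X * W m) = (2 - t m.+1) *: ('X * (Phi m + (-1) ^+ m *: Phis m)).
  by rewrite ih2 -scalerAr scalerA tS.
rewrite AE exprS mulN1r aE.
move: ((-1) ^+ m) ss => s ss.
have sP : s%:P * s%:P = 1 :> {poly K} by rewrite -polyCM ss.
rewrite -!mul_polyC !(polyCN, polyCM, polyCB, polyCD, polyC1).
move: (s%:P) sP (Phi m) (Phis m) => S SS p ps.
by split; ring: SS.
Qed.

Lemma arcsin_szego m :
  (forall k : nat, (k < m)%N -> tf k (Phi m) = 0) /\ tf m (Phi m) = E m.
Proof.
apply: (szego_orthogonal (E := E)) => {m} [|m|m Ps0].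
- by rewrite /E t0 divff// mul1r /arcsin_moment mul1r -norm mul1r.
- have ss : (-1) ^+ m.+1 ^+ 2 = 1 :> K by rewrite sqrr_sign.
  rewrite /E hS -tS /a exprMn ss; field.
  exact: two_neq0.
- have [h1 _] := szego_para m.
  have -> : (szego a m).1 = Phi m by [].
  have -> : 'X * Phi m = W m.+1 + (-1) ^+ m *: Phis m by rewrite -h1 subrK.
  (* Paired with 1, [W m.+1] gives up to sign [Lf (P m.+1 * V m.+1)], where only the leading
     coefficient 1/2 of the Chebyshev polynomial counts. *)
  rewrite toeplitz_formD toeplitz_formZ Ps0 -/tf toeplitz_form_para.
  rewrite addn0 mulr0 subr0 jacobi_norm; last exact: (half_chebyshev_lead m.+1).1.
  rewrite (half_chebyshev_lead m).2 /E hS -tS /a exprS; field.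
  exact: two_neq0.
Qed.

Lemma prod_jacobi_horner2 n : \prod_(m < n) t m = (P n).[2].
Proof.
suff : \prod_(m < n) t m = (P n).[2] /\ \prod_(m < n.+1) t m = (P n.+1).[2].
  by case.
elim: n => [|n [ih0 ih1]].
  by rewrite big_ord0 big_ord1 hornerC hornerX t0.
split=> //; rewrite big_ord_recr ih1.
rewrite -[P n.+2]/('X * P n.+1 - A n.+1 *: P n).
rewrite !(hornerD, hornerN, hornerZ, hornerM, hornerX).
by rewrite -ih1 big_ord_recr -ih0 -tS /=; ring.
Qed.

End arcsin_transform.

(** * Orthogonality for the Lommel ensemble *)

Section lommel_orthogonality.
Context {R : realType} (nu beta : R).
Context (nu_gtN1 : -1 < nu) (beta_gt0 : 0 < beta).

Let b := beta ^+ 2 / 4.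
Let A := lommel_A2 nu beta.
Let P := jacobi_poly A.
Let c := clifford_coef b.

Context (Lf : {scalar {poly R}}) (M h : nat -> R).
Context (Lf_even : forall r, Lf 'X^(2 * r) = M r).
Context (Lf_odd : forall r, Lf 'X^((2 * r).+1) = 0).
Context (M_newton : forall r,
  \sum_(i < r.+1) c nu i * M (r - i)%N = h 0%N * c (nu + 1) r).
Context (hS : forall m, h m.+1 = A m.+1 * h m).

Let rho m k := Lf (P m * 'X^k).

Let rho0 k : rho 0 k = Lf 'X^k.
Proof. by rewrite /rho /P /= mul1r. Qed.

Let rho1 k : rho 1 k = Lf 'X^(k.+1).
Proof. by rewrite /rho /P /= exprS. Qed.

Let rhoSS m k : rho m.+2 k = rho m.+1 k.+1 - A m.+1 * rho m k.
Proof.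
rewrite /rho /P jacobi_polySS mulrBl -scalerAl linearB linearZ/=.
by rewrite -mulrA mulrCA exprS mulrCA.
Qed.

Let rho_odd m k : odd (m + k) -> rho m k = 0.
Proof.
have Lodd j : odd j -> Lf 'X^j = 0.
  by move=> oj; rewrite -(odd_double_half j) oj -mul2n add1n Lf_odd.
elim/jacobi_poly_ind: m k => [||m ih0 ih1] k ok.
- by rewrite rho0 Lodd.
- by rewrite rho1 Lodd.
rewrite rhoSS ih0 ?ih1 ?mulr0 ?subrr//; first by rewrite addnS.
by move: ok; rewrite !addSn /= negbK.
Qed.

(** The coefficient of [w ^ r] in F_nu times the function of the second kind of index [m]. *)
Let conv m r := \sum_(i < r.+1) c nu i * rho m (m + 2 * (r - i)).

(* The functions of the second kind sum_k rho m (m + 2 k) w ^ k are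
   h m * F_(nu + m + 1) / F_nu, where F_mu = clifford b mu. *)
Let second_kind m : (forall k, (k < m)%N -> rho m k = 0) /\
  forall r, conv m r = h m * c (nu + m%:R + 1) r.
Proof.
move: m; have nu1 := nu_gtN1.
have conv0 m : conv m 0 = rho m m.
  by rewrite /conv big_ord1 /c clifford_coef0 mul1r subnn muln0 addn0.
have convS m r : \sum_(i < r.+1) c nu i * rho m (m + 2 * (r - i).+1) =
    conv m r.+1 - c nu r.+1 * conv m 0.
  rewrite conv0 /conv [X in _ = X - _]big_ord_recr/= subnn muln0 addn0 addrK.
  by apply: eq_bigr => i _; rewrite subSn// -ltnS.
have cE m : c (nu + m.+1%:R + 1) 0 = 1 by rewrite /c clifford_coef0.
have contig m r : c (nu + m.+1%:R + 1) r.+1 - c (nu + m%:R + 1) r.+1 =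
    A m.+2 * c (nu + m.+2%:R + 1) r.
  have m0 : 0 <= (m%:R : R) by [].
  have -> : nu + m.+1%:R + 1 = nu + m%:R + 1 + 1 by rewrite -natr1; lra.
  rewrite /c clifford_contiguous_coef; last by lra.
  have -> : nu + m%:R + 1 + 2 = nu + m.+2%:R + 1 by rewrite -!natr1; lra.
  rewrite /A lommel_A2E// -/b; congr (_ / _ * _).
  by rewrite -!natr1; lra.
apply: jacobi_poly_ind => [||m [low0 s0] [low1 s1]].
- split=> // r; rewrite addr0 -M_newton; apply: eq_bigr => i _.
  by rewrite add0n rho0 Lf_even.
- split=> [[|k]//|r]; first by move=> _; exact: rho_odd.
  transitivity (h 0%N * (c (nu + 1) r.+1 - c nu r.+1)).
    have e0 : conv 0 0 = h 0%N.
      by rewrite conv0 rho0 -[X in 'X^X](muln0 2) Lf_even;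
        have := M_newton 0; rewrite big_ord1 /c !clifford_coef0 mul1r mulr1 subnn.
    have e1 : conv 0 r.+1 = h 0%N * c (nu + 1) r.+1.
      rewrite -M_newton; apply: eq_bigr => i _.
      by rewrite add0n rho0 Lf_even.
    have := convS 0%N r; rewrite e0 e1 mulrBr [h 0%N * c nu _]mulrC => <-.
    apply: eq_bigr => i _; rewrite rho0 rho1; congr (_ * Lf 'X^_); lia.
  rewrite /c clifford_contiguous_coef// hS /A lommel_A2E// -/b mulrA.
  have -> : nu + 1 + 1 = nu + 2 by lra.
  by rewrite addr0 [h 0%N * _]mulrC; congr (_ / (_ * _) * _ * _); lra.
have norm0 : rho m m = h m by rewrite -conv0 s0 /c clifford_coef0 mulr1.
have norm1 : rho m.+1 m.+1 = h m.+1 by rewrite -conv0 s1 cE mulr1.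
split=> [k km|r].
  rewrite rhoSS; have [km'|mk] := ltnP k m.
    by rewrite low0// low1 ?mulr0 ?subrr//.
  (* Two exponents are new: at [k = m] the norms cancel by [hS], and at [k = m.+1] everything
     vanishes by parity. *)
  have [->|->] : k = m \/ k = m.+1 by lia.
    by rewrite norm1 norm0 hS subrr.
  by rewrite !rho_odd ?mulr0 ?subrr// !(addSn, addnS) /= ?negbK; lia.
transitivity (h m.+1 * (c (nu + m.+1%:R + 1) r.+1 - c (nu + m%:R + 1) r.+1)).
  have := convS m r; rewrite conv0 norm0 s0 => e0.
  have := convS m.+1 r; rewrite conv0 norm1 s1 => e1.
  transitivity ((h m.+1 * c (nu + m.+1%:R + 1) r.+1 - c nu r.+1 * h m.+1) -
     A m.+1 * (h m * c (nu + m%:R + 1) r.+1 - c nu r.+1 * h m)).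
    rewrite -e0 -e1 mulr_sumr -sumrB; apply: eq_bigr => i _.
    rewrite rhoSS mulrBr mulrCA; congr (_ * _ - _ * (_ * rho _ _)); last by lia.
    by congr rho; lia.
  by rewrite hS; ring.
by rewrite contig (hS m.+1); ring.
Qed.

Lemma lommel_orthogonal m k : (k < m)%N -> Lf (P m * 'X^k) = 0.
Proof. exact: (second_kind m).1. Qed.

Lemma lommel_norm m : Lf (P m * 'X^m) = h m.
Proof.
have := (second_kind m).2 0%N.
by rewrite /conv big_ord1 /c !clifford_coef0 mul1r subnn muln0 addn0 mulr1.
Qed.

End lommel_orthogonality.

Lemma nneseries_EFin {R : realType} (u : nat -> R) (l : R) :
  series u @ \oo --> l -> (\sum_(k <oo) (u k)%:E)%E = l%:E.
Proof.
move=> ul; apply/cvg_lim => //; under eq_cvg do rewrite sumEFin.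
by apply: cvg_EFin; [exact: nearW|exact: ul].
Qed.

(** * Integration against the Lommel ensemble *)

Section lommel_integral.
Context {R : realType} (nu beta : R).
Context (nu_gtN1 : -1 < nu) (beta_gt0 : 0 < beta).
Context (beta_lt : beta < 2 * bessel_zero nu 1).

Let L : {measure set R -> \bar R} := lommel_ensemble nu beta.
Let x := lommel_atom nu beta.

Let x_gt0 k : 0 < x k. Proof. exact: lommel_atom_gt0. Qed.

Lemma lommel_atom_lt2 k : x k < 2.
Proof.
apply: (le_lt_trans (lommel_atom_le nu_gtN1 beta_gt0 k)).
have j0 : 0 < bessel_zero nu 1.
  have := lommel_atom_gt0 nu_gtN1 beta_gt0 0; rewrite /lommel_atom.
  by rewrite pmulr_rgt0// invr_gt0.
by rewrite /lommel_atom ltr_pdivrMr.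
Qed.

Lemma ge0_integral_lommel (f : R -> \bar R) : (forall y, (0 <= f y)%E) ->
  measurable_fun setT f ->
  (\int[L]_y f y = \sum_(k <oo) (x k ^+ 2)%R%:E * (f (x k) + f (- x k)%R))%E.
Proof.
move=> f0 mf.
pose m' k := lommel_atoms nu beta k.+1.
have -> : (\int[L]_y f y = \int[mseries m' 0]_y f y)%E.
  apply: eq_measure_integral => D mD _.
  transitivity (\sum_(1 <= k <oo) lommel_atoms nu beta k D)%E; first by [].
  rewrite -nneseries_addn//; apply: eq_eseriesr => k _.
  by rewrite /m' addn1.
rewrite ge0_integral_measure_series//; apply: eq_eseriesr => k _.
rewrite /m' /lommel_atoms ge0_integral_measure_add// !ge0_integral_mscale//.
rewrite !integral_dirac// !diracT !mul1e /=.
by rewrite ge0_muleDr.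
Qed.

Lemma integrable_lommel (f : R -> R) (M : R) : measurable_fun setT f ->
  (forall y, `|y| <= 2 -> `|f y| <= M) -> L.-integrable setT (EFin \o f).
Proof.
move=> mf fM; apply/integrableP; split; first exact/measurable_EFinP.
rewrite ge0_integral_lommel//; last first.
  by apply/measurable_EFinP; exact: measurableT_comp.
have [S [hS _]] := rayleigh_sums nu_gtN1 beta_gt0.
have M0 : 0 <= M by apply: le_trans (fM 0 _); rewrite ?normr_ge0// normr0.
have h : series (fun k => x k ^+ 2 * (2 * M)) @ \oo --> S 0%N * (2 * M).
  have := hS 0%N => h0.
  rewrite (_ : series _ = fun n => series (fun k => x k ^+ (2 * 1)) n * (2 * M)).
    exact: cvgMr_tmp.
  by apply/funext => n; rewrite !seriesEnat /= mulr_suml.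
apply: (@le_lt_trans _ _ (S 0%N * (2 * M))%:E); last exact: ltry.
rewrite -(nneseries_EFin h); apply: lee_nneseries => k.
  by move=> _ _; rewrite mule_ge0 ?lee_fin ?sqr_ge0// adde_ge0.
move=> _; rewrite -EFinD -EFinM lee_fin ler_wpM2l ?sqr_ge0//.
rewrite mulr_natl mulr2n lerD// fM//.
  by rewrite gtr0_norm// ltW// lommel_atom_lt2.
by rewrite normrN gtr0_norm// ltW// lommel_atom_lt2.
Qed.

Lemma integrable_lommel_poly (p : {poly R}) : L.-integrable setT (EFin \o horner p).
Proof.
apply: (@integrable_lommel _ (\sum_(i < size p) `|p`_i| * 2 ^+ i)).
  by apply: continuous_measurable_fun; exact: continuous_horner.
move=> y y2; rewrite horner_coef (le_trans (ler_norm_sum _ _ _))// ler_sum// => i _.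
by rewrite normrM normrX ler_wpM2l// lerXn2r// nnegrE.
Qed.

(** The trigonometric form of the Chebyshev polynomials holds only on []-2, 2[], where [asin] is a
    genuine inverse; all atoms lie there. *)
Lemma eq_integral_lommel (f g : R -> R) :
  measurable_fun setT f -> measurable_fun setT g ->
  (forall y, -2 < y < 2 -> f y = g y) -> \int[L]_y f y = \int[L]_y g y.
Proof.
move=> mf mg fg; rewrite /Rintegral; congr fine.
have mf' : measurable_fun setT (EFin \o f) by exact/measurable_EFinP.
have mg' : measurable_fun setT (EFin \o g) by exact/measurable_EFinP.
have xE k : f (x k) = g (x k).
  by apply: fg; rewrite lommel_atom_lt2 andbT (lt_trans _ (x_gt0 k))// oppr_lt0.
have xNE k : f (- x k) = g (- x k).
  apply: fg; rewrite ltrN2 lommel_atom_lt2/= (lt_trans _ (ltr0Sn _ _))//.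
  by rewrite oppr_lt0.
rewrite integralE [RHS]integralE; congr (_ - _)%E.
  rewrite !ge0_integral_lommel//; [|exact: measurable_funepos..].
  by apply: eq_eseriesr => k _; rewrite !funeposE /= xE xNE.
rewrite !ge0_integral_lommel//; [|exact: measurable_funeneg..].
by apply: eq_eseriesr => k _; rewrite !funenegE /= xE xNE.
Qed.

Lemma integral_lommel_odd (f : R -> R) : measurable_fun setT f ->
  L.-integrable setT (EFin \o f) ->
  (forall y, -2 < y < 2 -> f (- y) = - f y) -> \int[L]_y f y = 0.
Proof.
move=> mf /integrableP[_ fi] fN.
have mf' : measurable_fun setT (EFin \o f) by exact/measurable_EFinP.
rewrite /Rintegral integralE.
have -> : (\int[L]_y (EFin \o f)^\- y = \int[L]_y (EFin \o f)^\+ y)%E.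
  rewrite !ge0_integral_lommel//; [|exact: measurable_funepos|exact: measurable_funeneg].
  apply: eq_eseriesr => k _; congr (_ * _)%E; rewrite addeC !funeposE !funenegE /=.
  have fNk : f (- x k) = - f (x k).
    by apply: fN; rewrite lommel_atom_lt2 andbT (lt_trans _ (x_gt0 k))// oppr_lt0.
  by rewrite fNk !EFinN oppeK.
rewrite subee// ge0_fin_numE; last by apply: integral_ge0 => y _; exact: funepos_ge0.
apply: le_lt_trans fi; apply: ge0_le_integral => //.
- exact: measurable_funepos.
- by apply/measurable_EFinP; exact: measurableT_comp.
- by move=> y _; rewrite funeposE /= ge_max lee_fin ler_norm lee_fin normr_ge0.
Qed.

Lemma integral_lommel_even r (S : R) :
  series (fun k => x k ^+ (2 * r.+1)) @ \oo --> S ->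
  \int[L]_y (y ^+ (2 * r)) = 2 * S.
Proof.
move=> hS.
rewrite /Rintegral ge0_integral_lommel//; last 2 first.
- by move=> y; rewrite lee_fin exprM exprn_ge0// sqr_ge0.
- by apply/measurable_EFinP; apply: continuous_measurable_fun; exact: exprn_continuous.
have h : series (fun k => 2 * x k ^+ (2 * r.+1)) @ \oo --> 2 * S.
  rewrite (_ : series _ = fun n => 2 * series (fun k => x k ^+ (2 * r.+1)) n).
    exact: cvgn_mull.
  by apply/funext => n; rewrite !seriesEnat /= mulr_sumr.
rewrite (eq_eseriesr (g := fun k => (2 * x k ^+ (2 * r.+1))%:E)).
  by rewrite (nneseries_EFin h).
move=> k _; rewrite -EFinD -EFinM; congr EFin.
by rewrite !exprM sqrrN [_ ^+ r.+1]exprS; ring.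
Qed.

Lemma lommel_functional : exists Lf : {scalar {poly R}},
  forall p, Lf p = \int[L]_y p.[y].
Proof.
pose f (p : {poly R}) : R := \int[L]_y p.[y].
have lin : linear_for *%R f.
  move=> a p q; rewrite /f.
  transitivity (\int[L]_y (a * p.[y] + q.[y])).
    by apply: eq_Rintegral => y _; rewrite hornerD hornerZ.
  rewrite RintegralD//.
  - by rewrite RintegralZl//; exact: integrable_lommel_poly.
  - rewrite (_ : _ \o _ = EFin \o horner (a *: p)); first exact: integrable_lommel_poly.
    by apply/funext => y /=; rewrite hornerZ.
  - exact: integrable_lommel_poly.
pose fl : {scalar {poly R}} := HB.pack f (GRing.isLinear.Build _ _ _ _ f lin).
by exists fl.
Qed.

End lommel_integral.

(** * Orthogonal polynomials of the ensemble and their norms *)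

Section lommel_oprl.
Context {R : realType} (nu beta : R).
Context (nu_gtN1 : -1 < nu) (beta_gt0 : 0 < beta).
Context (beta_lt : beta < 2 * bessel_zero nu 1).

Let b := beta ^+ 2 / 4.
Let A := lommel_A2 nu beta.
Let t := lommel_t nu beta.
Let P := jacobi_poly A.
Let L : {measure set R -> \bar R} := lommel_ensemble nu beta.

(** Positivity comes from the zeros of the polynomials lying below 2, and it justifies the divisions
    in the recursion of [t]. *)
Lemma lommel_t_ratio m : t m = (P m.+1).[2] / (P m).[2] /\ 0 < t m.
Proof.
have P0 n : 0 < (P n).[2].
  by apply: (jacobi_lommel_gt0 nu_gtN1 beta_gt0); exact: lommel_atom_lt2.
suff tE : t m = (P m.+1).[2] / (P m).[2] by rewrite tE; split=> //; rewrite divr_gt0.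
elim: m => [|m ih]; first by rewrite /P /= hornerX hornerC divr1.
have -> : t m.+1 = 2 - A m.+1 / t m.
  by rewrite /t /= -/t /A /lommel_A2 invfM mulrA.
have p1 := P0 m; have p2 := P0 m.+1.
rewrite ih -[P m.+2]/('X * P m.+1 - A m.+1 *: P m).
rewrite !(hornerD, hornerN, hornerZ, hornerM, hornerX).
by field; rewrite !gt_eqF.
Qed.

Lemma lommel_t_gt0 m : 0 < t m. Proof. exact: (lommel_t_ratio m).2. Qed.

Lemma lommel_tS m : (2 - t m.+1) * t m = A m.+1.
Proof.
have t0 := lommel_t_gt0 m.
have -> : t m.+1 = 2 - A m.+1 / t m by rewrite /t /= -/t /A /lommel_A2 invfM mulrA.
by field; rewrite gt_eqF.
Qed.

Definition lommel_norm2 (m : nat) : R :=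
  beta ^+ 2 / (2 * (nu + 1)) * (beta / 2) ^+ (2 * m) *
  ((Gamma (nu + 1) * Gamma (nu + 2)) /
   (Gamma (nu + m%:R + 1) * Gamma (nu + m%:R + 2))).
Let h := lommel_norm2.

Let Gamma_nat_gt0 m j : 0 < Gamma (nu + m%:R + j.+1%:R).
Proof.
apply: Gamma_gt0; have m0 : 0 <= (m%:R : R) by [].
have j0 : 0 <= (j%:R : R) by [].
by move: nu_gtN1 => ?; rewrite -natr1; lra.
Qed.

(* Stated for an arbitrary G so that ring and lra do not compare integrals. *)
Let norm2_step (G : R -> R) m : (forall y, 0 < y -> G (y + 1) = y * G y) ->
  beta ^+ 2 / (2 * (nu + 1)) * (beta / 2) ^+ (2 * m.+1) *
   ((G (nu + 1) * G (nu + 2)) / (G (nu + m.+1%:R + 1) * G (nu + m.+1%:R + 2))) =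
  A m.+1 * (beta ^+ 2 / (2 * (nu + 1)) * (beta / 2) ^+ (2 * m) *
   ((G (nu + 1) * G (nu + 2)) / (G (nu + m%:R + 1) * G (nu + m%:R + 2)))).
Proof.
move=> GS; have nu1 := nu_gtN1; have m0 : 0 <= (m%:R : R) by [].
rewrite mulnS exprD /A lommel_A2E//.
have -> : nu + m.+1%:R + 1 = nu + m%:R + 1 + 1 by rewrite -natr1; lra.
have -> : nu + m.+1%:R + 2 = nu + m%:R + 2 + 1 by rewrite -natr1; lra.
rewrite (GS (nu + m%:R + 1)); last by lra.
rewrite (GS (nu + m%:R + 2)); last by lra.
have -> : (beta / 2) ^+ 2 = b by rewrite /b; field.
have -> : nu + m%:R + 2 = nu + 1 + m%:R + 1 by lra.
have -> : nu + m%:R + 1 = nu + 1 + m%:R by lra.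
by rewrite /b !invfM; ring.
Qed.

Lemma lommel_norm2S m : h m.+1 = A m.+1 * h m.
Proof. by apply: norm2_step => y; exact: GammaS. Qed.

Lemma lommel_norm2_0 : h 0%N = 2 * (b / (nu + 1)).
Proof.
rewrite /h /lommel_norm2 muln0 expr0 mulr1 addr0 divff ?mulr1.
  have nu1 : 0 < nu + 1 by move: nu_gtN1 => ?; lra.
  by rewrite /b; field; rewrite gt_eqF.
have := Gamma_nat_gt0 0 0; have := Gamma_nat_gt0 0 1; rewrite addr0 => g1 g2.
by rewrite mulf_neq0// gt_eqF.
Qed.

Lemma lommel_norm2_gt0 m : 0 < h m.
Proof.
elim: m => [|m ih]; last by rewrite lommel_norm2S mulr_gt0// lommel_A2_gt0.
rewrite lommel_norm2_0; have := quarter_sqr_gt0 beta_gt0; rewrite -/b => b0.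
by move: nu_gtN1 => ?; rewrite mulr_gt0// divr_gt0//; lra.
Qed.

Lemma lommel_functional_orthogonal (Lf : {scalar {poly R}}) :
  (forall p, Lf p = \int[L]_y p.[y]) ->
  (forall m k, (k < m)%N -> Lf (P m * 'X^k) = 0) /\
  (forall m, Lf (P m * 'X^m) = h m).
Proof.
move=> LfE; have [S [hS SE]] := rayleigh_sums nu_gtN1 beta_gt0.
have even r : Lf 'X^(2 * r) = 2 * S r.
  rewrite LfE -(integral_lommel_even (hS r)).
  by apply: eq_Rintegral => y _; rewrite hornerXn.
have odd r : Lf 'X^((2 * r).+1) = 0.
  rewrite LfE; apply: (integral_lommel_odd nu_gtN1 beta_gt0 beta_lt).
  - by apply: continuous_measurable_fun; exact: continuous_horner.
  - exact: (integrable_lommel_poly nu_gtN1 beta_gt0 beta_lt).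
  - by move=> y _; rewrite !hornerXn exprNn exprS exprM sqrrN !expr1n mulr1 mulN1r.
have newton r : \sum_(i < r.+1) clifford_coef b nu i * (2 * S (r - i)%N) =
    h 0%N * clifford_coef b (nu + 1) r.
  rewrite lommel_norm2_0 -mulrA -SE mulr_sumr.
  by apply: eq_bigr => i _; rewrite mulrCA.
split=> [m k km|m].
  by apply: (@lommel_orthogonal _ _ _ nu_gtN1 beta_gt0 Lf (fun r => 2 * S r) h) => //; exact: lommel_norm2S.
by apply: (@lommel_norm _ _ _ nu_gtN1 beta_gt0 Lf (fun r => 2 * S r) h) => //; exact: lommel_norm2S.
Qed.

(** [xget] requires uniqueness: the difference of two candidates has some degree [d < m], and
    pairing it with [P d] returns its leading coefficient times a positive norm. *)
Lemma monic_oprl_lommel m : monic_oprl L m = P m.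
Proof.
have [Lf LfE] := lommel_functional nu_gtN1 beta_gt0 beta_lt.
have [orth norm] := lommel_functional_orthogonal LfE.
have intM p q : \int[L]_y (p.[y] * q.[y]) = Lf (p * q).
  by rewrite LfE; apply: eq_Rintegral => y _; rewrite hornerM.
apply: xget_unique => [|Q [[mQ sQ] oQ]].
  split; first by split; [exact: jacobi_poly_monic|exact: size_jacobi_poly].
  by move=> Q sQ; rewrite intM (jacobi_orthogonal orth).
apply/eqP; rewrite -subr_eq0; apply/negPn/negP => D0.
pose d := (size (Q - P m)).-1.
have dm : (d < m)%N.
  rewrite /d -ltnS prednK ?size_poly_gt0//.
  rewrite (@leq_ltn_trans m) ?leqnn//; apply/leq_sizeP => j.
  rewrite leq_eqVlt => /orP[/eqP<-|mj]; last first.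
    by rewrite coefB !nth_default ?subrr// ?sQ ?size_jacobi_poly.
  have /monicP := mQ; have /monicP := jacobi_poly_monic A m.
  by rewrite /lead_coef sQ size_jacobi_poly coefB /P /= => -> ->; rewrite subrr.
have : Lf ((Q - P m) * P d) = 0.
  rewrite mulrBl linearB/= -!intM oQ ?size_jacobi_poly//.
  by rewrite intM (jacobi_orthogonal orth) ?subrr// size_jacobi_poly.
rewrite mulrC (jacobi_norm orth norm).
  move/eqP; rewrite mulf_eq0 (gt_eqF (lommel_norm2_gt0 d)) orbF.
  by rewrite -/(lead_coef _) lead_coef_eq0 (negPf D0).
by rewrite /d prednK// size_poly_gt0.
Qed.

Lemma monic_oprl_lommel_norm m : \int[L]_y (monic_oprl L m).[y] ^+ 2 = h m.
Proof.
have [Lf LfE] := lommel_functional nu_gtN1 beta_gt0 beta_lt.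
have [orth norm] := lommel_functional_orthogonal LfE.
rewrite monic_oprl_lommel; transitivity (Lf (P m * P m)).
  by rewrite LfE; apply: eq_Rintegral => y _; rewrite hornerM expr2.
rewrite (jacobi_norm orth norm) ?size_jacobi_poly//.
have /monicP := jacobi_poly_monic A m.
by rewrite /lead_coef size_jacobi_poly /= => ->; rewrite mul1r.
Qed.

End lommel_oprl.

(** * Orthogonal polynomials on the unit circle *)

Section bounded_on_circle.
Context {R : realType}.
Implicit Types (u v : R[i] -> R) (f g : R[i] -> R[i]).

Lemma measurable_complex_pair : measurable_fun setT (@complex_pair R).
Proof.
move=> _ B mB; rewrite setTI; apply: sub_sigma_algebra; exists B => //.
by rewrite setTI.
Qed.

Lemma unit_circleE (z : R[i]) :
  unit_circle z <-> complex.Re z ^+ 2 + complex.Im z ^+ 2 = 1.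
Proof.
rewrite /unit_circle /= normc_def; split=> [|->]; last by rewrite sqrtr1.
move=> /(congr1 (@complex.Re R)) /= h; rewrite -[LHS]sqr_sqrtr ?h ?expr1n//.
by rewrite addr_ge0 ?sqr_ge0.
Qed.

(** Bounded measurable functions form an algebra and are integrable for a finite measure, so closure
    properties replace an integrability proof for each integrand. The bound is asked on the circle
    only, where polynomials are bounded. *)
Definition circle_bounded u : Prop :=
  measurable_fun setT u /\ exists M, forall z, unit_circle z -> `|u z| <= M.

Lemma circle_bounded_cst (r : R) : circle_bounded (fun=> r).
Proof. by split; [exact: measurable_cst|exists `|r|]. Qed.

Lemma circle_boundedD u v :
  circle_bounded u -> circle_bounded v -> circle_bounded (fun z => u z + v z).
Proof.
move=> [mu [M hM]] [mv [N hN]]; split; first exact: measurable_funD.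
exists (M + N) => z z1; rewrite (le_trans (ler_normD _ _))// lerD ?hM ?hN//.
Qed.

Lemma circle_boundedM u v :
  circle_bounded u -> circle_bounded v -> circle_bounded (fun z => u z * v z).
Proof.
move=> [mu [M hM]] [mv [N hN]]; split; first exact: measurable_funM.
by exists (M * N) => z z1; rewrite normrM ler_pM ?hM ?hN.
Qed.

Lemma circle_boundedN u : circle_bounded u -> circle_bounded (fun z => - u z).
Proof.
move=> /(circle_boundedM (circle_bounded_cst (-1))).
by under eq_fun do rewrite mulN1r.
Qed.

Definition ccircle_bounded f : Prop :=
  circle_bounded (@complex.Re R \o f) /\ circle_bounded (@complex.Im R \o f).

Lemma ccircle_bounded_cst (a : R[i]) : ccircle_bounded (fun=> a).
Proof. by split; exact: circle_bounded_cst. Qed.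

Lemma ccircle_bounded_id : ccircle_bounded id.
Proof.
split; split.
- exact: (measurableT_comp measurable_fst measurable_complex_pair).
- exists 1 => z /unit_circleE z1.
  rewrite -[leRHS]normr1 -ler_sqr ?nnegrE// !real_normK ?num_real//.
  by rewrite expr1n -z1 lerDl sqr_ge0.
- exact: (measurableT_comp measurable_snd measurable_complex_pair).
- exists 1 => z /unit_circleE z1.
  rewrite -[leRHS]normr1 -ler_sqr ?nnegrE// !real_normK ?num_real//.
  by rewrite expr1n -z1 lerDr sqr_ge0.
Qed.

Lemma ccircle_boundedD f g :
  ccircle_bounded f -> ccircle_bounded g -> ccircle_bounded (fun z => f z + g z).
Proof.
move=> [f1 f2] [g1 g2]; split.
  rewrite (_ : _ \o _ = fun z => complex.Re (f z) + complex.Re (g z)).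
    exact: circle_boundedD.
  by apply/funext => z /=; case: (f z) => ? ?; case: (g z).
rewrite (_ : _ \o _ = fun z => complex.Im (f z) + complex.Im (g z)).
  exact: circle_boundedD.
by apply/funext => z /=; case: (f z) => ? ?; case: (g z).
Qed.

Lemma ReM (v w : R[i]) : complex.Re (v * w) =
  complex.Re v * complex.Re w - complex.Im v * complex.Im w.
Proof. by case: v => ? ?; case: w. Qed.

Lemma ImM (v w : R[i]) : complex.Im (v * w) =
  complex.Re v * complex.Im w + complex.Im v * complex.Re w.
Proof. by case: v => ? ?; case: w. Qed.

Lemma ccircle_boundedM f g :
  ccircle_bounded f -> ccircle_bounded g -> ccircle_bounded (fun z => f z * g z).
Proof.
move=> [f1 f2] [g1 g2]; split.
  rewrite (_ : _ \o _ = fun z => complex.Re (f z) * complex.Re (g z) +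
      - (complex.Im (f z) * complex.Im (g z))).
    apply: circle_boundedD; first exact: circle_boundedM.
    by apply: circle_boundedN; exact: circle_boundedM.
  by apply/funext => z /=; rewrite ReM.
rewrite (_ : _ \o _ = fun z => complex.Re (f z) * complex.Im (g z) +
    complex.Im (f z) * complex.Re (g z)).
  by apply: circle_boundedD; exact: circle_boundedM.
by apply/funext => z /=; rewrite ImM.
Qed.

Lemma ccircle_bounded_conj f :
  ccircle_bounded f -> ccircle_bounded (fun z => (f z)^*).
Proof.
move=> [f1 f2]; split.
  by rewrite (_ : _ \o _ = @complex.Re R \o f)//; apply/funext => z /=; case: (f z).
rewrite (_ : _ \o _ = fun z => - complex.Im (f z)); first exact: circle_boundedN.
by apply/funext => z /=; case: (f z).
Qed.

Lemma ccircle_bounded_exp f n :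
  ccircle_bounded f -> ccircle_bounded (fun z => f z ^+ n).
Proof.
move=> cf; elim: n => [|n ih]; first exact: ccircle_bounded_cst.
by under eq_fun do rewrite exprS; exact: ccircle_boundedM.
Qed.

Lemma ccircle_bounded_sum (I : Type) (r : seq I) (F : I -> R[i] -> R[i]) :
  (forall i, ccircle_bounded (F i)) -> ccircle_bounded (fun z => \sum_(i <- r) F i z).
Proof.
move=> cF; elim: r => [|i r ih].
  by under eq_fun do rewrite big_nil; exact: ccircle_bounded_cst.
by under eq_fun do rewrite big_cons; exact: ccircle_boundedD.
Qed.

Lemma ccircle_bounded_horner (p : {poly R[i]}) : ccircle_bounded (horner p).
Proof.
rewrite (_ : horner p = fun z => \sum_(i < size p) p`_i * z ^+ i); last first.
  by apply/funext => z; rewrite horner_coef.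
apply: ccircle_bounded_sum => i; apply: ccircle_boundedM.
  exact: ccircle_bounded_cst.
exact/ccircle_bounded_exp/ccircle_bounded_id.
Qed.

Lemma measurable_unit_circle : measurable (@unit_circle R).
Proof.
have [[m1 _] [m2 _]] := ccircle_bounded_id.
have m : measurable_fun setT
    (fun z : R[i] => complex.Re z ^+ 2 + complex.Im z ^+ 2).
  by apply: measurable_funD; apply: measurable_funX.
have := m measurableT [set 1] (measurable_set1 1); rewrite setTI.
by congr measurable; apply/seteqP; split => z /= /unit_circleE.
Qed.

Context (mu : {measure set R[i] -> \bar R}).
Context (mu_fin : (mu unit_circle < +oo)%E).

Lemma circle_bounded_integrable u : circle_bounded u ->
  mu.-integrable unit_circle (EFin \o u).
Proof.
move=> [mu' [M hM]]; apply: measurable_bounded_integrable => //.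
- exact: measurable_unit_circle.
- exact: measurable_funTS.
- exists M; split; first exact: num_real.
  by move=> N MN z z1; rewrite /=  (le_trans (hM z z1))// ltW.
Qed.

Lemma complex_integralD f g : ccircle_bounded f -> ccircle_bounded g ->
  complex_integral mu (fun z => f z + g z) =
  complex_integral mu f + complex_integral mu g.
Proof.
move=> [f1 f2] [g1 g2]; rewrite /complex_integral.
have mC := measurable_unit_circle.
have -> : (fun z => complex.Re (f z + g z)) = fun z => complex.Re (f z) + complex.Re (g z).
  by apply/funext => z; case: (f z) => ? ?; case: (g z).
have -> : (fun z => complex.Im (f z + g z)) = fun z => complex.Im (f z) + complex.Im (g z).
  by apply/funext => z; case: (f z) => ? ?; case: (g z).
by rewrite !RintegralD//; exact: circle_bounded_integrable.
Qed.

Lemma complex_integralZ (a : R[i]) f : ccircle_bounded f ->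
  complex_integral mu (fun z => a * f z) = a * complex_integral mu f.
Proof.
move=> [f1 f2]; rewrite /complex_integral.
have mC := measurable_unit_circle.
have iZ (r : R) u : circle_bounded u ->
    mu.-integrable unit_circle (EFin \o (fun z => r * u z)).
  move=> cu; apply: circle_bounded_integrable; apply: circle_boundedM => //.
  exact: circle_bounded_cst.
under eq_Rintegral do rewrite ReM.
under [X in (_ +i* X)%C]eq_Rintegral do rewrite ImM.
rewrite RintegralB ?RintegralD; [|exact: mC|exact: iZ|exact: iZ|exact: mC|exact: iZ|exact: iZ].
rewrite !RintegralZl//; try exact: circle_bounded_integrable.
by case: a.
Qed.

Lemma complex_integral_sum (I : Type) (r : seq I) (F : I -> R[i] -> R[i]) :
  (forall i, ccircle_bounded (F i)) ->
  complex_integral mu (fun z => \sum_(i <- r) F i z) =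
  \sum_(i <- r) complex_integral mu (F i).
Proof.
move=> cF; elim: r => [|i r ih].
  under eq_fun do rewrite big_nil.
  rewrite big_nil /complex_integral /=.
  by rewrite !Rintegral_cst ?mul0r//; exact: measurable_unit_circle.
under eq_fun do rewrite big_cons.
by rewrite big_cons complex_integralD ?ih//; exact: ccircle_bounded_sum.
Qed.

Lemma eq_complex_integral f g : (forall z, unit_circle z -> f z = g z) ->
  complex_integral mu f = complex_integral mu g.
Proof.
by move=> fg; rewrite /complex_integral; congr (_ +i* _)%C;
  apply: eq_Rintegral => z; rewrite inE => /fg ->.
Qed.

End bounded_on_circle.

(** * Prediction errors and Toeplitz determinants from Szego polynomials *)

Section szego_opuc.
Context {R : realType} (mu : {measure set R[i] -> \bar R}).
Context (mu_fin : (mu unit_circle < +oo)%E).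
Context (c : nat -> R).
Context (moment : forall j k : nat,
  complex_integral mu (fun z => z ^+ j * (z ^+ k)^*) = (c `|j%:Z - k%:Z|%N)%:C%C).
Context (Phi : nat -> {poly R}) (E : nat -> R).
Context (Phi_monic : forall m, Phi m \is monic /\ size (Phi m) = m.+1).
Context (Phi_orth : forall m,
  (forall k : nat, (k < m)%N -> toeplitz_form c k (Phi m) = 0) /\
  toeplitz_form c m (Phi m) = E m).
Context (E_gt0 : forall m, 0 < E m).

Let toC (p : {poly R}) : {poly R[i]} := map_poly (real_complex R) p.
Let I (p q : {poly R[i]}) := complex_integral mu (fun z => p.[z] * (q.[z])^*).

Let IE p q : I p q =
  \sum_(j < size p) \sum_(k < size q) p`_j * (q`_k)^* * (c `|j%:Z - k%:Z|%N)%:C%C.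
Proof.
have cb (j k : nat) : ccircle_bounded (fun z : R[i] => z ^+ j * (z ^+ k)^*).
  apply: ccircle_boundedM; first exact/ccircle_bounded_exp/ccircle_bounded_id.
  exact/ccircle_bounded_conj/ccircle_bounded_exp/ccircle_bounded_id.
have cbZ a (j k : nat) : ccircle_bounded (fun z : R[i] => a * (z ^+ j * (z ^+ k)^*)).
  by apply: ccircle_boundedM => //; exact: ccircle_bounded_cst.
rewrite /I (_ : (fun z => _) = fun z => \sum_(j < size p) \sum_(k < size q)
    p`_j * (q`_k)^* * (z ^+ j * (z ^+ k)^*)); last first.
  apply/funext => z; rewrite !horner_coef rmorph_sum mulr_suml.
  apply: eq_bigr => j _; rewrite mulr_sumr; apply: eq_bigr => k _.
  by rewrite rmorphM mulrACA.
rewrite complex_integral_sum//; last by move=> j; exact: ccircle_bounded_sum.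
apply: eq_bigr => j _; rewrite complex_integral_sum//.
by apply: eq_bigr => k _; rewrite complex_integralZ// moment.
Qed.

Let I_toCl p q : I (toC p) q = \sum_(k < size q) (q`_k)^* * (toeplitz_form c k p)%:C%C.
Proof.
rewrite IE exchange_big /=; apply: eq_bigr => k _.
rewrite /toC size_map_poly /toeplitz_form rmorph_sum mulr_sumr; apply: eq_bigr => j _.
by rewrite coef_map /= rmorphM /= mulrAC mulrC.
Qed.

Let I_toCr p q : I q (toC p) = \sum_(k < size q) q`_k * (toeplitz_form c k p)%:C%C.
Proof.
rewrite IE; apply: eq_bigr => k _.
rewrite /toC size_map_poly /toeplitz_form rmorph_sum mulr_sumr; apply: eq_bigr => j _.
rewrite coef_map /= rmorphM /= -mulrA; congr (_ * (_ * _)).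
  by rewrite -[LHS]/(conjc _) conjc_real.
by congr (c _)%:C%C; lia.
Qed.

Let I_orth m (q : {poly R[i]}) : (size q <= m)%N -> I (toC (Phi m)) q = 0 /\ I q (toC (Phi m)) = 0.
Proof.
move=> qm; rewrite I_toCl I_toCr.
by split; rewrite big1// => k _; rewrite (Phi_orth m).1 ?mulr0// (leq_trans _ qm).
Qed.

Let toC_monic m : monic_of_degree m (toC (Phi m)).
Proof.
have [mP sP] := Phi_monic m.
by split; [rewrite map_monic|rewrite size_map_poly].
Qed.

Let subr_monic_size m (p q : {poly R[i]}) :
  monic_of_degree m p -> monic_of_degree m q -> (size (p - q)%R <= m)%N.
Proof.
move=> [mp sp] [mq sq]; apply/leq_sizeP => j.
rewrite leq_eqVlt => /orP[/eqP<-|mj]; last first.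
  by rewrite coefB !nth_default ?subrr// ?sp ?sq.
have /monicP := mp; have /monicP := mq.
by rewrite /lead_coef sp sq coefB /= => -> ->; rewrite subrr.
Qed.

Let ImulB p q r : I (p - q) r = I p r - I q r.
Proof.
have cb (s : {poly R[i]}) : ccircle_bounded (fun z => s.[z] * (r.[z])^*).
  apply: ccircle_boundedM; first exact: ccircle_bounded_horner.
  exact/ccircle_bounded_conj/ccircle_bounded_horner.
rewrite /I -[in RHS]mulN1r -complex_integralZ// -complex_integralD//.
  by apply: eq_complex_integral => z _; rewrite hornerD hornerN; ring.
by apply: ccircle_boundedM => //; exact: ccircle_bounded_cst.
Qed.

Lemma monic_opuc_szego m : monic_opuc mu m = toC (Phi m).
Proof.
apply: xget_unique => [|Q [mQ oQ]].
  by split=> // Q sQ; have [] := I_orth sQ.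
apply/eqP; rewrite -subr_eq0; apply/negPn/negP => D0.
set D := Q - _ in D0; have sD : (size D <= m)%N by exact: subr_monic_size.
pose d := (size D).-1.
have dE : size D = d.+1 by rewrite prednK// size_poly_gt0.
have sd : (size (toC (Phi d)) <= m)%N by have [_ ->] := toC_monic d; rewrite -dE.
have : I D (toC (Phi d)) = 0.
  rewrite ImulB; have [-> _] := I_orth sd; rewrite subr0; exact: oQ.
rewrite I_toCr dE big_ord_recr/= big1 ?add0r; last first.
  by move=> k _; rewrite (Phi_orth d).1 ?mulr0.
rewrite (Phi_orth d).2 => /eqP; rewrite mulf_eq0 -/(lead_coef _).
rewrite lead_coef_eq0 (negPf D0)/= => /eqP [] Ed.
by have := E_gt0 d; rewrite Ed ltxx.
Qed.

(** Pythagoras: for [Q] monic of degree [m], the difference with [Phi m] has lower degree, so its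
    square norm adds to that of [Phi m]. *)
Lemma prediction_error_szego m : prediction_error mu m = E m.
Proof.
have norm_I (Q : {poly R[i]}) :
    \int[mu]_(z in unit_circle) complex.Re (`|Q.[z]| ^+ 2) = complex.Re (I Q Q).
  rewrite /I /complex_integral [RHS]/=; apply: eq_Rintegral => z _.
  by rewrite sqr_normc.
have I_norm_ge0 (Q : {poly R[i]}) : 0 <= complex.Re (I Q Q).
  rewrite -norm_I; apply: Rintegral_ge0 => z _.
  rewrite sqr_normc; case: (Q.[z]) => x y /=.
  by rewrite mulrN opprK addr_ge0// -expr2 sqr_ge0.
have I_Phi : I (toC (Phi m)) (toC (Phi m)) = (E m)%:C%C.
  rewrite I_toCr; have [/monicP mP sP] := Phi_monic m.
  rewrite /toC size_map_poly sP big_ord_recr/= big1 ?add0r; last first.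
    by move=> k _; rewrite (Phi_orth m).1 ?mulr0.
  by rewrite (Phi_orth m).2 coef_map /=; move: mP; rewrite /lead_coef sP /= => ->; rewrite mul1r.
have ImulBr p q r : I r (p - q) = I r p - I r q.
  have cb (s : {poly R[i]}) : ccircle_bounded (fun z => r.[z] * (s.[z])^*).
    apply: ccircle_boundedM; first exact: ccircle_bounded_horner.
    exact/ccircle_bounded_conj/ccircle_bounded_horner.
  rewrite /I -[in RHS]mulN1r -complex_integralZ// -complex_integralD//.
    apply: eq_complex_integral => z _; rewrite hornerD hornerN rmorphB; ring.
  by apply: ccircle_boundedM => //; exact: ccircle_bounded_cst.
rewrite /prediction_error /minimum.
pose S := [set \int[mu]_(z in unit_circle) complex.Re (`|Q.[z]| ^+ 2)
          | Q in @monic_of_degree R[i] m]; rewrite -/S.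
have minE : S (E m) /\ lbound S (E m).
  split; first by exists (toC (Phi m)); rewrite ?norm_I ?I_Phi.
  move=> _ [Q mQ <-]; rewrite norm_I.
  have sD := subr_monic_size mQ (toC_monic m).
  have [orl orr] := I_orth sD.
  have : I Q Q = I (Q - toC (Phi m)) (Q - toC (Phi m)) + (E m)%:C%C.
    rewrite ImulBr orr subr0 ImulB -I_Phi.
    by move: orl; rewrite ImulBr => /eqP; rewrite subr_eq0 => /eqP ->; rewrite subrK.
  move=> ->; have := I_norm_ge0 (Q - toC (Phi m)).
  by case: (I _ _) => x y /= x0; rewrite lerDr.
apply: xget_unique => // e [Se le]; apply/eqP; rewrite eq_le.
by rewrite (le _ minE.1) (minE.2 _ Se).
Qed.

Lemma toeplitz_det_szego N : toeplitz_det mu N = (\prod_(m < N.+1) E m)%:C%C.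
Proof.
rewrite -(toeplitz_form_det N Phi_monic Phi_orth) -det_map_mx.
congr (\det _); apply/matrixP => j k; rewrite !mxE /= /toeplitz_moment.
(* The moment of index [j - k] integrates [z ^ (k - j)], which on the circle is [z ^ k] times the
   conjugate of [z ^ j]; hence the exchange of indices. *)
rewrite (_ : absz (j%:Z - k%:Z) = absz (k%:Z - j%:Z)); last by lia.
rewrite -moment; apply: eq_complex_integral => z z1.
have z0 : z != 0 by rewrite -normr_eq0 z1 oner_eq0.
have zV : z^* = z^-1 by rewrite invC_norm z1 expr1n invr1 mul1r.
by rewrite rmorphXn /= zV opprB expfzDr// exprVn exprnN.
Qed.

End szego_opuc.

(** * Trigonometry of the arcsin map *)

Section arcsin_map_trig.
Context {R : realType}.
Implicit Types (y : R) (n : nat).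

Let theta y : R := 2 * asin (y / 2).

Lemma arcsin_map_unit_circle y : unit_circle (arcsin_map y).
Proof. by apply/unit_circleE; rewrite /= cos2Dsin2. Qed.

Lemma arcsin_mapX y n : arcsin_map y ^+ n =
  (cos (n%:R * theta y) +i* sin (n%:R * theta y))%C.
Proof.
elim: n => [|n ih]; first by rewrite mul0r cos0 sin0.
rewrite exprS ih -natr1 mulrDl mul1r cosD sinD /arcsin_map -/(theta y).
by apply/eqP; rewrite eq_complex /=; apply/andP; split; apply/eqP; ring.
Qed.

Lemma arcsin_mapX_conj y (j k : nat) :
  arcsin_map y ^+ j * (arcsin_map y ^+ k)^* =
  (cos (j%:R * theta y - k%:R * theta y) +i*
   sin (j%:R * theta y - k%:R * theta y))%C.
Proof.
rewrite !arcsin_mapX cosB sinB -[Num.conj _]/(conjc _) /=.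
by apply/eqP; rewrite eq_complex /=; apply/andP; split; apply/eqP; ring.
Qed.

(** At [y = 2 sin phi] the even polynomials give cosines and the odd ones sines of multiples of
    [phi]; the addition formulas prove both together. *)
Lemma half_chebyshev_arcsin y n : -2 < y < 2 ->
  (-1) ^+ n * (half_chebyshev (2 * n)).[y] = cos (n%:R * theta y).
Proof.
move=> /andP[y1 y2]; set phi := asin (y / 2).
have yE : y = 2 * sin phi.
  rewrite asinK ?in_itv/=; last by apply/andP; split; lra.
  by field.
suff : (-1) ^+ n * (half_chebyshev (2 * n)).[y] = cos ((2 * n)%:R * phi) /\
    (-1) ^+ n * (half_chebyshev (2 * n).+1).[y] = sin ((2 * n).+1%:R * phi).
  by move=> [-> _]; rewrite natrM /theta mulrCA mulrA.
elim: n => [|n [ih0 ih1]].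
  rewrite muln0 expr0 !mul1r /= hornerC hornerZ hornerX mul0r cos0 ?mul1r.
  by split=> //; rewrite {1}yE; field.
have ss : (-1) ^+ n * (-1) ^+ n = 1 :> R by rewrite -exprMn mulrNN mulr1 expr1n.
have e2 : (2 * n).+2%:R * phi = (2 * n).+1%:R * phi + phi by rewrite -natr1; ring.
have e0 : (2 * n)%:R * phi = (2 * n).+1%:R * phi - phi by rewrite -natr1; ring.
have c2 : (-1) ^+ n.+1 * (half_chebyshev (2 * n).+2).[y] = cos ((2 * n).+2%:R * phi).
  rewrite half_chebyshevSS !(hornerD, hornerN, hornerM, hornerX).
  have -> : (-1) ^+ n.+1 * (y * (half_chebyshev (2 * n).+1).[y] -
      (half_chebyshev (2 * n)).[y]) =
    - y * ((-1) ^+ n * (half_chebyshev (2 * n).+1).[y]) +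
    (-1) ^+ n * (half_chebyshev (2 * n)).[y] by rewrite exprS; ring.
  by rewrite ih0 ih1 e0 e2 cosB cosD {1}yE; ring.
have -> : (2 * n.+1 = (2 * n).+2)%N by lia.
split=> //.
have -> : (-1) ^+ n.+1 * (half_chebyshev (2 * n).+3).[y] =
    y * ((-1) ^+ n.+1 * (half_chebyshev (2 * n).+2).[y]) +
    (-1) ^+ n * (half_chebyshev (2 * n).+1).[y].
  rewrite [half_chebyshev (2 * n).+3]half_chebyshevSS.
  by rewrite !(hornerD, hornerN, hornerM, hornerX) exprS; ring.
have e3 : (2 * n).+3%:R * phi = (2 * n).+2%:R * phi + phi by rewrite -[_.+3%:R]natr1; ring.
have e1 : (2 * n).+1%:R * phi = (2 * n).+2%:R * phi - phi by rewrite -[_.+2%:R]natr1; ring.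
by rewrite c2 ih1 e1 e3 sinB sinD {1}yE; ring.
Qed.

Lemma asinN_in y : -2 < y < 2 -> theta (- y) = - theta y.
Proof.
move=> /andP[y1 y2]; rewrite /theta mulNr; suff -> : asin (- (y / 2)) = - asin (y / 2).
  by rewrite mulrN.
have b1 : -1 <= y / 2 <= 1 by apply/andP; split; lra.
have b2 : -1 <= - (y / 2) <= 1 by apply/andP; split; lra.
apply: sin_inj.
- by rewrite in_itv/= asin_geNpi2// asin_lepi2.
- by rewrite in_itv/= lerN2 asin_lepi2// lerNl asin_geNpi2.
- by rewrite sinN !asinK// in_itv.
Qed.

End arcsin_map_trig.

(** * The lifted Lommel ensemble *)

Section lommel_arcsin_lift.
Context {R : realType} (nu beta : R).
Context (nu_gtN1 : -1 < nu) (beta_gt0 : 0 < beta).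
Context (beta_lt : beta < 2 * bessel_zero nu 1).

Let L : {measure set R -> \bar R} := lommel_ensemble nu beta.
Let mu : {measure set R[i] -> \bar R} := arcsin_lift L.
Let I : set R := `]-2, 2[%classic.
Let mI : measurable I := measurable_itv `]-2, 2[.

Let L_fin : (L setT < +oo)%E.
Proof.
have := integrable_lommel_poly nu_gtN1 beta_gt0 beta_lt 1.
move=> /integrableP[_]; apply: le_lt_trans.
under eq_integral do rewrite /= hornerC normr1.
by rewrite integral_cst// mul1e.
Qed.

Let L_outside : L (~` I) = 0%E.
Proof.
have mC : measurable (~` I) by exact: measurableC.
rewrite -[~` I]setIT -integral_indic//.
rewrite ge0_integral_lommel//.
  rewrite eseries0// => k _ _.
  have x0 := lommel_atom_gt0 nu_gtN1 beta_gt0 k.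
  have x2 := lommel_atom_lt2 nu_gtN1 beta_gt0 beta_lt k.
  rewrite !indicE !memNset ?adde0 ?mule0//= => h; apply: h.
    by rewrite /I/= in_itv/= ltrN2 x2 (lt_trans _ (ltr0Sn _ _))// oppr_lt0.
  by rewrite /I/= in_itv/= x2 (lt_trans _ x0)// oppr_lt0.
exact/measurable_EFinP/measurable_indic.
Qed.

Let L_restr (B : set R) : measurable B -> L (B `&` I) = L B.
Proof.
move=> mB; apply/eqP; rewrite eq_le; apply/andP; split.
  by apply: le_measure; rewrite ?inE//; exact: measurableI.
rewrite -[X in (L X <= _)%E](setUIDK B I).
apply: le_trans (measureU2 _ _ _) _ => //; first exact: measurableI.
  exact: measurableD.
rewrite -[leRHS]adde0 leeD2l// -L_outside.
apply: le_measure => [||y []//]; rewrite inE; first exact: measurableD.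
exact: measurableC.
Qed.

(** The ensemble charges nothing outside []-2, 2[], so the restriction in the lift is invisible; the
    map lands in the circle at every real [y], hence a bound there suffices. *)
Lemma integral_arcsin_lift_lommel (u : R[i] -> R) : circle_bounded u ->
  \int[mu]_(z in unit_circle) u z = \int[L]_y u (arcsin_map y).
Proof.
move=> [mu' [M hM]]; rewrite /Rintegral; congr fine.
have pre : @arcsin_map R @^-1` unit_circle = setT.
  by apply/seteqP; split => // y _; exact: arcsin_map_unit_circle.
have mua : measurable_fun setT (u \o @arcsin_map R).
  exact: (measurableT_comp mu' measurable_arcsin_map).
transitivity (\int[pushforward (mrestr L mI) (@arcsin_map R)]_(z in unit_circle) (u z)%:E)%E.
  by [].
rewrite integral_pushforward//.
- rewrite pre; apply: eq_measure_integral => B mB _; exact: L_restr.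
- exact: measurable_arcsin_map.
- exact/measurable_EFinP.
- rewrite pre; apply: (@measurable_bounded_integrable _ _ _ _ (u \o @arcsin_map R)) => //.
  + by apply: le_lt_trans L_fin; rewrite -[leLHS]/(L (setT `&` I)) L_restr.
  + exists M; split; first exact: num_real.
    move=> N MN y _ /=; rewrite (le_trans (hM _ (arcsin_map_unit_circle y)))//.
    exact: ltW.
- exact: measurable_unit_circle.
Qed.

Lemma arcsin_lift_lommel_fin : (mu unit_circle < +oo)%E.
Proof.
apply: le_lt_trans L_fin.
rewrite -[leLHS]/(L ((@arcsin_map R @^-1` unit_circle) `&` I)) L_restr.
  apply: le_measure; rewrite ?inE//; rewrite -[X in measurable X]setTI.
  exact: (measurable_arcsin_map measurableT measurable_unit_circle).
rewrite -[X in measurable X]setTI.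
exact: (measurable_arcsin_map measurableT measurable_unit_circle).
Qed.

(** The imaginary part is odd in [y] and integrates to 0 by symmetry; the real part is, up to sign,
    a Chebyshev polynomial at every atom. *)
Lemma arcsin_lift_lommel_moment (Lf : {scalar {poly R}}) :
  (forall p, Lf p = \int[L]_y p.[y]) -> forall j k : nat,
  complex_integral mu (fun z => z ^+ j * (z ^+ k)^*) =
  (arcsin_moment Lf `|j%:Z - k%:Z|%N)%:C%C.
Proof.
move=> LfE j k; pose f (z : R[i]) := z ^+ j * (z ^+ k)^*.
have [f1 f2] : ccircle_bounded f.
  apply: ccircle_boundedM; first exact/ccircle_bounded_exp/ccircle_bounded_id.
  exact/ccircle_bounded_conj/ccircle_bounded_exp/ccircle_bounded_id.
rewrite /complex_integral -/(f _).
rewrite (integral_arcsin_lift_lommel f1) (integral_arcsin_lift_lommel f2).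
have mf1 := measurableT_comp f1.1 measurable_arcsin_map.
have mf2 := measurableT_comp f2.1 measurable_arcsin_map.
have fE y : f (arcsin_map y) =
  (cos (j%:R * (2 * asin (y / 2)) - k%:R * (2 * asin (y / 2))) +i*
   sin (j%:R * (2 * asin (y / 2)) - k%:R * (2 * asin (y / 2))))%C.
  exact: arcsin_mapX_conj.
congr (_ +i* _)%C; last first.
  apply: (integral_lommel_odd nu_gtN1 beta_gt0 beta_lt) => //.
    apply: (@integrable_lommel _ _ _ nu_gtN1 beta_gt0 beta_lt _ 1) => // y _.
    by rewrite /= fE /= ler_norml sin_geN1 sin_le1.
  by move=> y y2; rewrite /= !fE /= asinN_in// !mulrN -opprD sinN.
set n := absz _; rewrite /arcsin_moment -linearZ /= LfE.
apply: (eq_integral_lommel nu_gtN1 beta_gt0 beta_lt) => //.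
  by apply: continuous_measurable_fun; exact: continuous_horner.
move=> y y2; rewrite /= fE hornerZ (half_chebyshev_arcsin n y2) /=.
have [jk|kj] := leqP j k.
  have -> : k%:R = (j%:R + n%:R) :> R by rewrite -natrD; congr (_%:R); rewrite /n; lia.
  by rewrite -cosN; congr cos; ring.
have -> : j%:R = (k%:R + n%:R) :> R by rewrite -natrD; congr (_%:R); rewrite /n; lia.
by congr cos; ring.
Qed.

Let t := lommel_t nu beta.
Let a m := (-1) ^+ m * (t m - 1).
Let Phi m := (szego a m).1.
Let E m := t m / 2 * lommel_norm2 nu beta m.

Let Phi_monic m : Phi m \is monic /\ size (Phi m) = m.+1.
Proof. exact: szego_monic. Qed.

Let E_gt0 m : 0 < E m.
Proof. by rewrite mulr_gt0 ?divr_gt0 ?lommel_t_gt0 ?lommel_norm2_gt0. Qed.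

Let setup : exists2 c : nat -> R,
  (forall j k : nat, complex_integral mu (fun z => z ^+ j * (z ^+ k)^*) =
    (c `|j%:Z - k%:Z|%N)%:C%C) &
  forall m, (forall k : nat, (k < m)%N -> toeplitz_form c k (Phi m) = 0) /\
    toeplitz_form c m (Phi m) = E m.
Proof.
have [Lf LfE] := lommel_functional nu_gtN1 beta_gt0 beta_lt.
have [orth norm] := lommel_functional_orthogonal nu_gtN1 beta_gt0 beta_lt LfE.
exists (arcsin_moment Lf); first exact: arcsin_lift_lommel_moment.
apply: (@arcsin_szego _ (lommel_A2 nu beta)) => //.
- by move=> m; exact: lommel_norm2S.
- by move=> m; exact: lommel_tS.
Qed.

Lemma monic_opuc_lommel m :
  monic_opuc mu m = map_poly (real_complex R) (Phi m).
Proof.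
have [c mom orth] := setup.
exact: (monic_opuc_szego arcsin_lift_lommel_fin mom Phi_monic orth E_gt0).
Qed.

Lemma monic_opuc_lommel0 m :
  (monic_opuc mu m).[0] = ((-1) ^+ m * (t m - 1))%:C%C.
Proof.
rewrite monic_opuc_lommel -[0 in LHS](rmorph0 (real_complex R)) horner_map /=.
congr (_%:C)%C; case: m => [|m]; last by have [-> _] := horner0_szego a m.
by rewrite /Phi /= hornerC mul1r /t /=; lra.
Qed.

Lemma prediction_error_lommel m : prediction_error mu m = E m.
Proof.
have [c mom orth] := setup.
exact: (prediction_error_szego arcsin_lift_lommel_fin mom Phi_monic orth).
Qed.

Lemma toeplitz_det_lommel N : toeplitz_det mu N =
  ((monic_oprl L N.+1).[2] / 2 ^+ N.+1 *
   \prod_(m < N.+1) lommel_norm2 nu beta m)%:C%C.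
Proof.
have [c mom orth] := setup.
rewrite (toeplitz_det_szego arcsin_lift_lommel_fin mom Phi_monic orth).
congr (_%:C)%C; rewrite big_split/= big_split/= monic_oprl_lommel//.
rewrite prodfV prodr_const card_ord; congr (_ / _ * _).
apply: prod_jacobi_horner2 => //; exact: lommel_tS.
Qed.

End lommel_arcsin_lift.

(** * Asymptotics *)

Section order_of_decay.
Context {R : realType}.
Implicit Types (u v : nat -> R) (k : nat).

(** [u m = O(m ^ - k)], with the exponent as an index so that orders add under products. *)
Definition decays k u : Prop :=
  exists C : R, \forall m \near \oo, `|u m| <= C * m%:R^-1 ^+ k.

Lemma decaysM k l u v : decays k u -> decays l v ->
  decays (k + l) (fun m => u m * v m).
Proof.
move=> [C hC] [D hD]; exists (C * D); near=> m.
have h1 : `|u m| <= C * m%:R^-1 ^+ k by near: m.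
have h2 : `|v m| <= D * m%:R^-1 ^+ l by near: m.
by rewrite normrM exprD mulrACA ler_pM.
Unshelve. all: by end_near. Qed.

Lemma decaysD k u v : decays k u -> decays k v -> decays k (fun m => u m + v m).
Proof.
move=> [C hC] [D hD]; exists (C + D); near=> m.
have h1 : `|u m| <= C * m%:R^-1 ^+ k by near: m.
have h2 : `|v m| <= D * m%:R^-1 ^+ k by near: m.
by rewrite (le_trans (ler_normD _ _))// mulrDl lerD.
Unshelve. all: by end_near. Qed.

Lemma decaysZ k (a : R) u : decays k u -> decays k (fun m => a * u m).
Proof.
move=> [C hC]; exists (`|a| * C); near=> m.
have h1 : `|u m| <= C * m%:R^-1 ^+ k by near: m.
by rewrite normrM -mulrA ler_wpM2l.
Unshelve. all: by end_near. Qed.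

Lemma decaysB k u v : decays k u -> decays k v -> decays k (fun m => u m - v m).
Proof.
move=> du /(decaysZ (-1)) dv; have := decaysD du dv.
by under eq_fun do rewrite mulN1r.
Qed.

Lemma decays_near k u v : (\forall m \near \oo, u m = v m) ->
  decays k u -> decays k v.
Proof.
move=> uv [C hC]; exists C; near=> m.
by have <- : u m = v m; near: m.
Unshelve. all: by end_near. Qed.

Lemma decays_le k l u : (l <= k)%N -> decays k u -> decays l u.
Proof.
move=> lk [C hC]; exists `|C|; near=> m.
have h1 : `|u m| <= C * m%:R^-1 ^+ k by near: m.
have m1 : (1 <= m)%N by near: m; exact: nbhs_infty_ge.
have m0 : 0 < m%:R :> R by rewrite ltr0n.
have i0 : 0 <= m%:R^-1 :> R by rewrite invr_ge0.
apply: le_trans h1 _; apply: le_trans (ler_wpM2r (exprn_ge0 _ i0) (ler_norm C)) _.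
rewrite ler_wpM2l// ler_wiXn2l// invf_le1// ler1n//.
Unshelve. all: by end_near. Qed.

Lemma decays_cvg u (l : R) : u @ \oo --> l -> decays 0 u.
Proof.
move=> ul; exists (`|l| + 1); near=> m.
rewrite expr0 mulr1; have : `|l - u m| <= 1.
  by near: m; move/cvgrPdist_le : ul; apply.
have -> : u m = l - (l - u m) by rewrite subKr.
rewrite subKr => h; rewrite (le_trans (ler_normB _ _))// lerD2l//.
Unshelve. all: by end_near. Qed.

Lemma decays_pred k u : decays k u -> decays k (fun m => u m.-1).
Proof.
(* The factor [2 ^ k] absorbs the shift, as [m <= 2 (m - 1)] from [m = 2] on. *)
move=> [C hC]; exists (`|C| * 2 ^+ k).
have h2 : \forall m \near \oo, `|u m.-1| <= C * m.-1%:R^-1 ^+ k.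
  by have [N _ hN] := hC; exists N.+1 => // m /= Nm; apply: hN => /=; lia.
near=> m.
have h1 : `|u m.-1| <= C * m.-1%:R^-1 ^+ k by near: m.
have m2 : (2 <= m)%N by near: m; exact: nbhs_infty_ge.
apply: le_trans h1 _.
have i0 : 0 <= m.-1%:R^-1 :> R by rewrite invr_ge0.
apply: le_trans (ler_wpM2r (exprn_ge0 _ i0) (ler_norm C)) _.
rewrite -mulrA -exprMn ler_wpM2l// lerXn2r ?nnegrE ?mulr_ge0 ?invr_ge0//.
have m0 : 0 < m%:R :> R by rewrite ltr0n; lia.
have m1 : 0 < m.-1%:R :> R by rewrite ltr0n; lia.
by rewrite ler_pdivlMr// mulrC ler_pdivrMr// -natrM ler_nat; lia.
Unshelve. all: by end_near. Qed.

Lemma decays_inv_addn (x : R) : decays 1 (fun m => (x + m%:R)^-1).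
Proof.
exists 2; near=> m.
have h : 2 * (`|x| + 1) <= m%:R by near: m; exact: nbhs_infty_ger.
have x1 : - `|x| <= x by rewrite lerNl -normrN ler_norm.
have x2 : 0 <= `|x| by [].
have p0 : 0 < x + m%:R by lra.
have m0 : 0 < m%:R :> R by lra.
rewrite expr1 gtr0_norm ?invr_gt0// ler_pdivlMr// mulrC ler_pdivrMr//.
by lra.
Unshelve. all: by end_near. Qed.

(** A lower bound of order [k] on [g] turns an absolute error of order [k + 2] into a relative one
    of order 2. *)
Lemma eq_up_to_O2_decays k (f g : nat -> R) (c : R) : 0 < c ->
  (\forall m \near \oo, c * m%:R^-1 ^+ k <= g m) ->
  decays (k + 2) (fun m => f m - g m) -> eq_up_to_O2 f g.
Proof.
move=> c0 cg [C hC]; exists (fun m => f m / g m - 1).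
have g0 : \forall m \near \oo, 0 < g m.
  near=> m; have m0 : (0 < m)%N by near: m; exact: nbhs_infty_gt.
  apply: (@lt_le_trans _ _ (c * m%:R^-1 ^+ k)); last by near: m.
  by rewrite mulr_gt0// exprn_gt0// invr_gt0 ltr0n.
split; last first.
  near=> m; have gm : 0 < g m by near: m.
  by rewrite addrCA subrr addr0 mulrC divfK// gt_eqF.
apply/eqO_exP; exists (`|C| / c + 1).
  by rewrite ltr_wpDl// divr_ge0// ltW.
near=> m.
have gm : 0 < g m by near: m.
have hm : `|f m - g m| <= C * m%:R^-1 ^+ (k + 2) by near: m.
have cm : c * m%:R^-1 ^+ k <= g m by near: m.
have i0 : 0 <= m%:R^-1 :> R by rewrite invr_ge0.
have -> : f m / g m - 1 = (f m - g m) / g m by rewrite mulrBl divff// gt_eqF.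
rewrite normrM normfV (gtr0_norm gm) ler_pdivrMr//.
apply: le_trans hm _; rewrite -exprVn normrX (ger0_norm i0).
apply: (@le_trans _ _ (`|C| / c * m%:R^-1 ^+ 2 * (c * m%:R^-1 ^+ k))); last first.
  rewrite ler_pM ?mulr_ge0 ?exprn_ge0 ?divr_ge0 ?invr_ge0 ?(ltW c0)//.
  apply: ler_wpM2r; first exact: exprn_ge0.
  by rewrite lerDl.
rewrite (_ : _ * (c * _) = `|C| * m%:R^-1 ^+ (k + 2)); last first.
  by rewrite mulrACA divfK ?gt_eqF// addnC exprD.
by rewrite ler_wpM2r ?exprn_ge0// ler_norm.
Unshelve. all: by end_near. Qed.

(** By [u / (1 + u) <= ln (1 + u) <= u], the error is at most [2 u ^ 2] once [|u| <= 1/2]. *)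
Lemma ln1D_decays k u : decays k.+1 u ->
  decays (k.+1 + k.+1) (fun m => ln (1 + u m) - u m).
Proof.
move=> du; have [C hC] := decaysM du du; exists (2 * C).
have u0 : \forall m \near \oo, `|u m| <= 1 / 2.
  have [D hD] := decays_le (ltn0Sn k) du.
  near=> m; have h : `|u m| <= D * m%:R^-1 ^+ 1 by near: m.
  have mD : 2 * `|D| + 1 <= m%:R by near: m; exact: nbhs_infty_ger.
  have m0 : 0 < m%:R :> R by have := normr_ge0 D; lra.
  apply: le_trans h _; rewrite expr1 ler_pdivrMr//.
  by have := ler_norm D; lra.
near=> m.
have h : `|u m * u m| <= C * m%:R^-1 ^+ (k.+1 + k.+1) by near: m.
have : `|u m| <= 1 / 2 by near: m.
rewrite ler_norml => /andP[u1 u2].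
rewrite -mulrA; apply: (@le_trans _ _ (2 * `|u m * u m|)); last by rewrite ler_wpM2l.
have uu : 0 <= u m * u m by rewrite -expr2 sqr_ge0.
rewrite (ger0_norm uu).
have p1 : 0 < 1 + u m by lra.
have hi : ln (1 + u m) <= u m by apply: le_ln1Dx; lra.
have lo : u m / (1 + u m) <= ln (1 + u m).
  have := @le_ln1Dx R (- (u m / (1 + u m))) _.
  have -> : 1 - u m / (1 + u m) = (1 + u m)^-1 by field; rewrite gt_eqF.
  rewrite lnV ?posrE// lerN2; apply.
  by rewrite ltrN2 ltr_pdivrMr//; lra.
have e : u m / (1 + u m) = u m - u m * u m / (1 + u m) by field; rewrite gt_eqF.
have l2 : u m * u m / (1 + u m) <= 2 * (u m * u m).
  by rewrite ler_pdivrMr//; nra.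
rewrite ler_norml; apply/andP; split; last by lra.
by rewrite e in lo; lra.
Unshelve. all: by end_near. Qed.

End order_of_decay.

Lemma inv_addn_ge (R : realType) (x : R) :
  \forall m \near \oo, 1 / 2 * m%:R^-1 <= (x + m%:R)^-1.
Proof.
near=> m.
have h : `|x| + 1 <= m%:R by near: m; exact: nbhs_infty_ger.
have x1 : - `|x| <= x by rewrite lerNl -normrN ler_norm.
have x2 : x <= `|x| by exact: ler_norm.
have x3 : 0 <= `|x| by [].
have p0 : 0 < x + m%:R by lra.
have m0 : 0 < m%:R :> R by lra.
by rewrite ler_pdivrMr// [leRHS]mulrC ler_pdivlMr//; lra.
Unshelve. all: by end_near. Qed.

(** * Asymptotics of [t] and of its increments *)

Section lommel_asymptotics.
Context {R : realType} (nu beta : R).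
Context (nu_gtN1 : -1 < nu) (beta_gt0 : 0 < beta).
Context (beta_lt : beta < 2 * bessel_zero nu 1).

Let A := lommel_A2 nu beta.
Let t := lommel_t nu beta.
Let P := jacobi_poly A.
Let g (m : nat) : R :=
  beta ^+ 2 / (8 * (nu + m%:R - 1) * (nu + m%:R) * (nu + m%:R + 1)).

Let t_gt0 m : 0 < t m. Proof. exact: lommel_t_gt0. Qed.

Let AE m : A m = beta ^+ 2 / 4 * ((nu + m%:R)^-1 * (nu + 1 + m%:R)^-1).
Proof. by rewrite /A /lommel_A2 addrAC !invfM !mulrA. Qed.

Let gE m : g m = beta ^+ 2 / 8 *
  ((nu - 1 + m%:R)^-1 * ((nu + m%:R)^-1 * (nu + 1 + m%:R)^-1)).
Proof. by rewrite /g addrAC [nu + m%:R + 1]addrAC !invfM !mulrA. Qed.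

Let A_decays : decays 2 A.
Proof.
rewrite (_ : A = fun m => A m)//; under eq_fun do rewrite AE.
by apply: decaysZ; apply: (@decaysM _ 1 1); exact: decays_inv_addn.
Qed.

Let g_decays : decays 3 g.
Proof.
rewrite (_ : g = fun m => g m)//; under eq_fun do rewrite gE.
apply: decaysZ; apply: (@decaysM _ 1 2); first exact: decays_inv_addn.
by apply: (@decaysM _ 1 1); exact: decays_inv_addn.
Qed.

(** [t n / 2] is the quotient of consecutive terms of a sequence whose limit is nonzero. *)
Lemma cvg_lommel_t : t @ \oo --> (2 : R).
Proof.
have c0 : 0 < clifford (beta ^+ 2 / 4) nu (1 / 4).
  by apply: (clifford_quarter_gt0 nu_gtN1 beta_gt0); exact: lommel_atom_lt2.
have cP := cvg_jacobi_lommel nu_gtN1 beta_gt0.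
have cS : (P n.+1).[2] / 2 ^+ n.+1 @[n --> \oo] --> clifford (beta ^+ 2 / 4) nu (1 / 4).
  by rewrite (cvg_shiftS (fun n => (P n).[2] / 2 ^+ n)).
have -> : t = fun n => 2 * ((P n.+1).[2] / 2 ^+ n.+1 * ((P n).[2] / 2 ^+ n)^-1).
  apply/funext => n.
  have [h] := lommel_t_ratio nu_gtN1 beta_gt0 beta_lt n; rewrite -/A -/t -/P in h *.
  rewrite h => /lt0r_neq0; rewrite mulf_eq0 invr_eq0 negb_or => /andP[_ P0].
  have q0 : (2 : R) ^+ n != 0 by rewrite expf_neq0.
  rewrite exprS; move: P0 q0; move: (P n.+1).[2] (P n).[2] (2 ^+ n) => p1 p0 q.
  by move=> P0 q0; field; rewrite P0 q0.
set c := clifford _ _ _ in c0 cP cS *.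
suff : 2 * ((P n.+1).[2] / 2 ^+ n.+1 * ((P n).[2] / 2 ^+ n)^-1) @[n --> \oo]
    --> 2 * (c * c^-1) by rewrite divff ?mulr1// gt_eqF.
apply: (@cvgn_mull _ 2); apply: cvgM; first exact: cS.
by apply: cvgV; [rewrite gt_eqF|exact: cP].
Qed.

Lemma cvg_lommel_t_pred : t m.-1 @[m --> \oo] --> (2 : R).
Proof. by rewrite -(cvg_shiftS (fun m => t m.-1)); exact: cvg_lommel_t. Qed.

Let tV_decays : decays 0 (fun m => (t m)^-1).
Proof.
by apply: (@decays_cvg _ _ 2^-1); apply: cvgV => //; exact: cvg_lommel_t.
Qed.

Lemma lommel_t_sub2 m : 2 - t m.+1 = A m.+1 / t m.
Proof. by rewrite -[A m.+1](lommel_tS nu_gtN1 beta_gt0 beta_lt) mulfK// gt_eqF. Qed.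

Let two_sub_t_decays : decays 2 (fun m => 2 - t m).
Proof.
apply: (@decays_near _ _ (fun m => A m * (t m.-1)^-1)).
  by near=> m; have /prednK <- : (0 < m)%N by [near: m; exact: nbhs_infty_gt];
    rewrite lommel_t_sub2.
by apply: (@decaysM _ 2 0) => //; exact: (decays_pred tV_decays).
Unshelve. all: by end_near. Qed.

Lemma lommel_A2B m : (2 <= m)%N -> A m.-1 - A m = 4 * g m.
Proof.
have nu1 := nu_gtN1.
case: m => [//|m m1]; rewrite /A /lommel_A2 /g /= -natr1.
have m0 : 1 <= m%:R :> R by rewrite ler1n.
by field; rewrite !gt_eqF//; lra.
Qed.

Let d m := t m - t m.-1.

(** Subtract [2 - t m = A m / t m.-1] at consecutive indices: the variation of [A] produces the term
    in [g], that of [t] the term in [d m.-1]. *)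
Let d_rec m : (2 <= m)%N -> d m = 4 * g m / t m.-1 +
  A m.-1 * (d m.-1 * ((t m.-1.-1)^-1 * (t m.-1)^-1)).
Proof.
case: m => [|[|m]]// _; rewrite -lommel_A2B// /d /=.
have t0 := t_gt0 m; have t1 := t_gt0 m.+1.
have -> : t m.+2 - t m.+1 = (2 - t m.+1) - (2 - t m.+2) by lra.
rewrite 2!lommel_t_sub2.
by field; rewrite !gt_eqF.
Qed.

(** Bootstrap: order 2 is inherited from [2 - t]; fed into the recursion, it gives order 4 to the
    term in [A], so that the term in [g], of order 3, dominates. *)
Let d_decays : decays 3 d.
Proof.
have d2 : decays 2 d.
  have -> : d = fun m => (2 - t m.-1) - (2 - t m) by apply/funext => m; rewrite /d; lra.
  by apply: decaysB => //; exact: (decays_pred two_sub_t_decays).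
apply: (@decays_near _ _ (fun m => 4 * (g m * (t m.-1)^-1) +
  A m.-1 * (d m.-1 * ((t m.-1.-1)^-1 * (t m.-1)^-1)))).
  near=> m; rewrite [RHS]d_rec ?(mulrA 4)//; near: m; exact: nbhs_infty_ge.
apply: decaysD.
  by apply: decaysZ; apply: (@decaysM _ 3 0) => //; exact: (decays_pred tV_decays).
apply: (@decays_le _ 4) => //; apply: (@decaysM _ 2 2); first exact: (decays_pred A_decays).
apply: (@decaysM _ 2 0); first exact: (decays_pred d2).
apply: (@decaysM _ 0 0); last exact: (decays_pred tV_decays).
exact: (decays_pred (decays_pred tV_decays)).
Unshelve. all: by end_near. Qed.

Lemma ln_lommel_t_ratio_O2 : eq_up_to_O2 (fun m => ln (t m / t m.-1)) g.
Proof.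
have tpV := decays_pred tV_decays.
have u3 : decays 3 (fun m => d m * (t m.-1)^-1) by exact: (@decaysM _ 3 0).
have ug : decays 5 (fun m => d m * (t m.-1)^-1 - g m).
  (* By [4 / t ^ 2 - 1 = (2 - t) (2 + t) / t ^ 2] at [t m.-1], the error splits into [g] times a
     term of order 2 and [A m.-1] times a term of order 3. *)
  apply: (@decays_near _ _ (fun m =>
     g m * ((2 - t m.-1) * ((2 + t m.-1) * ((t m.-1)^-1 * (t m.-1)^-1))) +
     A m.-1 * (d m.-1 * ((t m.-1.-1)^-1 * ((t m.-1)^-1 * (t m.-1)^-1))))).
    near=> m; rewrite [in RHS]d_rec; last by near: m; exact: nbhs_infty_ge.
    have t0 := t_gt0 m.-1; have t1 := t_gt0 m.-1.-1.
    by field; rewrite !gt_eqF.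
  apply: decaysD.
    apply: (@decaysM _ 3 2) => //; apply: (@decaysM _ 2 0).
      exact: (decays_pred two_sub_t_decays).
    apply: (@decaysM _ 0 0); last exact: (@decaysM _ 0 0).
    apply: (@decays_cvg _ _ (2 + 2)); apply: cvgD; first exact: cvg_cst.
    exact: cvg_lommel_t_pred.
  apply: (@decaysM _ 2 3); first exact: (decays_pred A_decays).
  apply: (@decaysM _ 3 0); first exact: (decays_pred d_decays).
  apply: (@decaysM _ 0 0); last exact: (@decaysM _ 0 0).
  exact: (decays_pred tpV).
(* Each of the three inverse factors of [g] is eventually at least [1 / (2 m)], whence the constant
   1/8. *)
have c0 : 0 < beta ^+ 2 / 8 * (1 / 8) by rewrite mulr_gt0// divr_gt0// exprn_gt0.
apply: (@eq_up_to_O2_decays _ 3 _ _ _ c0).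
  near=> m; rewrite gE -mulrA ler_wpM2l ?divr_ge0 ?exprn_ge0 ?(ltW beta_gt0)//.
  have i0 : 0 <= 1 / 2 * m%:R^-1 :> R by rewrite mulr_ge0 ?invr_ge0.
  have -> : 1 / 8 * m%:R^-1 ^+ 3 =
     1 / 2 * m%:R^-1 * (1 / 2 * m%:R^-1 * (1 / 2 * m%:R^-1)) :> R.
    by rewrite -[RHS]/((1 / 2 * _) ^+ 3) exprMn; congr (_ * _); field.
  by rewrite ler_pM ?mulr_ge0 ?ler_pM//; near: m; exact: inv_addn_ge.
have l6 : decays 6 (fun m => ln (1 + d m * (t m.-1)^-1) - d m * (t m.-1)^-1).
  exact: (ln1D_decays u3).
apply: (@decays_near _ _ (fun m =>
  (ln (1 + d m * (t m.-1)^-1) - d m * (t m.-1)^-1) +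
  (d m * (t m.-1)^-1 - g m))).
  apply: nearW => m; rewrite addrA subrK; congr (ln _ - _).
  by rewrite /d mulrBl divff ?gt_eqF//; lra.
by apply: decaysD => //; exact: (@decays_le _ 6).
Unshelve. all: by end_near. Qed.

Lemma two_sub_lommel_t_O2 : eq_up_to_O2 (fun m => 2 - t m) (fun m => A m / 2).
Proof.
have c0 : 0 < beta ^+ 2 / 8 * (1 / 4) by rewrite mulr_gt0// divr_gt0// exprn_gt0.
apply: (@eq_up_to_O2_decays _ 2 _ _ _ c0).
  near=> m; rewrite AE.
  rewrite [leRHS](_ : _ = beta ^+ 2 / 8 * ((nu + m%:R)^-1 * (nu + 1 + m%:R)^-1)); last first.
    by rewrite mulrAC; congr (_ * _); field.
  rewrite -mulrA ler_wpM2l ?divr_ge0 ?exprn_ge0 ?(ltW beta_gt0)//.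
  have i0 : 0 <= 1 / 2 * m%:R^-1 :> R by rewrite mulr_ge0 ?invr_ge0.
  have -> : 1 / 4 * m%:R^-1 ^+ 2 = 1 / 2 * m%:R^-1 * (1 / 2 * m%:R^-1) :> R.
    by rewrite -[RHS]/((1 / 2 * _) ^+ 2) exprMn; congr (_ * _); field.
  by rewrite ler_pM//; near: m; exact: inv_addn_ge.
(* As [2 - t m = A m / t m.-1], the difference is [A m * (2 - t m.-1) / (2 * t m.-1)], of order 2 +
   2. *)
apply: (@decays_near _ _ (fun m => A m * ((2 - t m.-1) * (2^-1 * (t m.-1)^-1)))).
  near=> m; have m0 : (0 < m)%N by near: m; exact: nbhs_infty_gt.
  have h := lommel_t_sub2 m.-1; rewrite (prednK m0) in h; rewrite h.
  by have t0 := t_gt0 m.-1; field; rewrite gt_eqF.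
apply: (@decaysM _ 2 2) => //; apply: (@decaysM _ 2 0).
  exact: (decays_pred two_sub_t_decays).
by apply: decaysZ; exact: (decays_pred tV_decays).
Unshelve. all: by end_near. Qed.

End lommel_asymptotics.

(** * Monotonicity of [t] and telescoping *)

Section lommel_monotonicity.
Context {R : realType} (nu beta : R).
Context (nu_gtN1 : -1 < nu) (beta_gt0 : 0 < beta).
Context (beta_lt : beta < 2 * bessel_zero nu 1).

Let A := lommel_A2 nu beta.
Let t := lommel_t nu beta.
Let P := jacobi_poly A.

Let t_gt0 m : 0 < t m. Proof. exact: lommel_t_gt0. Qed.

Let A_gt0 m : 0 < A m.+1. Proof. exact: lommel_A2_gt0. Qed.

Let t0E : t 0 = 2. Proof. by []. Qed.

Lemma lommel_t1 : t 1 = 2 - A 1 / 2.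
Proof. by have := lommel_t_sub2 nu_gtN1 beta_gt0 beta_lt 0; rewrite -/t -/A t0E; lra. Qed.

Lemma lommel_t_lt2 m : t m.+1 < 2.
Proof.
by rewrite -subr_gt0 (lommel_t_sub2 nu_gtN1 beta_gt0 beta_lt) divr_gt0.
Qed.

Lemma jacobi_lommel_horner2S m : (P m.+1).[2] = t m * (P m).[2].
Proof.
have [tE] := lommel_t_ratio nu_gtN1 beta_gt0 beta_lt m.
rewrite -/A -/t -/P in tE *; rewrite tE => /lt0r_neq0.
by rewrite mulf_eq0 invr_eq0 negb_or => /andP[_ P0]; rewrite divfK.
Qed.

Lemma jacobi_lommel_horner2_gt0 m : 0 < (P m).[2].
Proof.
by apply: (jacobi_lommel_gt0 nu_gtN1 beta_gt0); exact: lommel_atom_lt2.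
Qed.

Lemma jacobi_lommel_horner2E m :
  (P m.+1).[2] / 2 ^+ m.+1 = \prod_(1 <= k < m.+1) (t k / 2).
Proof.
elim: m => [|m ih]; first by rewrite big_nil /P /= hornerX expr1 divff.
rewrite big_nat_recr// -ih (jacobi_lommel_horner2S m.+1) [2 ^+ m.+2]exprS invfM.
by rewrite [LHS]mulrACA [LHS]mulrC.
Qed.

Lemma lommel_t_sqr m :
  1 - (t m.+1 - 1) ^+ 2 = A m.+1 * (t m.+1 / t m).
Proof.
have h := lommel_t_sub2 nu_gtN1 beta_gt0 beta_lt m.
have -> : A m.+1 * (t m.+1 / t m) = t m.+1 * (A m.+1 / t m) by ring.
by rewrite -h -/t; ring.
Qed.

Lemma lommel_prod_bounds : 0 < clifford (beta ^+ 2 / 4) nu (1 / 4) < 1.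
Proof.
rewrite clifford_quarter_gt0 ?lommel_atom_lt2//=.
have t12 : t 1 / 2 < 1 by have := lommel_t_lt2 0; lra.
apply: le_lt_trans t12; have cP := cvg_jacobi_lommel nu_gtN1 beta_gt0.
(* The terms of index 0 and 1 both equal 1; the bound by [t 1 / 2 < 1] starts at index 2. *)
suff h n : (P n.+2).[2] / 2 ^+ n.+2 <= t 1 / 2.
  by apply: (cvgr_to_le cP); exists 2 => // -[|[|n]]//= _; exact: h.
elim: n => [|n ih]; first by rewrite jacobi_lommel_horner2E big_nat1.
apply: le_trans ih; rewrite (jacobi_lommel_horner2S n.+2).
rewrite [2 ^+ n.+3]exprS invfM mulrACA ler_piMl ?divr_ge0 ?exprn_ge0//.
  exact: (ltW (jacobi_lommel_horner2_gt0 _)).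
by have := lommel_t_lt2 n.+1; lra.
Qed.

Lemma lommel_A2_decreasing m : A m.+2 < A m.+1.
Proof.
have nu1 := nu_gtN1; have b0 := beta_gt0; have m0 : 0 <= m%:R :> R by [].
have := @lommel_A2B _ nu beta nu_gtN1 m.+2 isT; rewrite -subr_gt0 /= => ->.
by rewrite mulr_gt0// divr_gt0 ?exprn_gt0// !mulr_gt0//;
  rewrite -!natr1; lra.
Qed.

Section increasing.
Context (beta_small : beta ^+ 2 < 32 * (nu + 1) * (nu + 2) / (nu + 3)).

(** At the first index the hypothesis, rewritten as [A 1 * (nu + 3) < 8], is exactly
    [A 2 / t 1 < A 1 / 2], that is [t 1 < t 2]. Afterwards [2 - t m.+1 = A m.+1 / t m] decreases,
    its numerator decreasing and, by induction, its denominator increasing. *)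
Lemma lommel_t_increasing m : t m.+1 < t m.+2.
Proof.
elim: m => [|m ih].
  have nu1 := nu_gtN1; have t1 := t_gt0 1.
  suff : A 2 / t 1 < A 1 / 2.
    rewrite -(lommel_t_sub2 nu_gtN1 beta_gt0 beta_lt 1) -/t.
    by have := lommel_t1; lra.
  rewrite ltr_pdivrMr// mulrAC ltr_pdivlMr// lommel_t1.
  have A2E : A 2 * (nu + 3) = A 1 * (nu + 1).
    by rewrite /A /lommel_A2; field; rewrite !gt_eqF//; lra.
  have A1E : A 1 * (4 * (nu + 1) * (nu + 2)) = beta ^+ 2.
    by rewrite /A /lommel_A2; field; rewrite !gt_eqF//; lra.
  have n3 : 0 < nu + 3 by lra.
  have A1_small : A 1 * (nu + 3) < 8.
    have n12 : 0 < 4 * (nu + 1) * (nu + 2) by rewrite !mulr_gt0//; lra.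
    have := beta_small; rewrite ltr_pdivlMr// -A1E => h.
    by rewrite -(ltr_pM2r n12) mulrAC; apply: lt_le_trans h _; lra.
  rewrite -(ltr_pM2r n3).
  have -> : A 2 * 2 * (nu + 3) = 2 * (A 1 * (nu + 1)) by rewrite -A2E; ring.
  have -> : A 1 * (2 - A 1 / 2) * (nu + 3) = A 1 * (2 * (nu + 3) - (A 1 * (nu + 3)) / 2) by field.
  rewrite mulrCA ltr_pM2l ?A_gt0//; lra.
have t1 := t_gt0 m.+1; have t2 := t_gt0 m.+2.
suff : 2 - t m.+3 < 2 - t m.+2 by lra.
rewrite !(lommel_t_sub2 nu_gtN1 beta_gt0 beta_lt).
apply: (@lt_trans _ _ (A m.+2 / t m.+2)).
  by rewrite ltr_pM2r ?invr_gt0// lommel_A2_decreasing.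
by rewrite ltr_pM2l ?A_gt0// ltf_pV2.
Qed.

Lemma cvg_sum_ln_lommel_t :
  \sum_(2 <= m < n) ln (t m / t m.-1) @[n --> \oo] --> ln (4 / (4 - A 1)).
Proof.
have t1 := t_gt0 1.
have -> : 4 / (4 - A 1) = 2 / t 1.
  have := t1; rewrite lommel_t1 => h; by field; rewrite !gt_eqF//; lra.
rewrite ln_div ?posrE//.
apply: (@cvg_trans _ (ln (t n.-1) - ln (t 1) @[n --> \oo])); last first.
  apply: cvgB; last exact: cvg_cst.
  by apply: continuous_cvg; [exact: continuous_ln|exact: cvg_lommel_t_pred].
apply: near_eq_cvg; near=> n.
have n2 : (2 <= n)%N by near: n; exact: nbhs_infty_ge.
rewrite -(telescope_sumr (fun k => ln (t k.-1)) n2); apply: eq_big_nat => k _.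
by rewrite ln_div ?posrE.
Unshelve. all: by end_near. Qed.

End increasing.
End lommel_monotonicity.

Theorem theorem3 (R : realType) (nu beta : R)
    (hnu : -1 < nu) (hbeta0 : 0 < beta) (hbeta : beta < 2 * bessel_zero nu 1) :
  let L := lommel_ensemble nu beta in
  let P := monic_oprl L in
  let normP2 (m : nat) : R := \int[L]_x (P m).[x] ^+ 2 in
  let mu : {measure set R[i] -> \bar R} := arcsin_lift L in
  let Phi := monic_opuc mu in
  let E := prediction_error mu in
  let D := toeplitz_det mu in
  let A2 := lommel_A2 nu beta in
  let t := lommel_t nu beta in
  let h (m : nat) : R :=
    beta ^+ 2 / (2 * (nu + 1)) * (beta / 2) ^+ (2 * m) *
    ((Gamma (nu + 1) * Gamma (nu + 2)) /
     (Gamma (nu + m%:R + 1) * Gamma (nu + m%:R + 2))) in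
  let calJ : R := Gamma (nu + 1) * (4 / beta) `^ nu * besselJ nu (beta / 2) in
  let abs_Phi0 (m : nat) : R := complex.Re `|(Phi m).[0]| in
  (forall m : nat,
     [/\ normP2 m = h m,
         E m = t m / 2 * h m
       & (Phi m).[0] = ((-1) ^+ m * (t m - 1))%:C%C]) /\
  (* (i) *)
  ([/\ (fun n : nat => \prod_(1 <= m < n.+1) (t m / 2)) @ \oo --> calJ,
      0 < calJ < 1,
      (forall N : nat,
         D N = ((P N.+1).[2] / 2 ^+ N.+1 * \prod_(m < N.+1) normP2 m)%:C%C)
    & (fun N : nat => (P N.+1).[2] / 2 ^+ N.+1) @ \oo --> calJ]) /\
  (* (ii) *)
  (beta ^+ 2 < 32 * (nu + 1) * (nu + 2) / (nu + 3) ->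
   [/\ (forall m : nat, (1 <= m)%N -> t m < t m.+1),
       (forall m : nat, (2 <= m)%N ->
          (P m).[2] ^+ 2 < (P m.+1).[2] * (P m.-1).[2])
         /\ (P 2%N).[2] * (P 0%N).[2] < (P 1%N).[2] ^+ 2,
       (forall m : nat, (2 <= m)%N ->
          1 - (Phi m).[0] ^+ 2 = (A2 m * (t m / t m.-1))%:C%C /\
          A2 m < A2 m * (t m / t m.-1)),
       (forall m : nat, (2 <= m)%N -> 0 < ln (t m / t m.-1))
     & (fun n : nat => \sum_(2 <= m < n) ln (t m / t m.-1)) @ \oo
         --> ln (4 / (4 - A2 1%N))]) /\
  (* (iii) *)
  [/\ (forall m : nat, (1 <= m)%N ->
         ln (complex.Re (1 - (Phi m).[0] ^+ 2) / A2 m) = ln (t m / t m.-1)),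
      eq_up_to_O2 (fun m => ln (t m / t m.-1))
        (fun m => beta ^+ 2 /
           (8 * (nu + m%:R - 1) * (nu + m%:R) * (nu + m%:R + 1))),
      eq_up_to_O2 (fun m => 2 - t m) (fun m => A2 m / 2),
      (\forall m \near \oo, 1 < t m /\ 1 - abs_Phi0 m = 2 - t m)
    & eq_up_to_O2 (fun m => 1 - abs_Phi0 m)
        (fun m => beta ^+ 2 / (8 * (nu + m%:R) * (nu + m%:R + 1)))].
Proof.
move=> L P normP2 mu Phi E D A2 t h calJ abs_Phi0.
have tt m : 0 < t m by exact: lommel_t_gt0.
have A0 m : 0 < A2 m.+1 by exact: lommel_A2_gt0.
have PE m : P m = jacobi_poly A2 m by exact: monic_oprl_lommel.
have PS m : (P m.+1).[2] = t m * (P m).[2].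
  by rewrite !PE; exact: jacobi_lommel_horner2S.
have P0 m : 0 < (P m).[2] by rewrite PE; exact: jacobi_lommel_horner2_gt0.
have normE m : normP2 m = h m by exact: monic_oprl_lommel_norm.
have PhiE m : (Phi m).[0] = ((-1) ^+ m * (t m - 1))%:C%C.
  exact: monic_opuc_lommel0.
have absE m : abs_Phi0 m = `|t m - 1|.
  rewrite /abs_Phi0 PhiE normc_def /= expr0n addr0 sqrtr_sqr normrM normrX.
  by rewrite normrN1 expr1n mul1r.
have PhiSE m : (1 <= m)%N -> 1 - (Phi m).[0] ^+ 2 = (A2 m * (t m / t m.-1))%:C%C.
  case: m => // m _; rewrite PhiE -[1 in LHS](rmorph1 (real_complex R)).
  rewrite -rmorphXn -rmorphB exprMn sqrr_sign mul1r; congr (_%:C)%C.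
  exact: lommel_t_sqr.
have calJE : calJ = clifford (beta ^+ 2 / 4) nu (1 / 4) by exact: clifford_quarter_besselJ.
have cvgP : (fun N : nat => (P N.+1).[2] / 2 ^+ N.+1) @ \oo --> calJ.
  have := cvg_jacobi_lommel hnu hbeta0; rewrite -cvg_shiftS calJE.
  by under eq_fun do rewrite -PE.
have two_sub m : (1 <= m)%N -> 2 - t m = A2 m / t m.-1.
  by case: m => // m _; exact: lommel_t_sub2.
have near_abs : \forall m \near \oo, 1 < t m /\ 1 - abs_Phi0 m = 2 - t m.
  have t1 : \forall m \near \oo, 1 < t m.
    have /cvgrPdist_lt/(_ 1 ltr01) := cvg_lommel_t hnu hbeta0 hbeta.
    by apply: filterS => m; rewrite ltr_norml => /andP[_]; rewrite -/t; lra.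
  apply: filterS t1 => m t1; split=> //.
  by rewrite absE gtr0_norm ?subr_gt0//; lra.
split; first by move=> m; split; [|exact: prediction_error_lommel|].
split.
  split => //.
  - have -> : (fun n : nat => \prod_(1 <= m < n.+1) (t m / 2)) =
        fun N => (P N.+1).[2] / 2 ^+ N.+1.
      by apply/funext => n; rewrite PE jacobi_lommel_horner2E.
    exact: cvgP.
  - by rewrite calJE; exact: lommel_prod_bounds.
  - move=> N; rewrite [LHS]toeplitz_det_lommel//; congr (_ * _)%:C%C.
    by apply: eq_bigr => m _; rewrite normE.
split.
  move=> small; have inc m : (1 <= m)%N -> t m < t m.+1.
    by case: m => // m _; exact: lommel_t_increasing.
  have incV m : (2 <= m)%N -> t m.-1 < t m by case: m => [|[|m]]// _; exact: inc.
  have ratio_gt1 m : (2 <= m)%N -> 1 < t m / t m.-1.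
    by move=> m2; rewrite ltr_pdivlMr// mul1r incV.
  split=> //.
  - split=> [[|[|m]]// _|].
      have -> : (P m.+3).[2] * (P m.+1).[2] = t m.+2 * ((P m.+2).[2] * (P m.+1).[2]).
        by rewrite (PS m.+2) mulrA.
      have -> : (P m.+2).[2] ^+ 2 = t m.+1 * ((P m.+2).[2] * (P m.+1).[2]).
        by rewrite expr2 {1}(PS m.+1) mulrAC mulrA.
      by rewrite ltr_pM2r ?mulr_gt0// inc.
    (* Here the comparison is between [t 1] and [t 0 = 2], whence the opposite inequality. *)
    rewrite (PS 1%N) mulrAC expr2 ltr_pM2r// (PS 0%N) ltr_pM2r//.
    exact: lommel_t_lt2.
  - move=> m m2; split; first by apply: PhiSE; exact: ltnW.
    rewrite ltr_pMr ?ratio_gt1//; case: m m2 => // m _; exact: A0.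
  - by move=> m m2; rewrite ln_gt0 ?ratio_gt1.
  - exact: cvg_sum_ln_lommel_t.
split=> //.
- move=> m m1; rewrite PhiSE//=; congr ln.
  by case: m m1 => // m _; rewrite mulrC mulKf// gt_eqF.
- exact: ln_lommel_t_ratio_O2.
- exact: two_sub_lommel_t_O2.
(* Eventually [1 - abs_Phi0 m] equals [2 - t m], and [A2 m / 2] is the stated equivalent, so the
   same [eps] works. *)
- have [eps [epsO epsE]] := two_sub_lommel_t_O2 hnu hbeta0 hbeta.
  exists eps; split=> //; near=> m.
  have [_ ->] : 1 < t m /\ 1 - abs_Phi0 m = 2 - t m by near: m.
  have -> : 2 - t m = A2 m / 2 * (1 + eps m) by near: m.
  by congr (_ * _); rewrite /A2 /lommel_A2 -[LHS]mulrA -invfM; congr (_ / _); ring.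
Unshelve. all: by end_near. Qed.
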